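(* Let $\Omega\subseteq\mathbb{R}^N$ satisfy the standing assumptions below and let $\ell\ge2$ be an integer with $\lambda_\ell(\Omega)<\mathcal{E}(\Omega)$. Then for every $j=1,\dots,\ell$: (1) $\lambda_j(\Omega)$ is an eigenvalue of the Dirichlet Laplacian on $\Omega$, i.e. there is $u_j\in\mathcal{S}_2(\Omega)$ with $\int_\Omega\langle\nabla u_j,\nabla\varphi\rangle dx=\lambda_j(\Omega)\int_\Omega u_j\varphi\,dx$ for all $\varphi\in W^{1,2}_0(\Omega)$; the functions $u_1,\dots,u_j$ can be chosen orthonormal in $L^2(\Omega)$, and \[ \lambda_j(\Omega)=\min\Big\{\int_\Omega|\nabla u|^2dx:\ u\in\mathcal{S}_2(\Omega),\ \int_\Omega u\,u_m\,dx=0\ \text{for }m=1,\dots,j-1\Big\}, \] the minimum being attained by $u_j$; (2) with $\Omega_n$ ($n\ge r_0$) the truncated sets defined below, for every $n$ there are eigenfunctions $u^n_1,\dots,u^n_j\in\mathcal{S}_2(\Omega_n)$ of the Dirichlet Laplacian on $\Omega_n$, associated with $\lambda_1(\Omega_n),\dots,\lambda_j(\Omega_n)$, forming an orthonormal set in $L^2(\Omega_n)$, such that (extending them by zero and up to a subsequence) $\lim_{n\to\infty}\|u^n_m-u_m\|_{L^2(\Omega)}=0$ for $m=1,\dots,j$.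
   Context: Standing assumptions: $N\ge2$ and $\Omega=\Omega_0\cup\bigcup_{i=1}^k\mathcal{C}_i$ with $k\ge1$, where (A1) $\Omega_0\subseteq\mathbb{R}^N$ is a bounded open set (possibly empty); (A2) for each $i$, $\mathcal{C}_i=\mathbf{R}_i(E_i\times(0,+\infty))+\mathbf{t}_i$, where $E_i\subseteq\mathbb{R}^{N-1}$ is open, bounded and connected, $\mathbf{R}_i$ is an $N\times N$ orthogonal matrix and $\mathbf{t}_i\in\mathbb{R}^N$; (A3) there is $\varrho_0>0$ with $(\mathcal{C}_i\cap\mathcal{C}_j)\setminus B_{\varrho_0}(0)=\emptyset$ for $i\neq j$. For $r>0$ set $Q^i_r=\mathbf{R}_i((-r,r)^N)+\mathbf{t}_i$, $\Omega^i_r=\Omega_0\cup(Q^i_r\cap\mathcal{C}_i)$, $\Omega_r=\bigcup_{i=1}^k\Omega^i_r$; $r_0>0$ is fixed so large that for every $r\ge r_0$, $\Omega\setminus\Omega_r=\bigcup_{i=1}^k(\mathcal{C}_i\setminus Q^i_r)$ is a disjoint union. For an open set $A$, $W^{1,2}_0(A)$ is the closure of $C^\infty_0(A)$ in $W^{1,2}(A)$, $\mathcal{S}_2(A)=\{\varphi\in W^{1,2}_0(A):\|\varphi\|_{L^2(A)}=1\}$ and \[ \lambda_j(A)=\inf\Big\{\max_{\varphi\in F\cap\mathcal{S}_2(A)}\int_A|\nabla\varphi|^2dx:\ F\subseteq W^{1,2}_0(A)\text{ subspace},\ \dim F=j\Big\}. \] $\lambda_1(E_i)$ is the first Dirichlet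 eigenvalue of $E_i\subseteq\mathbb{R}^{N-1}$ and $\mathcal{E}(\Omega)=\min\{\lambda_1(E_1),\dots,\lambda_1(E_k)\}$. *)

(* Defs.v *)
From HB Require Import structures.
From mathcomp Require Import all_boot all_order all_algebra.
From mathcomp Require Import all_classical all_reals all_analysis.

Set Implicit Arguments.
Unset Strict Implicit.
Unset Printing Implicit Defensive.

Import Order.TTheory GRing.Theory Num.Theory.
Import numFieldNormedType.Exports.

Local Open Scope classical_set_scope.
Local Open Scope ring_scope.

Section Dirichlet.
Variable R : realType.

Definition evec (d : nat) (i : 'I_d) : 'rV[R]_d := delta_mx 0 i.

Definition enorm (d : nat) (x : 'rV[R]_d) : R :=
  Num.sqrt (\sum_(i < d) x 0 i ^+ 2).

Definition pderiv (d : nat) (i : 'I_d) (f : 'rV[R]_d -> R) : 'rV[R]_d -> R :=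
  fun x => 'D_(evec i) f x.

Fixpoint ipderiv (d : nat) (s : seq 'I_d) (f : 'rV[R]_d -> R) : 'rV[R]_d -> R :=
  match s with
  | [::] => f
  | i :: s' => pderiv i (ipderiv s' f)
  end.

Definition smooth (d : nat) (f : 'rV[R]_d -> R) : Prop :=
  forall s : seq 'I_d,
    continuous (ipderiv s f) /\
    (forall (i : 'I_d) (x : 'rV[R]_d), derivable (ipderiv s f) x (evec i)).

Definition test_fun (d : nat) (A : set 'rV[R]_d) (f : 'rV[R]_d -> R) : Prop :=
  smooth f /\
  exists K : set 'rV[R]_d, compact K /\ K `<=` A /\ (forall x, ~ K x -> f x = 0).

(* Integral over R^d of (continuous compactly supported) functions, as the
   iterated one-dimensional Lebesgue integral (Fubini). Coordinates are
   indexed by nat; coordinates >= n are set to 0. *)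
Fixpoint iint (n : nat) (f : (nat -> R) -> R) : R :=
  match n with
  | 0 => f (fun _ => 0)
  | m.+1 => Rintegral (@lebesgue_measure R) setT
              (fun x : R => iint m (fun y => f (fun i => if i == m then x else y i)))
  end.

Definition intRd (d : nat) (f : 'rV[R]_d -> R) : R :=
  iint d (fun y => f (\row_(i < d) y (nat_of_ord i))).

Definition L2ip_f (d : nat) (f g : 'rV[R]_d -> R) : R :=
  intRd (fun x => f x * g x).
Definition Dform_f (d : nat) (f g : 'rV[R]_d -> R) : R :=
  intRd (fun x => \sum_(i < d) pderiv i f x * pderiv i g x).

(* Elements of W^{1,2}_0(A) (closure of C^infty_0(A) in W^{1,2}) are
   represented by W^{1,2}-Cauchy sequences of test functions in C^infty_0(A)
   (functions on R^d vanishing outside A, i.e. extended by zero). *)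
Definition Wseq (d : nat) := nat -> 'rV[R]_d -> R.

Definition W0 (d : nat) (A : set 'rV[R]_d) (u : Wseq d) : Prop :=
  (forall k, test_fun A (u k)) /\
  (forall eps : R, 0 < eps -> exists K : nat, forall k l : nat, (K <= k)%N -> (K <= l)%N ->
     L2ip_f (u k \- u l) (u k \- u l) + Dform_f (u k \- u l) (u k \- u l) < eps).

Definition ip (d : nat) (u v : Wseq d) : R := limn (fun k => L2ip_f (u k) (v k)).
Definition Dform (d : nat) (u v : Wseq d) : R := limn (fun k => Dform_f (u k) (v k)).
Definition energy (d : nat) (u : Wseq d) : R := Dform u u.
Definition L2dist (d : nat) (u v : Wseq d) : R :=
  Num.sqrt (ip (fun k => u k \- v k) (fun k => u k \- v k)).

Definition S2 (d : nat) (A : set 'rV[R]_d) (u : Wseq d) : Prop :=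
  W0 A u /\ ip u u = 1.

Definition lincomb (d j : nat) (c : 'I_j -> R) (v : 'I_j -> Wseq d) : Wseq d :=
  fun k x => \sum_(m < j) c m * v m k x.

Definition lin_indep (d j : nat) (v : 'I_j -> Wseq d) : Prop :=
  forall c : 'I_j -> R,
    ip (lincomb c v) (lincomb c v) + energy (lincomb c v) = 0 -> forall m, c m = 0.

Definition lambda (d : nat) (A : set 'rV[R]_d) (j : nat) : \bar R :=
  ereal_inf [set x : \bar R | exists v : 'I_j -> Wseq d,
    (forall m, W0 A (v m)) /\ lin_indep v /\
    x = ereal_sup [set y : \bar R | exists c : 'I_j -> R,
          ip (lincomb c v) (lincomb c v) = 1 /\ y = (energy (lincomb c v))%:E]].

Definition eigfun (d : nat) (A : set 'rV[R]_d) (lam : \bar R) (u : Wseq d) : Prop :=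
  S2 A u /\ exists l : R, lam = l%:E /\
    forall phi : Wseq d, W0 A phi -> Dform u phi = l * ip u phi.

Definition orthonormal_fam (d j : nat) (u : 'I_j -> Wseq d) : Prop :=
  forall m m' : 'I_j, ip (u m) (u m') = (m == m')%:R.

(* cylinder R (E x (0,+oo)) + t in R^{n+1}; matrices act on column vectors,
   so with row vectors M x is written x *m M^T *)
Definition cylinder (n : nat) (E : set 'rV[R]_n) (M : 'M[R]_n.+1) (t : 'rV[R]_n.+1)
  : set 'rV[R]_n.+1 :=
  [set x | exists (y : 'rV[R]_n) (s : R), E y /\ 0 < s /\
     x = castmx (erefl 1%N, addn1 n) (row_mx y (s%:M : 'rV[R]_1)) *m M^T + t].

Definition cube (N : nat) (M : 'M[R]_N) (t : 'rV[R]_N) (r : R) : set 'rV[R]_N :=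
  [set x | exists z : 'rV[R]_N, (forall i, `|z 0 i| < r) /\ x = z *m M^T + t].

Definition orthogonal_mx (N : nat) (M : 'M[R]_N) : Prop := M *m M^T = 1%:M.

End Dirichlet.

(* Main.v *)
Require Import Defs.
From HB Require Import structures.
From mathcomp Require Import all_boot all_order all_algebra.
From mathcomp Require Import all_classical all_reals all_analysis.
From mathcomp Require Import ring lra.
Set Implicit Arguments.
Unset Strict Implicit.
Unset Printing Implicit Defensive.
Import Order.TTheory GRing.Theory Num.Theory.
Import numFieldNormedType.Exports.
Local Open Scope classical_set_scope.
Local Open Scope ring_scope.

(** No compact embedding is used.  For every e > 0 there are finitely many test
    functions a_i with |u|^2 <= e |grad u|^2 + sum_i <u, a_i>^2 for all test
    functions u supported in a given box (the kernel of a Landau-type mollifier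
    is a polynomial of x and y, hence of finite rank).  Cutting u off far out in
    the tubes, where the Poincare inequality of the cross-sections applies slice
    by slice, this upgrades on Omega to
      mu |u|^2 <= |grad u|^2 + sum_i <u, a_i>^2    for every mu < E(Omega).
    Consequently a minimizing sequence of energy below mu is Cauchy in W^{1,2}
    as soon as its finitely many coefficients <w_n, a_i> converge, which yields
    the eigenfunctions.  For the truncations, test u^n_m against u^{n'}_m:
      |grad (u^n_m - u^{n'}_m)|^2
        = (lam^n_m - lam^{n'}_m) + lam^{n'}_m |u^n_m - u^{n'}_m|^2   (n <= n'),
    where lam^n_m decreases in n.  The limit of lam^n_m is at most
    lambda_m(Omega) < mu by the variational characterization, so the same
    inequality makes u^n_m Cauchy along a subsequence on which the coefficients
    converge, and the limits are the required eigenfunctions on Omega. *)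

(** * Iterated integrals *)

(** Elements of W_0^{1,2} are Cauchy sequences of test functions and integrals are iterated
    one-dimensional ones. The integral estimates are therefore made for continuous functions of
    compact support, where Fubini and rotation invariance have elementary proofs, and they pass to
    the limit by bounds in the W^{1,2} norm. The finite-codimension inequality comes from averaging
    the translation estimate |u(. + z) - u|^2 <= |z|^2 |grad u|^2 against a kernel concentrated at
    0; the cross terms form the finite-rank part. Cutting off costs part of a spectral gap, so the
    tubes are used at a level mu0 > mu. Tubes may meet each other and Omega_0 near the origin; the
    cut-off pieces therefore live only beyond r_0, where they are disjoint. The truncated sets are
    bounded, so eigenfunctions exist on them at every level, once they are known to be nonempty.
    Orthogonality to the earlier truncated eigenfunctions is a constraint that varies with n; it is
    replaced by an inequality for arbitrary functions with their projections subtracted, and this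
    inequality passes to the limit. *)

Section Int1.
Variable R : realType.
Implicit Types (f g F : R -> R) (B : R).

Local Notation int1 f := (Rintegral (@lebesgue_measure R) setT f).

Lemma int1_itv f (a b : R) : (forall x, x < a \/ b < x -> f x = 0) ->
  int1 f = Rintegral (@lebesgue_measure R) `[a, b] f.
Proof.
move=> f0; rewrite [RHS]Rintegral_mkcond; apply: eq_Rintegral => x _.
rewrite patchE; case: ifPn => // /negP xB; apply: f0.
case: (ltP x a) => xa; first by left.
right; rewrite ltNge; apply/negP => xb; apply: xB.
by rewrite inE /= in_itv /= xa xb.
Qed.

Lemma int1_integrable f B : continuous f -> (forall x, B < `|x| -> f x = 0) ->
  (@lebesgue_measure R).-integrable setT (EFin \o f).
Proof.
move=> cf f0.
have -> : EFin \o f = (EFin \o f) \_ `[- B, B].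
  apply/funext => x; rewrite patchE; case: ifPn => // /negP xB /=.
  rewrite f0// ltNge; apply/negP => xB'; apply: xB; rewrite inE /= in_itv /=.
  by rewrite -ler_norml.
apply/integrable_restrict => //; rewrite setTI.
by apply: continuous_compact_integrable;
  [exact: segment_compact | exact: continuous_subspaceT].
Qed.

Lemma int1D f g B : continuous f -> continuous g ->
  (forall x, B < `|x| -> f x = 0) -> (forall x, B < `|x| -> g x = 0) ->
  int1 (fun x => f x + g x) = int1 f + int1 g.
Proof.
by move=> cf cg f0 g0; apply: RintegralD => //; [exact: int1_integrable cf f0|exact: int1_integrable cg g0].
Qed.

Lemma int1Z f B (a : R) : continuous f -> (forall x, B < `|x| -> f x = 0) ->
  int1 (fun x => a * f x) = a * int1 f.
Proof. by move=> cf f0; apply: RintegralZl => //; apply: (int1_integrable cf f0). Qed.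

Lemma int1_ge0 f : (forall x, 0 <= f x) -> 0 <= int1 f.
Proof. by move=> f0; apply: Rintegral_ge0. Qed.

Lemma deriv_continuous (f F : R -> R) : (forall x, is_derive x (1 : R) F (f x)) ->
  continuous F.
Proof.
move=> dF x; apply: differentiable_continuous; apply/derivable1_diffP.
by have := dF x; case.
Qed.

(** Reduces a one-dimensional integral to a primitive; bounds, positivity and Riemann sums then
    follow from the mean value theorem, substitutions from the chain rule. *)
Lemma int1_FTC f F (a b : R) : a < b -> continuous f ->
  (forall x, x < a \/ b < x -> f x = 0) ->
  (forall x, is_derive x (1 : R) F (f x)) -> int1 f = F b - F a.
Proof.
move=> ab cf f0 dF; have cF := deriv_continuous dF.
rewrite (int1_itv f0) /Rintegral (@continuous_FTC2 _ f F)//.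
- exact: continuous_subspaceT.
- split.
  + by move=> x _; have := dF x; case.
  + by apply: cvg_at_right_filter; apply: cF.
  + by apply: cvg_at_left_filter; apply: cF.
- by move=> x _; rewrite derive1E; apply: derive_val.
Qed.

Lemma antiderivative_exists f B : continuous f -> (forall x, B < `|x| -> f x = 0) ->
  exists F, forall x, is_derive x (1 : R) F (f x).
Proof.
move=> cf f0.
(* Integration from -oo gives one primitive on the whole line; bounded support makes f
   integrable. *)
exists (fun x => (\int[@lebesgue_measure R]_(t in [set` Interval -oo%O (BRight x)]) (f t))%R) => x.
have xu : x < x + 1 by rewrite ltrDl.
have ifx : (@lebesgue_measure R).-integrable [set` Interval -oo%O (BRight (x + 1))] (EFin \o f).
  by apply: (integrableS measurableT _ _ (int1_integrable cf f0)).
have [|d1 d2] := continuous_FTC1 xu ifx _ (cf x); first by rewrite ltNyr.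
by apply: DeriveDef; [exact: d1 | rewrite -derive1E; exact: d2].
Qed.

(** The condition [e * e = 1] treats translations and reflections together: it makes
    [e * F (c + e * x)] a primitive of the composed function whenever F is one of f. *)
Lemma int1_aff f B (c e : R) : 0 < B -> e * e = 1 -> continuous f ->
  (forall x, B < `|x| -> f x = 0) -> int1 (fun x => f (c + e * x)) = int1 f.
Proof.
move=> B0 ee cf f0; have [F dF] := antiderivative_exists cf f0.
have e0 : e = 1 \/ e = -1.
  have : (e - 1) * (e + 1) = 0 by rewrite -subr_sqr expr1n expr2 ee subrr.
  by move/eqP; rewrite mulf_eq0 => /orP[] /eqP h; [left|right]; lra.
(* Large enough for [c - C, c + C] to contain the support of f and for [-C, C] to contain that of
   the composed function. *)
pose C := B + `|c|.
have [cle Ncle] : c <= `|c| /\ - c <= `|c| by rewrite ler_norm -normrN ler_norm.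
have caff : continuous (fun x : R => c + e * x).
  move=> x; apply: cvgD; first exact: cvg_cst.
  by apply: cvgM; [exact: cvg_cst|exact: cvg_id].
have C0 : - C < C by rewrite /C; have := normr_ge0 c; lra.
have C1 : c - C < c + C by lra.
have -> : int1 f = F (c + C) - F (c - C).
  refine (int1_FTC C1 cf _ dF) => x h; apply: f0.
  by case: h => h; rewrite ltr_normr; apply/orP; [right|left]; rewrite /C in h; lra.
have -> : int1 (fun x => f (c + e * x)) = e * F (c + e * C) - e * F (c + e * - C).
  refine (@int1_FTC _ (fun x => e * F (c + e * x)) _ _ C0 _ _ _).
  - by move=> x; apply: continuous_comp; [exact: caff|exact: cf].
  - move=> x h; apply: f0; rewrite ltr_normr; apply/orP.
    by case: e0 => ->; case: h; rewrite /C ?mul1r ?mulN1r => h; [right|left|left|right]; lra.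
  - move=> x.
    have d1 : is_derive x (1 : R) (fun x => c + e * x) e.
      have := is_deriveD (is_derive_cst c x 1) (is_deriveZ e (is_derive_id x 1)).
      by rewrite add0r /GRing.scale /= mulr1.
    have -> : (fun x => e * F (c + e * x)) = e \*: (F \o (fun x => c + e * x)) by [].
    have d2 := @is_derive1_comp _ F (fun x => c + e * x) _ _ _ (dF (c + e * x)) d1.
    have := is_deriveZ e d2.
    by rewrite /GRing.scale /= mulrCA ee mulr1.
by case: e0 => ->; rewrite ?mul1r ?mulN1r ?opprK; lra.
Qed.

End Int1.

(** * Riemann sums and bounds for one-dimensional integrals *)

Section Riemann.
Variable R : realType.
Local Notation int1 f := (Rintegral (@lebesgue_measure R) setT f).

(** On each cell the mean value theorem writes the increment of a primitive as h times a value of f,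
    and the modulus of continuity compares this value with the one at the left endpoint. *)
Lemma int1_riemann (f : R -> R) (B h e : R) (n : nat) :
  0 < B -> 0 < h -> n%:R * h = 2 * B -> continuous f ->
  (forall x, B < `|x| -> f x = 0) ->
  (forall x y, `|x - y| < 2 * h -> `|f x - f y| <= e) ->
  `|int1 f - \sum_(k < n) h * f (- B + k%:R * h)| <= 2 * B * e.
Proof.
move=> B0 h0 nB cf f0 fe; have [F dF] := antiderivative_exists cf f0.
have cF := deriv_continuous dF.
have step c : `|F (c + h) - F c - h * f c| <= h * e.
  have ch : c < c + h by rewrite ltrDl.
  have [x] := MVT ch (fun z _ => dF z) (continuous_subspaceT cF).
  rewrite in_itv /= => /andP[cx xc] ->.
  rewrite [c + h]addrC addrK mulrC -mulrBr normrM (gtr0_norm h0) ler_pM2l//.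
  by apply: fe; rewrite ger0_norm; lra.
have main m : `|F (- B + m%:R * h) - F (- B) - \sum_(k < m) h * f (- B + k%:R * h)|
    <= m%:R * h * e.
  elim: m => [|m IH]; first by rewrite big_ord0 !mul0r addr0 subrr subr0 normr0.
  rewrite big_ord_recr /=.
  have := step (- B + m%:R * h).
  have -> : - B + m%:R * h + h = - B + m.+1%:R * h by rewrite -natr1; ring.
  set a := F (- B + m.+1%:R * h); set b := F (- B + m%:R * h) in IH *.
  set s := \sum_(_ < _) _ in IH *; set t := h * f _ => st.
  have -> : a - F (- B) - (s + t) = (b - F (- B) - s) + (a - b - t) by lra.
  apply: le_trans (ler_normD _ _) _; rewrite -natr1.
  have -> : (m%:R + 1) * h * e = m%:R * h * e + h * e by ring.
  exact: lerD.
have := main n; rewrite nB.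
suff -> : F (- B + 2 * B) - F (- B) = int1 f by [].
have -> : - B + 2 * B = B by lra.
symmetry; refine (int1_FTC _ cf _ dF).
  lra.
by move=> x [] h1; apply: f0; rewrite ltr_normr; apply/orP; [right|left]; lra.
Qed.

Lemma int1_bound (f : R -> R) (B e : R) : 0 < B -> continuous f ->
  (forall x, B < `|x| -> f x = 0) -> (forall x, `|f x| <= e) ->
  `|int1 f| <= 2 * B * e.
Proof.
move=> B0 cf f0 fe; have [F dF] := antiderivative_exists cf f0.
have BB : - B < B by lra.
have -> : int1 f = F B - F (- B).
  refine (int1_FTC BB cf _ dF).
  by move=> x [] h1; apply: f0; rewrite ltr_normr; apply/orP; [right|left]; lra.
have [x _ ->] := MVT BB (fun z _ => dF z) (continuous_subspaceT (deriv_continuous dF)).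
rewrite opprK normrM mulrC (_ : B + B = 2 * B); last lra.
by rewrite (gtr0_norm (_ : 0 < 2 * B)) ?ler_pM2l//; lra.
Qed.

Lemma int1_gt0 (f : R -> R) (B x0 : R) : continuous f ->
  (forall x, B < `|x| -> f x = 0) -> (forall x, 0 <= f x) -> 0 < f x0 -> 0 < int1 f.
Proof.
move=> cf f0 fge0 fx0.
have cf2 : {for x0, continuous f} by exact: cf.
move/cvgrPdist_lt : (cf2) => /(_ _ (divr_gt0 fx0 (ltr0Sn _ 1))) /= [d /= d0 hd].
have fd x : `|x0 - x| < d -> f x0 / 2 < f x.
  move=> xd; have := hd x xd; rewrite ltr_norml => /andP[_].
  lra.
have [F dF] := antiderivative_exists cf f0.
have cF := deriv_continuous dF.
(* The primitive is nondecreasing, and [-C, C] contains both the support and the interval around x0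
   on which f exceeds f(x0) / 2, where the primitive increases strictly. *)
pose C := `|B| + `|x0| + d.
have [nB nx0] : 0 <= `|B| /\ 0 <= `|x0| by rewrite !normr_ge0.
have [x0le Nx0le] : x0 <= `|x0| /\ - x0 <= `|x0| by rewrite ler_norm -normrN ler_norm.
have Bn : B <= `|B| by rewrite ler_norm.
have -> : int1 f = F C - F (- C).
  refine (int1_FTC _ cf _ dF); first by rewrite /C; lra.
  by move=> x [] h1; apply: f0; rewrite ltr_normr; apply/orP; [right|left]; move: h1; rewrite /C; lra.
have mono x y : x < y -> F x <= F y.
  move=> xy; have [z _ E] := MVT xy (fun z _ => dF z) (continuous_subspaceT cF).
  by rewrite -subr_ge0 E mulr_ge0// subr_ge0 ltW.
have ab : x0 - d / 2 < x0 + d / 2 by lra.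
have [z zin E] := MVT ab (fun z _ => dF z) (continuous_subspaceT cF).
have fz : f x0 / 2 < f z.
  by apply: fd; move: zin; rewrite in_itv /= ltr_norml => /andP[h1 h2]; lra.
have p : 0 < f z * (x0 + d / 2 - (x0 - d / 2)) by rewrite mulr_gt0//; lra.
have m1 : F (- C) <= F (x0 - d / 2) by apply: mono; rewrite /C; lra.
have m2 : F (x0 + d / 2) <= F C by apply: mono; rewrite /C; lra.
by rewrite -E in p; lra.
Qed.
End Riemann.

(** * Exchange of two one-dimensional integrals *)

Section Iter.
Variable R : realType.
Local Notation int1 f := (Rintegral (@lebesgue_measure R) setT f).
Implicit Types (f g : (nat -> R) -> R) (y z : nat -> R).

Lemma int1_0 : int1 (fun _ => 0) = 0.
Proof. by rewrite Rintegral_cst// mul0r. Qed.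

Lemma continuous_bigsum (T : topologicalType) (I : Type) (r : seq I) (F : I -> T -> R) :
  (forall k, continuous (F k)) -> continuous (fun x => \sum_(k <- r) F k x).
Proof.
move=> cF x; have -> : (fun x => \sum_(i <- r) F i x) = \sum_(i <- r) F i.
  by apply/funext => z; rewrite fct_sumE.
by elim/big_ind : _ => [|a b ca cb|i _];
  [exact: cvg_cst|apply: cvgD; [exact: ca|exact: cb]|exact: cF].
Qed.

Lemma int1_sum (n : nat) (F : 'I_n -> R -> R) (B : R) : (forall k, continuous (F k)) ->
  (forall k x, B < `|x| -> F k x = 0) ->
  int1 (fun x => \sum_(k < n) F k x) = \sum_(k < n) int1 (F k).
Proof.
elim: n F => [|n IH] F cF F0.
  by rewrite big_ord0 -[RHS]int1_0; apply: eq_Rintegral => x _; rewrite big_ord0.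
rewrite big_ord_recr /= -IH//; last by move=> k; exact: F0.
have -> : (fun x => \sum_(k < n.+1) F k x) = (fun x => \sum_(k < n) F (widen_ord (leqnSn n) k) x + F ord_max x).
  by apply/funext => x; rewrite big_ord_recr.
apply: (@int1D _ _ _ B) => //; last exact: F0.
  exact: continuous_bigsum.
by move=> x Bx; rewrite big1// => i _; exact: F0.
Qed.

Lemma int1B (f g : R -> R) (B : R) : continuous f -> continuous g ->
  (forall x, B < `|x| -> f x = 0) -> (forall x, B < `|x| -> g x = 0) ->
  int1 (fun x => f x - g x) = int1 f - int1 g.
Proof.
move=> cf cg f0 g0.
have -> : - int1 g = int1 (fun x => - 1 * g x) by rewrite (@int1Z _ _ B)// mulN1r.
rewrite -(@int1D _ _ _ B)//.
- by apply: eq_Rintegral => x _; rewrite mulN1r.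
- by move=> x; apply: cvgM; [exact: cvg_cst|exact: cg].
- by move=> x Bx; rewrite g0// mulr0.
Qed.

(* Integrands are functions of infinitely many coordinates, so that changing the
   order of integration amounts to permuting a list of indices. *)
Definition upd y i (x : R) : nat -> R := fun k => if k == i then x else y k.
Definition Jop i f : (nat -> R) -> R := fun y => int1 (fun x => f (upd y i x)).
(** Only coordinates below [N] are compared, so this also says that f depends on no others. *)
Definition UC N f := forall e : R, 0 < e -> exists2 d : R, 0 < d &
  forall y z, (forall k, (k < N)%N -> `|y k - z k| < d) -> `|f y - f z| < e.
Definition VS (B : R) i f := forall y, B < `|y i| -> f y = 0.

Lemma updC y i j a b : i != j -> upd (upd y i a) j b = upd (upd y j b) i a.
Proof.
move=> ij; apply/funext => k; rewrite /upd; case: eqP => [->|//].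
by rewrite eq_sym (negbTE ij).
Qed.

Lemma upd_dist y i a b k : `|upd y i a k - upd y i b k| <= `|a - b|.
Proof. by rewrite /upd; case: eqP => //; rewrite subrr normr0. Qed.

Lemma upd_dist2 y z i a k (d : R) : 0 < d -> `|y k - z k| < d ->
  `|upd y i a k - upd z i a k| < d.
Proof. by rewrite /upd; case: eqP => //; rewrite subrr normr0. Qed.

Lemma UC_slice N f y i : UC N f -> continuous (fun x => f (upd y i x)).
Proof.
move=> uf x; apply/cvgrPdist_lt => e /uf[d d0 fd].
exists d => //= t; rewrite /ball_ /= => xt; apply: fd => k _.
exact: le_lt_trans (upd_dist _ _ _ _ _) xt.
Qed.

Lemma VS_slice (B : R) f y i x : VS B i f -> B < `|x| -> f (upd y i x) = 0.
Proof. by move=> vf xB; apply: vf; rewrite /upd eqxx. Qed.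

Section class.
Variables (N : nat) (B : R).
Hypothesis B0 : 0 < B.

Lemma Jop_UC i f : UC N f -> VS B i f -> UC N (Jop i f).
Proof.
move=> uf vf e e0.
have e1 : 0 < e / (4 * B) by rewrite divr_gt0// mulr_gt0.
have [d d0 fd] := uf _ e1; exists d => // y z yz.
rewrite /Jop -(@int1B _ _ B); [|exact: UC_slice uf|exact: UC_slice uf|
  by move=> x; exact: VS_slice|by move=> x; exact: VS_slice].
apply: (@le_lt_trans _ _ (2 * B * (e / (4 * B)))).
  apply: int1_bound => //.
  - by move=> x; apply: cvgB; apply: UC_slice uf _.
  - by move=> x Bx; rewrite !(VS_slice _ vf Bx) subrr.
  - by move=> x; apply: ltW; apply: fd => k kN; apply: upd_dist2; [|exact: yz].
have -> : 2 * B * (e / (4 * B)) = e / 2 by field; rewrite gt_eqF.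
lra.
Qed.

Lemma Jop_VS i k f : k != i -> VS B k f -> VS B k (Jop i f).
Proof.
move=> ki vf y yk; rewrite /Jop -[RHS]int1_0; apply: eq_Rintegral => x _.
by apply: vf; rewrite /upd (negbTE ki).
Qed.

(** Fubini by Riemann sums: the integral in the i-th variable is replaced by a finite sum, on both
    sides the same one, and uniform continuity makes the two errors arbitrarily small. *)
Lemma Jop_comm i j f y : i != j -> UC N f -> VS B i f -> VS B j f ->
  Jop i (Jop j f) y = Jop j (Jop i f) y.
Proof.
move=> ij uf vi vj.
have ji : j != i by rewrite eq_sym.
apply/eqP; rewrite -subr_eq0 -normr_le0; apply/ler_addgt0Pr => e e0.
(* Each of the two Riemann errors below is at most 4 B^2 e', that is e / 2. *)
rewrite add0r; pose e' := e / (8 * B * B).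
have e'0 : 0 < e' by rewrite divr_gt0// !mulr_gt0.
have [d d0 fd] := uf _ e'0.
pose n := (Num.truncn (4 * B / d)).+1.
have n0 : (0 : R) < n%:R by rewrite ltr0n.
pose h := 2 * B / n%:R.
have h0 : 0 < h by rewrite divr_gt0// mulr_gt0.
have nh : n%:R * h = 2 * B by rewrite /h mulrC divfK// gt_eqF.
have hd : 2 * h < d.
  have : 4 * B / d < n%:R by apply: truncnS_gt.
  rewrite ltr_pdivrMr// => hn.
  by rewrite -(ltr_pM2r n0) [d * _]mulrC -mulrA [h * _]mulrC nh; lra.
pose a (k : nat) := - B + k%:R * h.
have uJ i' : VS B i' f -> UC N (Jop i' f) by move=> v; exact: Jop_UC.
have modJ (y' : nat -> R) (x x' : R) : `|x - x'| < 2 * h ->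
    `|Jop j f (upd y' i x) - Jop j f (upd y' i x')| <= 2 * B * e'.
  move=> xx; rewrite /Jop -(@int1B _ _ B); [|exact: UC_slice uf|exact: UC_slice uf|
    by move=> w; exact: VS_slice|by move=> w; exact: VS_slice].
  apply: int1_bound => //.
  - by move=> w; apply: cvgB; apply: UC_slice uf _.
  - by move=> w Bw; rewrite !(VS_slice _ vj Bw) subrr.
  - move=> w; apply: ltW; apply: fd => k kN; apply: upd_dist2 => //.
    by apply: le_lt_trans (upd_dist _ _ _ _ _) (lt_trans xx hd).
have L := int1_riemann B0 h0 nh (UC_slice (y := y) (i := i) (uJ j vj))
   (fun x => VS_slice y (Jop_VS ij vi)) (modJ y).
have Rz x : `|Jop i f (upd y j x) - \sum_(k < n) h * f (upd (upd y j x) i (a k))| <= 2 * B * e'.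
  apply: (int1_riemann B0 h0 nh (UC_slice (y := upd y j x) (i := i) uf)
   (fun w => VS_slice (upd y j x) vi)) => w w' ww.
  apply: ltW; apply: fd => k _; apply: le_lt_trans (upd_dist _ _ _ _ _) (lt_trans ww hd).
have cfs (k : nat) : continuous (fun x => f (upd (upd y j x) i (a k))).
  rewrite (_ : (fun x => _) = (fun x => f (upd (upd y i (a k)) j x))); first exact: UC_slice uf.
  by apply/funext => w; rewrite updC.
have cS : continuous (fun x => \sum_(k < n) h * f (upd (upd y j x) i (a k))).
  apply: continuous_bigsum => k.
  by move=> x; apply: cvgM; [exact: cvg_cst|exact: cfs].
(* The exchange itself: a finite sum commutes with the integral in the j-th variable. *)
have E : \sum_(k < n) h * Jop j f (upd y i (a k)) =
    int1 (fun x => \sum_(k < n) h * f (upd (upd y j x) i (a k))).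
  rewrite (@int1_sum _ _ B).
  - apply: eq_bigr => k _; rewrite /Jop -(@int1Z _ _ B).
    + by apply: eq_Rintegral => x _; rewrite updC.
    + exact: UC_slice uf.
    + by move=> x; exact: VS_slice.
  - move=> k x; apply: cvgM; first exact: cvg_cst.
    exact: cfs.
  - by move=> k x Bx; rewrite updC// (VS_slice _ vj Bx) mulr0.
have Rr : `|Jop j (Jop i f) y - \sum_(k < n) h * Jop j f (upd y i (a k))| <= 2 * B * (2 * B * e').
  rewrite E {1}/Jop -(@int1B _ _ B).
  - apply: int1_bound => //.
    + by move=> x; apply: cvgB; [exact: (UC_slice (uJ i vi))|exact: cS].
    + move=> x Bx; rewrite (VS_slice _ (Jop_VS ji vj) Bx)// big1 ?subrr// => k _.
      by rewrite updC// (VS_slice _ vj Bx) mulr0.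
  - exact: (UC_slice (uJ i vi)).
  - exact: cS.
  - by move=> x Bx; rewrite (VS_slice _ (Jop_VS ji vj) Bx).
  - by move=> x Bx; rewrite big1// => k _; rewrite updC// (VS_slice _ vj Bx) mulr0.
have -> : e = 2 * B * (2 * B * e') + 2 * B * (2 * B * e').
  by rewrite /e'; field; rewrite gt_eqF.
set S := \sum_(k < n) _ in L Rr.
have -> : Jop i (Jop j f) y - Jop j (Jop i f) y =
    (Jop i (Jop j f) y - S) - (Jop j (Jop i f) y - S).
  move: (Jop i _ y) (Jop j _ y) S {L Rr Rz E cS cfs modJ} => u v S; ring.
by apply: le_trans (ler_normB _ _) _; apply: lerD; [exact: L|exact: Rr].
Qed.

End class.
End Iter.

Section Js.
Variable R : realType.
Implicit Types (f g : (nat -> R) -> R) (y z : nat -> R) (s : seq nat).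

(** The head of the list is the innermost integral. *)
Definition Js s f := foldl (fun g i => Jop i g) f s.

Lemma Js_ge0 s f y : (forall y, 0 <= f y) -> 0 <= Js s f y.
Proof.
by elim: s f => //= i s IH f f0; apply: IH => z; apply: int1_ge0.
Qed.

Lemma Js_eq s f g w : (forall z, (forall k, k \notin s -> z k = w k) -> f z = g z) ->
  Js s f w = Js s g w.
Proof.
elim: s f g => /= [|i s IH] f g fg; first exact: fg.
apply: IH => z zw; apply: eq_Rintegral => x _; apply: fg => k.
by rewrite inE negb_or /upd => /andP[/negbTE -> ks]; exact: zw.
Qed.

Lemma Js_ext s f g w : (forall z, f z = g z) -> Js s f w = Js s g w.
Proof. by move=> fg; apply: Js_eq => z _. Qed.

Lemma Js_upd s i f y x : i \notin s -> Js s f (upd y i x) = Js s (fun z => f (upd z i x)) y.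
Proof.
elim: s f => //= j s IH f; rewrite inE negb_or => /andP[ij js].
rewrite IH//; apply: Js_ext => z; apply: eq_Rintegral => t _.
by rewrite updC.
Qed.

Lemma iint_Js n f : iint n f = Js (iota 0 n) f (fun _ => 0).
Proof.
elim: n f => // n IH f.
have -> : iota 0 n.+1 = rcons (iota 0 n) n.
  by rewrite -cats1 -[[:: n]]/(iota (0 + n) 1) -iotaD addn1.
rewrite /Js foldl_rcons -/(Js _ _) /= {1}/Jop; apply: eq_Rintegral => x _.
by rewrite Js_upd ?IH// mem_iota /= add0n ltnn.
Qed.

Lemma Js_0 s y : Js s (fun _ => 0) y = 0.
Proof.
elim: s y => //= i s IH y; rewrite -[RHS](IH y); apply: Js_ext => z.
exact: int1_0.
Qed.

Lemma Js_rename c s g z : Js (map (addn c) s) (fun z => g (fun k => z (c + k)%N)) z =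
  Js s g (fun k => z (c + k)%N).
Proof.
elim: s g => //= i s IH g; rewrite -IH; apply: Js_ext => w.
apply: eq_Rintegral => x _; congr (g _); apply/funext => k.
by rewrite /upd eqn_add2l.
Qed.

Section class.
Variables (N : nat) (B : R).
Hypothesis B0 : 0 < B.

Definition Jclass s f := UC N f /\ forall i, i \in s -> VS B i f.

Lemma Jclass_cons i s f : uniq (i :: s) -> Jclass (i :: s) f -> Jclass s (Jop i f).
Proof.
move=> /= /andP[nis us] [uf vf]; split; first by apply: (Jop_UC B0 uf); apply: vf; rewrite mem_head.
move=> k ks; apply: Jop_VS; first by apply: contraNN nis => /eqP <-.
by apply: vf; rewrite inE ks orbT.
Qed.

Lemma Js_lin s f g a y : uniq s -> Jclass s f -> Jclass s g ->
  Js s (fun y => f y + a * g y) y = Js s f y + a * Js s g y.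
Proof.
elim: s f g => //= i s IH f g us cf cg.
rewrite -IH; [|by case/andP: us|exact: Jclass_cons|exact: Jclass_cons].
apply: Js_ext => z; rewrite /Jop.
have [[uf vf] [ug vg]] := (cf, cg).
have {}vf := vf i (mem_head _ _); have {}vg := vg i (mem_head _ _).
rewrite (@int1D _ _ _ B).
- congr (_ + _); rewrite (@int1Z _ _ B)//; first exact: UC_slice ug.
  by move=> x Bx; rewrite (VS_slice _ vg Bx).
- exact: UC_slice uf.
- by move=> x; apply: cvgM; [exact: cvg_cst|exact: (UC_slice ug)].
- by move=> x Bx; rewrite (VS_slice _ vf Bx).
- by move=> x Bx; rewrite (VS_slice _ vg Bx) mulr0.
Qed.

Lemma Jop_Js i s f y : uniq (i :: s) -> Jclass (i :: s) f ->
  Jop i (Js s f) y = Js s (Jop i f) y.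
Proof.
elim: s f => //= j s IH f /and3P[]; rewrite inE negb_or => /andP[ij nis] js us cf.
have ujis : uniq [:: j, i & s] by rewrite /= inE negb_or eq_sym ij js nis us.
have cf' : Jclass [:: j, i & s] f.
  by case: cf => uf vf; split=> // k; rewrite !inE orbCA => h; apply: vf; rewrite !inE.
rewrite IH; [|by rewrite /= nis us|exact: Jclass_cons].
apply: Js_ext => z; case: cf => uf vf.
by apply: (Jop_comm B0 _ ij uf); apply: vf; rewrite !inE eqxx ?orbT.
Qed.

Lemma Js_perm s s' f y : perm_eq s s' -> uniq s -> Jclass s f -> Js s f y = Js s' f y.
Proof.
elim: s s' f y => [|i s IH] s' f y ss' us cf.
  by move: ss'; rewrite perm_sym => /perm_nilP ->.
have is' : i \in s' by rewrite -(perm_mem ss') mem_head.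
case/splitPr: is' ss' => s1 s2 ss'.
have pss : perm_eq s (s1 ++ s2).
  by rewrite -(perm_cons i); apply: perm_trans ss' _; rewrite -cat1s perm_catCA.
have us12 : uniq (i :: (s1 ++ s2)).
  by rewrite -(perm_uniq (_ : perm_eq (i :: s) _))// perm_cons.
rewrite /= (IH _ _ _ pss); [|by case/andP: us|exact: Jclass_cons].
rewrite /Js !foldl_cat /= -!/(Js _ _); apply: Js_ext => z.
symmetry; apply: Jop_Js.
  by move: us12; rewrite /= cat_uniq mem_cat negb_or => /andP[/andP[-> _] /andP[-> _]].
case: cf => uf vf; split=> // k; rewrite inE => h; apply: vf.
by rewrite inE (perm_mem pss) mem_cat orbA h.
Qed.

(** The order of integration is free, so the i-th integral can be made the innermost one. This is
    the source of the divergence theorem below. *)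
Lemma Js_kill i s f y : i \in s -> uniq s -> Jclass s f ->
  (forall z, Jop i f z = 0) -> Js s f y = 0.
Proof.
move=> nis us cf f0; rewrite (Js_perm _ (perm_to_rem nis))//=.
by rewrite -[RHS](Js_0 (rem i s) y); exact: Js_ext.
Qed.

Lemma Js_aff s f (a : nat -> R) (e : R) y : e * e = 1 -> uniq s -> Jclass s f ->
  Js s (fun y => f (fun k => if k \in s then a k + e * y k else y k)) y = Js s f y.
Proof.
move=> ee; elim: s f => [|i s IH] f us cf /=; first by congr f.
rewrite -(IH (Jop i f)); [|by case/andP: us|exact: Jclass_cons].
apply: Js_ext => z; rewrite /Jop.
pose w : nat -> R := fun k => if k \in s then a k + e * z k else z k; rewrite -/w.
case: cf => uf vf; have {}vf := vf i (mem_head _ _).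
rewrite -(@int1_aff _ (fun x => f (upd w i x)) B (a i) e B0 ee).
- apply: eq_Rintegral => x _; congr (f _); apply/funext => k.
  by rewrite /upd /w inE; case: eqP => [->|].
- exact: UC_slice uf.
- by move=> x; exact: VS_slice.
Qed.

Lemma Js_gt0 s f w y0 : uniq s -> Jclass s f -> (forall y, 0 <= f y) ->
  (forall k, k \notin s -> y0 k = w k) -> 0 < f y0 -> 0 < Js s f w.
Proof.
elim: s f y0 => [|i s IH] f y0 us cf f0 yw fy /=.
  by have <- : y0 = w by apply/funext => k; exact: yw.
(* The i-th coordinate no longer matters after integration; it is reset so that the point agrees
   with [w] outside the shorter list. *)
apply: (IH _ (upd y0 i (w i))).
- by case/andP: us.
- exact: Jclass_cons.
- by move=> y; apply: int1_ge0.
- move=> k ks; rewrite /upd; case: eqP => [->//|/eqP ki].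
  by apply: yw; rewrite inE negb_or ki.
- case: cf => uf vf; have {}vf := vf i (mem_head _ _).
  apply: (int1_gt0 (B := B) (x0 := y0 i)) => //.
  + exact: UC_slice uf.
  + by move=> x; exact: VS_slice.
  + rewrite (_ : upd _ _ _ = y0)//; apply/funext => k; rewrite /upd.
    by case: eqP => // ->.
Qed.

End class.
End Js.

(** * Continuous functions of compact support on R^d *)

Section RowTopology.
Variable R : realType.

Lemma cont_cst (T U : topologicalType) (c : U) : continuous (fun _ : T => c).
Proof. by move=> x; exact: cvg_cst. Qed.

Lemma cont_id (T : topologicalType) : continuous (fun x : T => x).
Proof. by move=> x; exact: cvg_id. Qed.

Lemma contD (T : topologicalType) (f g : T -> R) : continuous f -> continuous g ->
  continuous (fun x => f x + g x).
Proof. by move=> cf cg x; exact: (cvgD (cf x) (cg x)). Qed.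

Lemma contDV (T : topologicalType) (V : normedModType R) (f g : T -> V) :
  continuous f -> continuous g -> continuous (fun x => f x + g x).
Proof. by move=> cf cg x; exact: (cvgD (cf x) (cg x)). Qed.

Lemma contB (T : topologicalType) (f g : T -> R) : continuous f -> continuous g ->
  continuous (fun x => f x - g x).
Proof. by move=> cf cg x; exact: (cvgB (cf x) (cg x)). Qed.

Lemma contM (T : topologicalType) (f g : T -> R) : continuous f -> continuous g ->
  continuous (fun x => f x * g x).
Proof. by move=> cf cg x; exact: (cvgM (cf x) (cg x)). Qed.

Lemma contX (T : topologicalType) (f : T -> R) n : continuous f ->
  continuous (fun x => f x ^+ n).
Proof.
move=> cf; elim: n => [|n IH]; first by under eq_fun do rewrite expr0; exact: cont_cst.
by under eq_fun do rewrite exprS; exact: contM.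
Qed.

Lemma cont_comp (T U V : topologicalType) (f : U -> V) (g : T -> U) : continuous f ->
  continuous g -> continuous (fun x => f (g x)).
Proof. by move=> cf cg x; apply: continuous_comp; [exact: cg|exact: cf]. Qed.

Lemma coord_le_norm d (x : 'rV[R]_d) i : `|x 0 i| <= `|x|.
Proof.
rewrite {2}/Num.norm /= mx_normrE.
exact: (le_bigmax _ (fun ij : 'I_1 * 'I_d => `|x ij.1 ij.2|) (0, i)).
Qed.

Lemma normrV_le d (x : 'rV[R]_d) e : 0 <= e -> (forall i, `|x 0 i| <= e) -> `|x| <= e.
Proof.
move=> e0 xe; rewrite {1}/Num.norm /= mx_normrE; apply/bigmax_leP; split => //.
by move=> [i j] _ /=; rewrite ord1.
Qed.

Lemma normrV_lt d (x : 'rV[R]_d) e : 0 < e -> (forall i, `|x 0 i| < e) -> `|x| < e.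
Proof.
move=> e0 xe; rewrite {1}/Num.norm /= mx_normrE; apply/bigmax_ltP; split => //.
by move=> [i j] _ /=; rewrite ord1.
Qed.

Lemma continuous_row (T : topologicalType) d (f : T -> 'rV[R]_d) :
  (forall i, continuous (fun x => f x 0 i)) -> continuous f.
Proof.
move=> cf x; apply/cvgrPdist_lt => e e0.
have : \forall t \near x, forall i : 'I_d, `|f x 0 i - f t 0 i| < e.
  by apply: filter_forall => i; move/cvgrPdist_lt : (cf i x); apply.
by apply: filterS => t ft; apply: normrV_lt => // i; rewrite !mxE.
Qed.

Lemma continuous_mulmxr m n (A : 'M[R]_(m, n)) : continuous (fun x : 'rV[R]_m => x *m A).
Proof.
apply: continuous_row => i.
rewrite (_ : (fun x => _) = (fun x : 'rV_m => \sum_(j < m) x 0 j * A j i)).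
  by apply: continuous_bigsum => j; apply: contM; [exact: coord_continuous|exact: cont_cst].
by apply/funext => x; rewrite mxE.
Qed.

Lemma continuous_affine m n (A : 'M[R]_(m, n)) (b : 'rV[R]_n) :
  continuous (fun x : 'rV[R]_m => x *m A + b).
Proof.
by apply: contDV; [exact: continuous_mulmxr|exact: cont_cst].
Qed.

(** The norm on rows is the maximum norm, so supports are measured by cubes. *)
Definition Cc d (f : 'rV[R]_d -> R) :=
  continuous f /\ exists B : R, forall x, B < `|x| -> f x = 0.

(** Only [x] has to lie in K; this serves [Cc_unif] for pairs that straddle the boundary of the
    ball. *)
Lemma compact_unif_cont d (f : 'rV[R]_d -> R) (K : set 'rV[R]_d) : compact K ->
  continuous f -> forall e, 0 < e ->
  exists2 r : R, 0 < r & forall x y, K x -> `|x - y| < r -> `|f x - f y| < e.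
Proof.
move=> cK cf e e0.
have nc : near_covering K by apply/compact_near_coveringP.
pose P (r : R) (x : 'rV[R]_d) := forall y, `|x - y| < r -> `|f x - f y| < e.
have e2 : 0 < e / 2 by lra.
have := nc R (0^'+) P _; case.
  move=> x Kx.
  move/cvgrPdist_lt : (cf x) => /(_ _ e2) /nbhs_normP[r /= r0 hr].
  exists (ball x (r / 2), [set s | s < r / 2]) => /=.
    split; first by apply: nbhsx_ballx; lra.
    by apply: nbhs_right_lt; lra.
  move=> [x' s] [/= xx' sr] y x'y.
  have xx'2 : `|x - x'| < r / 2 by rewrite -ball_normE in xx'.
  have h1 : `|f x - f x'| < e / 2 by apply: hr; rewrite /= ; lra.
  have h2 : `|f x - f y| < e / 2.
    apply: hr => /=; rewrite (_ : x - y = (x - x') + (x' - y)); last by rewrite addrA subrK.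
    apply: le_lt_trans (ler_normD _ _) _; rewrite /= in sr; lra.
  rewrite (_ : _ - _ = (f x - f y) - (f x - f x')); last by lra.
  by apply: le_lt_trans (ler_normB _ _) _; lra.
move=> r /= r0 hr; exists (r / 2); first lra.
move=> x y Kx xy; apply: (hr (r / 2)) => //=; last lra.
by rewrite sub0r normrN gtr0_norm; lra.
Qed.

Lemma ball_compact d (B : R) : compact [set x : 'rV[R]_d | `|x| <= B].
Proof.
apply: bounded_closed_compact.
  by exists B; split; [exact: num_real|move=> M BM x /= xB; apply: le_trans xB (ltW BM)].
have cn : continuous (fun x : 'rV[R]_d => `|x|) by exact: norm_continuous.
have := @closed_comp _ _ (fun x : 'rV[R]_d => `|x|) [set y | y <= B].
by apply; [move=> x _; exact: cn|exact: closed_le].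
Qed.

Lemma Cc_unif d (f : 'rV[R]_d -> R) : Cc f -> forall e, 0 < e ->
  exists2 r : R, 0 < r & forall x y, `|x - y| < r -> `|f x - f y| < e.
Proof.
move=> [cf [B f0]] e e0.
have [r r0 hr] := compact_unif_cont (@ball_compact d (B + 1)) cf e0.
exists (Num.min r 1); first by rewrite lt_min r0 ltr01.
move=> x y; rewrite lt_min => /andP[xyr xy1].
have [xB|xB] := leP `|x| (B + 1); first exact: hr.
rewrite !f0 ?subrr ?normr0//; last lra.
have : `|x| <= `|x - y| + `|y| by rewrite -{1}(subrK y x) ler_normD.
by lra.
Qed.

Lemma Cc_bounded d (f : 'rV[R]_d -> R) : Cc f -> exists2 C : R, 0 < C & forall x, `|f x| <= C.
Proof.
move=> [cf [B f0]].
have : bounded_set (f @` [set x | `|x| <= B]).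
  apply: (@compact_bounded R R^o); apply: continuous_compact; last exact: ball_compact.
  exact: continuous_subspaceT.
move=> [M [_ hM]]; exists (`|M| + 1); first by rewrite ltr_wpDl.
move=> x; have [xB|xB] := leP `|x| B.
  apply: (hM (`|M| + 1)); last by exists x.
  by apply: le_lt_trans (ler_norm _) _; rewrite ltrDl.
by rewrite f0// normr0 addr_ge0.
Qed.

Lemma CcD d (f g : 'rV[R]_d -> R) : Cc f -> Cc g -> Cc (fun x => f x + g x).
Proof.
move=> [cf [B f0]] [cg [C g0]]; split.
  exact: contD.
exists (Num.max B C) => x; rewrite gt_max => /andP[xB xC].
by rewrite f0// g0// addr0.
Qed.

Lemma CcM d (f g : 'rV[R]_d -> R) : Cc f -> continuous g -> Cc (fun x => f x * g x).
Proof.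
move=> [cf [B f0]] cg; split.
  exact: contM.
by exists B => x xB; rewrite f0// mul0r.
Qed.

Lemma CcZ d (f : 'rV[R]_d -> R) a : Cc f -> Cc (fun x => a * f x).
Proof.
move=> cf; have := @CcM _ f (fun=> a) cf (@cont_cst _ _ a).
by under eq_fun do rewrite mulrC.
Qed.

Lemma Cc0 d : Cc (fun _ : 'rV[R]_d => 0 : R).
Proof. by split; [exact: cont_cst|exists 0]. Qed.

Lemma Cc_sum d (I : Type) (r : seq I) (F : I -> 'rV[R]_d -> R) :
  (forall i, Cc (F i)) -> Cc (fun x => \sum_(i <- r) F i x).
Proof.
move=> cF; elim: r => [|i r IH].
  by under eq_fun do rewrite big_nil; exact: Cc0.
by under eq_fun do rewrite big_cons; apply: CcD.
Qed.

Lemma Cc_affine d (f : 'rV[R]_d -> R) (A : 'M[R]_d) (b : 'rV[R]_d) : A \in unitmx -> Cc f ->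
  Cc (fun x => f (x *m A + b)).
Proof.
move=> uA [cf [B f0]]; split.
  by apply: cont_comp; [exact: cf|exact: continuous_affine].
have [C C0 hC] : exists2 C : R, 0 < C & forall x : 'rV[R]_d, `|x| <= B -> `|(x - b) *m invmx A| <= C.
  have : bounded_set ((fun x => (x - b) *m invmx A) @` [set x | `|x| <= B]).
    apply: compact_bounded; apply: continuous_compact; last exact: ball_compact.
    apply: continuous_subspaceT.
    rewrite (_ : (fun x => _) = (fun x : 'rV[R]_d => x *m invmx A + - (b *m invmx A))).
      exact: continuous_affine.
    by apply/funext => x; rewrite mulmxBl.
  move=> [M [_ hM]]; exists (`|M| + 1); first by rewrite ltr_wpDl.
  move=> x xB; apply: (hM (`|M| + 1)); last by exists x.
  by apply: le_lt_trans (ler_norm _) _; rewrite ltrDl.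
exists C => x Cx; apply: f0; rewrite ltNge; apply/negP => /hC.
by rewrite addrK mulmxK// leNgt Cx.
Qed.

End RowTopology.

(** * The integral over R^d *)

Section IntRd.
Variable R : realType.
Local Notation int1 f := (Rintegral (@lebesgue_measure R) setT f).

Definition rowof d (y : nat -> R) : 'rV[R]_d := \row_(i < d) y (nat_of_ord i).
Definition corow d (x : 'rV[R]_d) : nat -> R := fun k => if insub k is Some i then x 0 i else 0.

Lemma corowK d (x : 'rV[R]_d) : rowof d (corow x) = x.
Proof. by apply/rowP => i; rewrite mxE /corow valK. Qed.

Lemma intRdE d (f : 'rV[R]_d -> R) :
  intRd f = Js (iota 0 d) (fun y => f (rowof d y)) (fun _ => 0).
Proof. by rewrite /intRd iint_Js. Qed.

Lemma Cc_Jclass d (f : 'rV[R]_d -> R) : Cc f ->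
  exists2 B : R, 0 < B & Jclass d B (iota 0 d) (fun y => f (rowof d y)).
Proof.
move=> cf; have [_ [B f0]] := cf.
exists (`|B| + 1); first by rewrite ltr_wpDl.
split.
  move=> e e0; have [r r0 hr] := Cc_unif cf e0; exists r => // y z yz.
  by apply: hr; apply: normrV_lt => // i; rewrite !mxE; apply: yz.
move=> i; rewrite mem_iota add0n => /= id y yB; apply: f0.
apply: lt_le_trans (coord_le_norm (rowof d y) (Ordinal id)).
by rewrite mxE /=; apply: le_lt_trans (ler_norm _) (le_lt_trans _ yB); rewrite lerDl.
Qed.

Lemma Jclass_le N (B C : R) s (f : (nat -> R) -> R) : B <= C -> Jclass N B s f -> Jclass N C s f.
Proof. by move=> BC [uf vf]; split=> // i iS y /(le_lt_trans BC); exact: vf. Qed.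

Lemma intRd_lin d (f g : 'rV[R]_d -> R) a : Cc f -> Cc g ->
  intRd (fun x => f x + a * g x) = intRd f + a * intRd g.
Proof.
move=> /Cc_Jclass[B B0 cf] /Cc_Jclass[C C0 cg]; rewrite !intRdE.
have D0 : 0 < Num.max B C by rewrite lt_max B0.
apply: (Js_lin D0 _ _ (iota_uniq 0 d)).
  by apply: Jclass_le cf; rewrite le_max lexx.
by apply: Jclass_le cg; rewrite le_max lexx orbT.
Qed.

Lemma intRdD d (f g : 'rV[R]_d -> R) : Cc f -> Cc g ->
  intRd (fun x => f x + g x) = intRd f + intRd g.
Proof.
move=> cf cg; rewrite -[X in _ + X]mul1r -intRd_lin//.
by under [in RHS]eq_fun do rewrite mul1r.
Qed.

Lemma intRd_0 d : intRd (fun _ : 'rV[R]_d => 0) = 0.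
Proof. by rewrite intRdE Js_0. Qed.

Lemma intRdZ d (f : 'rV[R]_d -> R) a : Cc f -> intRd (fun x => a * f x) = a * intRd f.
Proof.
move=> cf; rewrite -[RHS]add0r -[X in X + _](@intRd_0 d) -intRd_lin//; last exact: Cc0.
by under [in RHS]eq_fun do rewrite add0r.
Qed.

Lemma intRdB d (f g : 'rV[R]_d -> R) : Cc f -> Cc g ->
  intRd (fun x => f x - g x) = intRd f - intRd g.
Proof.
move=> cf cg; rewrite -[X in _ - X]mul1r -mulNr -intRd_lin//.
by under [in RHS]eq_fun do rewrite mulN1r.
Qed.

Lemma intRd_sum d (I : Type) (r : seq I) (F : I -> 'rV[R]_d -> R) : (forall i, Cc (F i)) ->
  intRd (fun x => \sum_(i <- r) F i x) = \sum_(i <- r) intRd (F i).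
Proof.
move=> cF; elim: r => [|i r IH].
  by rewrite big_nil; under eq_fun do rewrite big_nil; exact: intRd_0.
rewrite big_cons -IH -intRdD//; last exact: Cc_sum.
by under eq_fun do rewrite big_cons.
Qed.

Lemma intRd_ge0 d (f : 'rV[R]_d -> R) : (forall x, 0 <= f x) -> 0 <= intRd f.
Proof. by move=> f0; rewrite intRdE; apply: Js_ge0. Qed.

Lemma intRd_le d (f g : 'rV[R]_d -> R) : Cc f -> Cc g -> (forall x, f x <= g x) ->
  intRd f <= intRd g.
Proof.
move=> cf cg fg; rewrite -subr_ge0 -intRdB//; apply: intRd_ge0 => x.
by rewrite subr_ge0.
Qed.

Lemma intRd_gt0 d (f : 'rV[R]_d -> R) x0 : Cc f -> (forall x, 0 <= f x) -> 0 < f x0 ->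
  0 < intRd f.
Proof.
move=> /Cc_Jclass[B B0 cf] f0 fx0; rewrite intRdE.
apply: (Js_gt0 B0 (y0 := corow x0)) cf _ _ _ => //; first exact: iota_uniq.
  move=> k; rewrite mem_iota add0n /= -leqNgt => dk.
  by rewrite /corow insubF// ltnNge dk.
by rewrite corowK.
Qed.

Lemma intRd_aff d (f : 'rV[R]_d -> R) (a : 'rV[R]_d) (e : R) : e * e = 1 -> Cc f ->
  intRd (fun x => f (a + e *: x)) = intRd f.
Proof.
move=> ee /Cc_Jclass[B B0 cf]; rewrite !intRdE.
rewrite -(Js_aff B0 (corow a) _ ee (iota_uniq 0 d) cf).
apply: Js_ext => z; congr f; apply/rowP => i.
by rewrite !mxE mem_iota /= add0n ltn_ord /corow valK.
Qed.

Lemma intRd_shift d (f : 'rV[R]_d -> R) (a : 'rV[R]_d) : Cc f ->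
  intRd (fun x => f (x + a)) = intRd f.
Proof.
move=> cf; rewrite -(intRd_aff a (mulr1 1) cf).
by under [in RHS]eq_fun do rewrite scale1r addrC.
Qed.

Lemma intRd_reflect d (f : 'rV[R]_d -> R) (a : 'rV[R]_d) : Cc f ->
  intRd (fun x => f (a - x)) = intRd f.
Proof.
move=> cf; rewrite -(intRd_aff a (_ : -1 * -1 = 1 :> R) cf); last by rewrite mulrNN mulr1.
by under [in RHS]eq_fun do rewrite scaleN1r.
Qed.

Lemma intRd_kill d (f : 'rV[R]_d -> R) (i : 'I_d) : Cc f ->
  (forall x, int1 (fun s => f (x + s *: evec R i)) = 0) -> intRd f = 0.
Proof.
move=> cf fi; have [B B0 cl] := Cc_Jclass cf; rewrite intRdE.
apply: (@Js_kill _ d B B0 i) => //.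
- by rewrite mem_iota /= add0n.
- exact: iota_uniq.
- move=> z; rewrite -[RHS](fi (rowof d (upd z i 0))).
  apply: eq_Rintegral => s _; congr f; apply/rowP => k.
  rewrite !mxE /upd eqxx /= (_ : (nat_of_ord k == nat_of_ord i) = (k == i))//.
  by case: (k == i); rewrite ?mulr1 ?add0r// mulr0 addr0.
Qed.

Lemma is_derive_line d (f : 'rV[R]_d -> R) x v (s l : R) :
  is_derive s (1 : R) (fun s => f (x + s *: v)) l <-> is_derive (x + s *: v) v f l.
Proof.
have E : (fun h : R => h^-1 *: (((fun s => f (x + s *: v)) \o shift s) (h *: (1 : R)) - f (x + s *: v))) =
   (fun h => h^-1 *: ((f \o shift (x + s *: v)) (h *: v) - f (x + s *: v))).
  by apply/funext => h /=; rewrite /GRing.scale /= mulr1 addrCA -scalerDl.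
split=> -[d1 d2]; apply: DeriveDef; move: d1 d2; rewrite /derivable /derive.
- by rewrite E.
- by rewrite E.
- by rewrite -E.
- by rewrite -E.
Qed.

Lemma is_derive_line0 d (f : 'rV[R]_d -> R) x v (l : R) :
  is_derive (0 : R) (1 : R) (fun s => f (x + s *: v)) l <-> is_derive x v f l.
Proof. by rewrite is_derive_line scale0r addr0. Qed.

Lemma line_continuous d (x v : 'rV[R]_d) : continuous (fun s : R => x + s *: v).
Proof.
apply: continuous_row => k.
rewrite (_ : (fun s => _) = (fun s : R => x 0 k + s * v 0 k)).
  by apply: contD; [exact: cont_cst|apply: contM; [exact: cont_id|exact: cont_cst]].
by apply/funext => s; rewrite !mxE.
Qed.

(** Integrating along the i-th direction first leaves a difference of two values of f outside its
    support. Integration by parts rests on this. *)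
Lemma intRd_deriv d (f : 'rV[R]_d -> R) (i : 'I_d) : Cc f -> Cc (pderiv i f) ->
  (forall x, derivable f x (evec R i)) -> intRd (pderiv i f) = 0.
Proof.
move=> cf cdf df; apply: (@intRd_kill _ _ i) => // x.
have [_ [B0 f0]] := cf; have [cg [B1 g0]] := cdf.
(* Beyond this parameter the line through x in the i-th direction has left the supports of f and of
   its derivative. *)
pose B := Num.max (Num.max B0 B1) 0 + `|x| + 1.
have [h0 [h1 h2]] : 0 <= Num.max (Num.max B0 B1) 0 /\
   B0 <= Num.max (Num.max B0 B1) 0 /\ B1 <= Num.max (Num.max B0 B1) 0.
  by rewrite !le_max !lexx !orbT.
have nx := normr_ge0 x.
have big (s : R) : B < `|s| -> Num.max (Num.max B0 B1) 0 + 1 < `|x + s *: evec R i|.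
  move=> Bs; have : `|s| <= `|x + s *: evec R i| + `|x|; last by rewrite /B in Bs; lra.
  have -> : `|s| = `|(x + s *: evec R i - x) 0 i|.
    by rewrite addrC addKr !mxE !eqxx mulr1.
  exact: le_trans (coord_le_norm _ _) (ler_normB _ _).
have -> : int1 (fun s => pderiv i f (x + s *: evec R i)) =
    f (x + (B + 1) *: evec R i) - f (x + (- (B + 1)) *: evec R i).
  refine (@int1_FTC _ _ (fun s => f (x + s *: evec R i)) _ _ _ _ _ _).
  - by rewrite /B; lra.
  - by apply: cont_comp; [exact: cg|exact: line_continuous].
  - move=> s hs; apply: g0; apply: le_lt_trans h2 (lt_trans _ (big _ _)); first by rewrite ltrDl.
    by rewrite ltr_normr; case: hs => hs; apply/orP; [right|left]; lra.
  - by move=> s; apply/is_derive_line; apply: derivableP; exact: df.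
by rewrite !f0 ?subrr//; apply: le_lt_trans h1 (lt_trans _ (big _ _)); rewrite ?ltrDl//
    ?normrN ger0_norm /B; lra.
Qed.

End IntRd.

(** * Fubini for two groups of variables *)

Section Fubini.
Variable R : realType.
Local Notation int1 f := (Rintegral (@lebesgue_measure R) setT f).

Lemma Js_base s (g : (nat -> R) -> R) w w' :
  (forall z z', (forall k, k \in s -> z k = z' k) -> g z = g z') ->
  Js s g w = Js s g w'.
Proof.
elim: s g => [|i s IH] g gs /=; first exact: gs.
apply: IH => z z' zz'; apply: eq_Rintegral => x _; apply: gs => k.
by rewrite inE /upd; case: eqP => //= _; exact: zz'.
Qed.

Lemma Js_cat s1 s2 (f : (nat -> R) -> R) w : Js s2 (fun z => Js s1 f z) w = Js (s1 ++ s2) f w.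
Proof. by rewrite /Js foldl_cat. Qed.

Lemma cont_eps (V : normedModType R) (f : V -> R) :
  (forall x e, 0 < e -> exists2 r : R, 0 < r & forall y, `|x - y| < r -> `|f x - f y| < e) ->
  continuous f.
Proof.
move=> H x; apply/cvgrPdist_lt => e /(H x)[r r0 hr].
by apply/nbhs_normP; exists r => // y /=; exact: hr.
Qed.

Lemma norm_continuousV d : continuous (fun x : 'rV[R]_d => `|x|).
Proof. exact: norm_continuous. Qed.

Definition bump0 d (B : R) (x : 'rV[R]_d) : R := Num.max 0 (B + 1 - `|x|).

Lemma cont_max (T : topologicalType) (f g : T -> R) : continuous f -> continuous g ->
  continuous (fun x => Num.max (f x) (g x)).
Proof. by move=> cf cg x; apply: (@continuous_max _ _ f g x); [exact: cf|exact: cg]. Qed.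

Lemma bump0_Cc d B : Cc (@bump0 d B).
Proof.
split.
  apply: cont_max; first exact: cont_cst.
  by apply: contB; [exact: cont_cst|exact: norm_continuousV].
by exists (B + 1) => x xB; rewrite /bump0 max_l//; lra.
Qed.

Lemma bump0_ge0 d B (x : 'rV[R]_d) : 0 <= bump0 B x.
Proof. by rewrite /bump0 le_max lexx. Qed.

Lemma bump0_ge1 d B (x : 'rV[R]_d) : `|x| <= B -> 1 <= bump0 B x.
Proof. by move=> xB; rewrite /bump0 le_max; apply/orP; right; lra. Qed.

(** The tent [bump0] dominates the indicator of the ball, so its integral is a constant depending on
    d and B only; adding 1 makes it positive. *)
Lemma intRd_bound d (B : R) : exists2 C : R, 0 < C & forall (f : 'rV[R]_d -> R) e, Cc f ->
  (forall x, B < `|x| -> f x = 0) -> 0 <= e -> (forall x, `|f x| <= e) -> `|intRd f| <= C * e.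
Proof.
exists (intRd (@bump0 d B) + 1).
  by rewrite ltr_wpDl// intRd_ge0// => x; exact: bump0_ge0.
move=> f e cf f0 e0 fe; apply: (@le_trans _ _ (intRd (@bump0 d B) * e)); last first.
  by rewrite ler_wpM2r// lerDl.
rewrite mulrC -intRdZ; last exact: bump0_Cc.
have le1 x : `|f x| <= e * bump0 B x.
  have [xB|xB] := leP `|x| B.
    by apply: le_trans (fe x) _; rewrite ler_peMr// bump0_ge1.
  by rewrite f0// normr0 mulr_ge0// bump0_ge0.
have cb : Cc (fun x : 'rV[R]_d => e * bump0 B x) by apply: CcZ; exact: bump0_Cc.
rewrite ler_norml; apply/andP; split.
  rewrite -mulN1r -intRdZ//; apply: intRd_le => //; first exact: CcZ.
  by move=> x; rewrite mulN1r; have := le1 x; rewrite ler_norml => /andP[].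
by apply: intRd_le => // x; exact: le_trans (ler_norm _) (le1 x).
Qed.

Definition Cc2 d e (F : 'rV[R]_d -> 'rV[R]_e -> R) :=
  Cc (fun z : 'rV[R]_(d + e) => F (lsubmx z) (rsubmx z)).

Lemma norm_row_mx d e (x : 'rV[R]_d) (y : 'rV[R]_e) (r : R) : 0 < r ->
  `|x| < r -> `|y| < r -> `|row_mx x y| < r.
Proof.
move=> r0 xr yr; apply: normrV_lt => // i; rewrite mxE; case: splitP => j _.
  exact: le_lt_trans (coord_le_norm _ _) xr.
exact: le_lt_trans (coord_le_norm _ _) yr.
Qed.

Lemma norm_row_mxl d e (x : 'rV[R]_d) (y : 'rV[R]_e) : `|x| <= `|row_mx x y|.
Proof. by apply: normrV_le => // i; rewrite -(row_mxEl x y 0 i) coord_le_norm. Qed.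

Lemma norm_row_mxr d e (x : 'rV[R]_d) (y : 'rV[R]_e) : `|y| <= `|row_mx x y|.
Proof. by apply: normrV_le => // i; rewrite -(row_mxEr x y 0 i) coord_le_norm. Qed.

Lemma Cc2_unif d e (F : 'rV[R]_d -> 'rV[R]_e -> R) : Cc2 F -> forall r, 0 < r ->
  exists2 s : R, 0 < s & forall x x' y y', `|x - x'| < s -> `|y - y'| < s -> `|F x y - F x' y'| < r.
Proof.
move=> cF r r0; have [s s0 hs] := Cc_unif cF r0; exists s => // x x' y y' xx yy.
have := hs (row_mx x y) (row_mx x' y'); rewrite !row_mxKl !row_mxKr; apply.
by rewrite opp_row_mx add_row_mx; exact: norm_row_mx.
Qed.

Lemma Cc2_supp d e (F : 'rV[R]_d -> 'rV[R]_e -> R) : Cc2 F ->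
  exists B : R, forall x y, B < `|x| \/ B < `|y| -> F x y = 0.
Proof.
move=> [_ [B F0]]; exists B => x y h.
have := F0 (row_mx x y); rewrite row_mxKl row_mxKr; apply.
case: h => h; first exact: lt_le_trans h (norm_row_mxl _ _).
exact: lt_le_trans h (norm_row_mxr _ _).
Qed.

Lemma Cc2_r d e (F : 'rV[R]_d -> 'rV[R]_e -> R) x : Cc2 F -> Cc (F x).
Proof.
move=> cF; split; last by have [B hB] := Cc2_supp cF; exists B => y yB; apply: hB; right.
apply: cont_eps => y r r0; have [s s0 hs] := Cc2_unif cF r0.
exists s => // y' yy'; apply: hs => //.
by rewrite subrr normr0.
Qed.

Lemma Cc2_l d e (F : 'rV[R]_d -> 'rV[R]_e -> R) y : Cc2 F -> Cc (F^~ y).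
Proof.
move=> cF; split; last by have [B hB] := Cc2_supp cF; exists B => x xB; apply: hB; left.
apply: cont_eps => x r r0; have [s s0 hs] := Cc2_unif cF r0.
exists s => // y' yy'; apply: hs => //.
by rewrite subrr normr0.
Qed.

Lemma Cc2_int d e (F : 'rV[R]_d -> 'rV[R]_e -> R) : Cc2 F -> Cc (fun x => intRd (F x)).
Proof.
move=> cF; have [B hB] := Cc2_supp cF; split; last first.
  exists B => x xB; rewrite -[RHS](@intRd_0 R e); congr intRd; apply/funext => y.
  by apply: hB; left.
have [C C0 hC] := intRd_bound e B.
apply: cont_eps => x r r0.
have r1 : 0 < r / (2 * C) by rewrite divr_gt0// mulr_gt0.
have [s s0 hs] := Cc2_unif cF r1.
exists s => // y' yy'.
rewrite -intRdB; [|exact: Cc2_r|exact: Cc2_r].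
apply: (@le_lt_trans _ _ (C * (r / (2 * C)))).
  apply: hC; [ | |exact: ltW|].
  - apply: CcD; first exact: Cc2_r.
    by under eq_fun do rewrite -mulN1r; apply: CcZ; exact: Cc2_r.
  - by move=> y yB; rewrite !hB ?subrr//; right.
  - by move=> y; apply: ltW; apply: hs => //; rewrite subrr normr0.
have -> : C * (r / (2 * C)) = r / 2 by field; rewrite gt_eqF.
lra.
Qed.

(** Both sides integrate one function of d + e coordinates, in two orders of the same list of
    indices; [Js_perm] identifies them. *)
Lemma intRd_swap d e (F : 'rV[R]_d -> 'rV[R]_e -> R) : Cc2 F ->
  intRd (fun x => intRd (F x)) = intRd (fun y => intRd (F^~ y)).
Proof.
move=> /Cc_Jclass[B B0 cl].
pose f (z : nat -> R) := F (rowof d z) (rowof e (fun k => z (d + k)%N)).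
have {}cl : Jclass (d + e) B (iota 0 (d + e)) f.
  move: cl; congr Jclass; apply/funext => z; congr F; apply/rowP => i; by rewrite !mxE.
have E1 w : intRd (F (rowof d w)) = Js (iota d e) f w.
  rewrite intRdE (@Js_base _ _ _ (fun k => w (d + k)%N)); last first.
    move=> z z' zz; congr F; apply/rowP => i; rewrite !mxE; apply: zz.
    by rewrite mem_iota /= add0n.
  rewrite -(@Js_rename _ d _ (fun y => F (rowof d w) (rowof e y))) -iotaDl addn0.
  apply: Js_eq => z zw; rewrite /f; congr F; apply/rowP => i; rewrite !mxE; symmetry; apply: zw.
  by rewrite mem_iota negb_and -ltnNge ltn_ord.
have E2 z : intRd (F^~ (rowof e (fun k => z (d + k)%N))) = Js (iota 0 d) f z.
  rewrite intRdE (@Js_base _ _ _ z); last first.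
    move=> w w' ww; congr F; apply/rowP => i; rewrite !mxE; apply: ww.
    by rewrite mem_iota /= add0n.
  apply: Js_eq => w zw; rewrite /f; congr F; apply/rowP => i; rewrite !mxE; symmetry; apply: zw.
  by rewrite mem_iota add0n negb_and -leqNgt leq_addr orbT.
rewrite intRdE; under eq_fun do rewrite E1.
rewrite Js_cat.
rewrite intRdE.
rewrite -(@Js_rename _ d _ (fun v => intRd (F^~ (rowof e v))) (fun=> 0)) -iotaDl addn0.
under [in RHS]eq_fun do rewrite E2.
rewrite Js_cat.
have pc : perm_eq (iota d e ++ iota 0 d) (iota 0 (d + e)).
  by rewrite iotaD perm_catC add0n.
apply: (Js_perm (N := d + e) B0).
- by rewrite perm_catC.
- by rewrite (perm_uniq pc) iota_uniq.
- by case: cl => uf vf; split=> // k; rewrite (perm_mem pc); exact: vf.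
Qed.

Definition rsnoc n (y : 'rV[R]_n) (s : R) : 'rV[R]_n.+1 :=
  castmx (erefl 1%N, addn1 n) (row_mx y (s%:M : 'rV[R]_1)).

Lemma rsnocE n (y : 'rV[R]_n) s (i : 'I_n.+1) :
  rsnoc y s 0 i = if insub (i : nat) is Some j then y 0 j else s.
Proof.
rewrite /rsnoc castmxE /= cast_ord_id mxE.
case: splitP => j /= ij; last by rewrite insubF ?ij ?mxE ?ord1 ?eqxx// ltnNge leq_addr.
by case: insubP => [k _ kj|]; [congr (y _ _); apply: val_inj; rewrite /= kj ij|rewrite ij ltn_ord].
Qed.

Lemma rsnoc_lift n (y : 'rV[R]_n) s (j : 'I_n) : rsnoc y s 0 (lift ord_max j) = y 0 j.
Proof.
rewrite rsnocE; case: insubP => [k _ kj|].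
  by congr (y _ _); apply: val_inj; rewrite kj; exact: lift_max.
by rewrite [X in (X < _)%N]lift_max ltn_ord.
Qed.

Lemma rsnoc_max n (y : 'rV[R]_n) s : rsnoc y s 0 ord_max = s.
Proof. by rewrite rsnocE insubF//= ltnn. Qed.

(** Holds without exchanging integrals, because the last coordinate is the outermost one in
    [iint]. *)
Lemma intRd_rsnoc n (f : 'rV[R]_n.+1 -> R) :
  intRd f = int1 (fun s => intRd (fun y => f (rsnoc y s))).
Proof.
rewrite /intRd /=; apply: eq_Rintegral => s _; congr iint; apply/funext => y.
congr f; apply/rowP => i; rewrite rsnocE !mxE.
case: insubP => [k _ kj|]; first by rewrite mxE kj ltn_eqF// -kj ltn_ord.
by rewrite -leqNgt => ni; rewrite ifT// eqn_leq ni -ltnS ltn_ord.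
Qed.

End Fubini.

(** * Invariance of the integral under orthogonal maps *)

Section Rotation.
Variable R : realType.

Definition sqn d (x : 'rV[R]_d) : R := \sum_(i < d) x 0 i ^+ 2.

Lemma sqn_ge0 d (x : 'rV[R]_d) : 0 <= sqn x.
Proof. by apply: sumr_ge0 => i _; exact: sqr_ge0. Qed.

Lemma sqn_coord d (x : 'rV[R]_d) i : x 0 i ^+ 2 <= sqn x.
Proof.
by rewrite /sqn (bigD1 i)//= lerDl; apply: sumr_ge0 => j _; exact: sqr_ge0.
Qed.

Lemma sqnE d (x : 'rV[R]_d) : sqn x = (x *m x^T) 0 0.
Proof. by rewrite mxE; apply: eq_bigr => i _; rewrite mxE expr2. Qed.

Lemma sqn_orth d (x : 'rV[R]_d) (M : 'M[R]_d) : M *m M^T = 1%:M -> sqn (x *m M) = sqn x.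
Proof. by move=> MM; rewrite !sqnE trmx_mul mulmxA -(mulmxA x) MM mulmx1. Qed.

Lemma norm_sqn d (x : 'rV[R]_d) (r : R) : 0 <= r -> sqn x <= r ^+ 2 -> `|x| <= r.
Proof.
move=> r0 xr; apply: normrV_le => // i.
rewrite -(@ler_pXn2r _ 2)// ?nnegrE// real_normK ?num_real//.
exact: le_trans (sqn_coord _ _) xr.
Qed.

Lemma sqn_norm d (x : 'rV[R]_d) : sqn x <= d%:R * `|x| ^+ 2.
Proof.
apply: (@le_trans _ _ (\sum_(i < d) `|x| ^+ 2)); last by rewrite sumr_const card_ord mulr_natl.
apply: ler_sum => i _; rewrite -(real_normK (num_real (x 0 i))).
by rewrite ler_pXn2r// ?nnegrE// coord_le_norm.
Qed.

Lemma sqn_cont d : continuous (@sqn d).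
Proof.
by apply: continuous_bigsum => i; apply: contX; exact: coord_continuous.
Qed.

(** Used twice: its invariance under orthogonal maps gives that of the integral, and its powers,
    polynomials on the Euclidean ball of radius r, are the Landau kernels. *)
Definition radial d (r : R) (x : 'rV[R]_d) : R := Num.max 0 (1 - sqn x / r ^+ 2).

Lemma radial_ge0 d r (x : 'rV[R]_d) : 0 <= radial r x.
Proof. by rewrite /radial le_max lexx. Qed.

Lemma radial_le1 d r (x : 'rV[R]_d) : radial r x <= 1.
Proof.
rewrite /radial ge_max ler01 /=.
have := divr_ge0 (sqn_ge0 x) (sqr_ge0 r); lra.
Qed.

Lemma radial_Cc d (r : R) : 0 < r -> Cc (@radial d r).
Proof.
move=> r0; split.
  apply: cont_max; first exact: cont_cst.
  apply: contB; first exact: cont_cst.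
  by apply: contM; [exact: sqn_cont|exact: cont_cst].
exists r => x rx; rewrite /radial max_l// subr_le0 ler_pdivlMr ?exprn_gt0// mul1r.
rewrite leNgt; apply/negP => /ltW /(norm_sqn (ltW r0)).
by rewrite leNgt rx.
Qed.

Lemma radial0 d r : @radial d r 0 = 1.
Proof.
rewrite /radial (_ : sqn 0 = 0); last by rewrite /sqn big1// => i _; rewrite mxE expr0n.
by rewrite mul0r subr0 max_r.
Qed.

Lemma cont_lsub d e : continuous (fun z : 'rV[R]_(d + e) => lsubmx z).
Proof. exact: continuous_lsubmx. Qed.
Lemma cont_rsub d e : continuous (fun z : 'rV[R]_(d + e) => rsubmx z).
Proof. exact: continuous_rsubmx. Qed.

Lemma contBV (T : topologicalType) (V : normedModType R) (f g : T -> V) :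
  continuous f -> continuous g -> continuous (fun x => f x - g x).
Proof. by move=> cf cg x; exact: (cvgB (cf x) (cg x)). Qed.

Section orth.
Variables (d : nat) (M : 'M[R]_d).
Hypothesis MM : M *m M^T = 1%:M.

Lemma orth_unit : M \in unitmx.
Proof. by case: (mulmx1_unit MM). Qed.

Lemma orth_tr : M^T *m M = 1%:M.
Proof. exact: mulmx1C. Qed.

Lemma Cc_orth (f : 'rV[R]_d -> R) : Cc f -> Cc (fun x => f (x *m M)).
Proof.
move=> cf; have := Cc_affine 0 orth_unit cf.
by under eq_fun do rewrite addr0.
Qed.

Lemma Cc2_conv (f g : 'rV[R]_d -> R) : Cc f -> Cc g ->
  Cc2 (fun x y => f x * g (y *m M - x)).
Proof.
move=> [cf [B f0]] [cg [C g0]]; split.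
  apply: contM; first by apply: cont_comp; [exact: cf|exact: cont_lsub].
  apply: cont_comp; first exact: cg.
  apply: contBV; last exact: cont_lsub.
  exact: (cont_comp (@continuous_mulmxr R d d M) (@cont_rsub d d)).
(* A tent composed with M vanishes outside a ball, so |y M| >= B + C + 1 for |y| > D. With |x| <= B
   this puts y M - x outside the support of g. *)
have [_ [D hD]] := Cc_orth (@bump0_Cc R d (B + C)).
exists (Num.max B D) => z zB.
have [xB|xB] := ltP B `|lsubmx z|; first by rewrite f0// mul0r.
rewrite [g _]g0 ?mulr0//.
have yD : D < `|rsubmx z|.
  move: zB; rewrite gt_max => /andP[zB zD]; rewrite ltNge; apply/negP => yD.
  move: zD zB; rewrite -{1 2}(hsubmxK z) => zD zB.
  have [B1|B1] := leP B D.
    have : `|row_mx (lsubmx z) (rsubmx z)| <= D.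
      apply: normrV_le; first exact: le_trans (normr_ge0 _) yD.
      move=> i; rewrite mxE; case: splitP => j _; apply: le_trans (coord_le_norm _ _) _ => //.
      exact: le_trans xB B1.
    by rewrite leNgt zD.
  have : `|row_mx (lsubmx z) (rsubmx z)| <= B.
    apply: normrV_le; first exact: le_trans (normr_ge0 _) xB.
    move=> i; rewrite mxE; case: splitP => j _; apply: le_trans (coord_le_norm _ _) _ => //.
    exact: le_trans yD (ltW B1).
  by rewrite leNgt zB.
have := hD _ yD; rewrite /bump0 => h.
have {}h : B + C + 1 <= `|rsubmx z *m M|.
  rewrite leNgt; apply/negP => h1; move: h; rewrite max_r; lra.
have : `|rsubmx z *m M| <= `|rsubmx z *m M - lsubmx z| + `|lsubmx z|.
  by rewrite -{1}(subrK (lsubmx z) (rsubmx z *m M)) ler_normD.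
lra.
Qed.

(* Integrating f x * g (y M - x) over x and y in both orders.  With g radial this
   gives the invariance of the integral under M, without change of variables. *)
Lemma conv_comm (f g : 'rV[R]_d -> R) : Cc f -> Cc g ->
  intRd f * intRd (fun y => g (y *m M)) = intRd g * intRd (fun y => f (y *m M)).
Proof.
have half (f' g' : 'rV[R]_d -> R) : Cc f' -> Cc g' ->
    intRd f' * intRd (fun y => g' (y *m M)) = intRd (fun x => intRd (fun y => f' x * g' (y *m M - x))).
  move=> cf cg; rewrite mulrC -intRdZ//; congr intRd; apply/funext => x.
  have cgx : Cc (fun y => g' (y *m M - x)).
    have := Cc_affine (- x) orth_unit cg; by [].
  rewrite intRdZ// mulrC; congr (_ * _).
  rewrite -(@intRd_shift _ _ _ (- (x *m M^T)) (Cc_orth cg)).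
  by congr intRd; apply/funext => y; rewrite mulmxBl -mulmxA orth_tr mulmx1.
move=> cf cg; rewrite half// half//.
rewrite [LHS]intRd_swap; last exact: Cc2_conv.
rewrite [RHS]intRd_swap; last exact: Cc2_conv.
congr intRd; apply/funext => y.
have c1 : Cc (fun x => f x * g (y *m M - x)) by exact: (Cc2_l y (Cc2_conv cf cg)).
rewrite -(intRd_reflect (y *m M) c1); congr intRd; apply/funext => x.
by rewrite opprB [X in g X]addrC subrK mulrC.
Qed.

Lemma intRd_orth (f : 'rV[R]_d -> R) : Cc f -> intRd (fun y => f (y *m M)) = intRd f.
Proof.
move=> cf; have cg := @radial_Cc d 1 ltr01.
have gp : 0 < intRd (@radial d 1).
  apply: (intRd_gt0 (x0 := 0)) => //; first by move=> x; exact: radial_ge0.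
  by rewrite radial0.
have := conv_comm cf cg.
have -> : (fun y => radial 1 (y *m M)) = @radial d 1.
  by apply/funext => y; rewrite /radial sqn_orth.
by rewrite mulrC => /(mulfI (lt0r_neq0 gp)).
Qed.

Lemma intRd_isometry (f : 'rV[R]_d -> R) (a : 'rV[R]_d) : Cc f ->
  intRd (fun y => f (y *m M + a)) = intRd f.
Proof.
move=> cf; rewrite -(@intRd_orth f)// -(intRd_shift (a *m M^T) (Cc_orth cf)).
by congr intRd; apply/funext => y; rewrite mulmxDl -mulmxA orth_tr mulmx1.
Qed.

End orth.
End Rotation.

(** * Smooth functions and test functions *)

Section Smooth.
Variable R : realType.

Lemma is_derive_epsP (V : normedModType R) (f : V -> R) x v l :
  is_derive x v f l <->
  forall e, 0 < e -> exists2 r : R, 0 < r & forall h, h != 0 -> `|h| < r ->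
    `|h^-1 * (f (x + h *: v) - f x) - l| < e.
Proof.
split.
  move=> [d1 d2] e e0.
  have /cvgrPdist_lt/(_ _ e0) : (fun h => h^-1 *: ((f \o shift x) (h *: v) - f x)) @ 0^' --> l.
    by rewrite -d2 /derive; exact: d1.
  move=> [r /= r0 hr]; exists r => // h h0 hr'.
  have := hr h; rewrite /ball_ /= sub0r normrN => /(_ hr' h0).
  by rewrite distrC [x + _]addrC.
move=> H.
have L : (fun h => h^-1 *: ((f \o shift x) (h *: v) - f x)) @ 0^' --> l.
  apply/cvgrPdist_lt => e /H[r r0 hr]; exists r => // h /=.
  by rewrite sub0r normrN distrC => hr' h0; rewrite (addrC (h *: v)); exact: hr.
apply: DeriveDef; first by apply/cvg_ex; exists l.
exact: cvg_lim L.
Qed.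

Lemma mvt_line d (f : 'rV[R]_d -> R) (e : 'rV[R]_d) z (t : R) :
  (forall x, derivable f x e) ->
  exists2 xi : R, `|xi| <= `|t| & f (z + t *: e) - f z = t * 'D_e f (z + xi *: e).
Proof.
move=> df.
have dg s : is_derive s (1 : R) (fun s => f (z + s *: e)) ('D_e f (z + s *: e)).
  by apply/is_derive_line; apply: derivableP.
have cg := deriv_continuous dg.
have [t0|t0] := leP 0 t.
  have [xi] := MVT_segment t0 (fun s _ => dg s) (continuous_subspaceT cg).
  rewrite in_itv /= scale0r addr0 subr0 => /andP[x0 xt] E.
  by exists xi; rewrite ?ger0_norm// E mulrC.
have [xi] := MVT_segment (ltW t0) (fun s _ => dg s) (continuous_subspaceT cg).
rewrite in_itv /= scale0r addr0 sub0r => /andP[x0 xt] E.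
exists xi; first by rewrite (ler0_norm xt) (ltr0_norm t0) lerN2.
by rewrite -opprB E mulrN opprK mulrC.
Qed.

(** The direction is built up one coordinate at a time; the increment along the new coordinate is an
    increment of f on a line, where the mean value theorem and the continuity of the partial
    derivative apply. *)
Lemma dir_deriv d (f : 'rV[R]_d -> R) : (forall i x, derivable f x (evec R i)) ->
  (forall i, continuous (pderiv i f)) -> forall x w,
  is_derive x w f (\sum_(i < d) w 0 i * pderiv i f x).
Proof.
move=> df cf x w.
suff H r : is_derive x (\sum_(i <- r) w 0 i *: evec R i) f (\sum_(i <- r) w 0 i * pderiv i f x).
  by have := H (index_enum _); rewrite -row_sum_delta.
elim: r => [|i r IH].
  rewrite !big_nil; apply/is_derive_epsP => e e0; exists 1 => // h _ _.
  by rewrite scaler0 addr0 subrr mulr0 subrr normr0.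
rewrite !big_cons; move: IH; set v := \sum_(j <- r) _; set l := \sum_(j <- r) _ => IH.
set c := w 0 i.
apply/is_derive_epsP => e e0.
have e2 : 0 < e / 2 by lra.
have [r1 r10 h1] := (is_derive_epsP _ _ _ _).1 IH _ e2.
have e3 : 0 < e / (2 * (`|c| + 1)) by rewrite divr_gt0// mulr_gt0// ltr_wpDl.
have /cvgrPdist_lt/(_ _ e3)/nbhs_normP[r2 /= r20 h2] := cf i x.
pose K := `|v| + `|c| + 1.
have K0 : 0 < K by rewrite ltr_wpDl// addr_ge0.
exists (Num.min r1 (r2 / K)); first by rewrite lt_min r10 divr_gt0.
move=> h h0; rewrite lt_min ltr_pdivlMr// => /andP[hr1 hr2].
have [xi xic E] := @mvt_line d f (evec R i) (x + h *: v) (h * c) (df i).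
have -> : h^-1 * (f (x + h *: (c *: evec R i + v)) - f x) - (c * pderiv i f x + l) =
   (h^-1 * (f (x + h *: v) - f x) - l) +
   c * (pderiv i f (x + h *: v + xi *: evec R i) - pderiv i f x).
  rewrite scalerDr scalerA [_ *: evec R i + _]addrC addrA.
  have -> : f (x + h *: v + (h * c) *: evec R i) = f (x + h *: v) + (h * c) * pderiv i f (x + h *: v + xi *: evec R i).
    by rewrite -[LHS](subrK (f (x + h *: v))) E addrC.
  by field.
apply: le_lt_trans (ler_normD _ _) _.
have A1 := h1 h h0 hr1.
have A2 : `|pderiv i f (x + h *: v + xi *: evec R i) - pderiv i f x| < e / (2 * (`|c| + 1)).
  rewrite distrC; apply: h2; rewrite /ball_ /= -addrA opprD addNKr normrN.
  apply: le_lt_trans (ler_normD _ _) _; rewrite !normrZ.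
  have n1 : `|evec R i| <= 1.
    apply: normrV_le => // j; rewrite mxE /=; case: eqP => _; rewrite ?normr0 ?normr1//.
  apply: le_lt_trans hr2; rewrite /K mulrDr mulrDr mulr1 -addrA lerD2l.
  rewrite normrM in xic; apply: (@le_trans _ _ (`|xi|)); first by rewrite ler_piMr.
  by apply: le_trans xic _; rewrite lerDl.
rewrite normrM.
have : `|c| * `|pderiv i f (x + h *: v + xi *: evec R i) - pderiv i f x| <= e / 2.
  apply: (@le_trans _ _ ((`|c| + 1) * (e / (2 * (`|c| + 1))))).
    by apply: ler_pM => //; [rewrite lerDl|exact: ltW].
  have c1 : 0 < `|c| + 1 by rewrite ltr_wpDl.
  by rewrite le_eqVlt; apply/orP; left; apply/eqP; field; rewrite gt_eqF.
lra.
Qed.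

Lemma smooth_coind d (S : ('rV[R]_d -> R) -> Prop) :
  (forall f, S f -> continuous f /\ (forall i x, derivable f x (evec R i)) /\
     forall i, S (pderiv i f)) -> forall f, S f -> smooth f.
Proof.
move=> HS f Sf s.
have : S (ipderiv s f) by elim: s => //= i s /HS [_ [_ ]]; exact.
by move=> /HS [c [dd _]].
Qed.

Lemma ipderiv_rcons d s i (f : 'rV[R]_d -> R) : ipderiv (rcons s i) f = ipderiv s (pderiv i f).
Proof. by elim: s => //= j s ->. Qed.

Lemma smooth_pderiv d i (f : 'rV[R]_d -> R) : smooth f -> smooth (pderiv i f).
Proof. by move=> sf s; rewrite -ipderiv_rcons; exact: sf. Qed.

Lemma smooth_cont d (f : 'rV[R]_d -> R) : smooth f -> continuous f.
Proof. by move=> sf; have [] := sf [::]. Qed.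

Lemma smooth_derivable d (f : 'rV[R]_d -> R) : smooth f -> forall i x, derivable f x (evec R i).
Proof. by move=> sf; have [] := sf [::]. Qed.

Lemma smooth_is_derive d (f : 'rV[R]_d -> R) i x : smooth f -> is_derive x (evec R i) f (pderiv i f x).
Proof. by move=> sf; apply: derivableP; exact: smooth_derivable. Qed.

Lemma smooth_dir d (f : 'rV[R]_d -> R) x w : smooth f ->
  is_derive x w f (\sum_(i < d) w 0 i * pderiv i f x).
Proof.
move=> sf; apply: dir_deriv; first exact: smooth_derivable.
by move=> i; apply: smooth_cont; exact: smooth_pderiv.
Qed.

Lemma pderivE d i (f g : 'rV[R]_d -> R) : (forall x, is_derive x (evec R i) f (g x)) ->
  pderiv i f = g.
Proof. by move=> H; apply/funext => x; have [_ <-] := H x. Qed.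

Lemma is_deriveDf d (f g : 'rV[R]_d -> R) x v a b : is_derive x v f a -> is_derive x v g b ->
  is_derive x v (fun x => f x + g x) (a + b).
Proof. exact: is_deriveD. Qed.

Lemma is_deriveMf d (f g : 'rV[R]_d -> R) x v a b : is_derive x v f a -> is_derive x v g b ->
  is_derive x v (fun x => f x * g x) (f x * b + g x * a).
Proof. exact: is_deriveM. Qed.

(* Smoothness is coinductive: it is enough that the generators have derivatives
   in the algebra they generate. *)
Inductive alg d (G : ('rV[R]_d -> R) -> Prop) : ('rV[R]_d -> R) -> Prop :=
| alg_base f : G f -> alg G f
| alg_cst c : alg G (fun _ => c)
| alg_add f g : alg G f -> alg G g -> alg G (fun x => f x + g x)
| alg_mul f g : alg G f -> alg G g -> alg G (fun x => f x * g x).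

Lemma alg_sum d (G : ('rV[R]_d -> R) -> Prop) (I : Type) (r : seq I) (F : I -> 'rV[R]_d -> R) :
  (forall i, alg G (F i)) -> alg G (fun x => \sum_(i <- r) F i x).
Proof.
move=> GF; elim: r => [|i r IH].
  by under eq_fun do rewrite big_nil; exact: alg_cst.
by under eq_fun do rewrite big_cons; exact: alg_add.
Qed.

Lemma alg_smooth d (G : ('rV[R]_d -> R) -> Prop) :
  (forall f, G f -> continuous f /\ forall i, exists2 g, alg G g & forall x, is_derive x (evec R i) f (g x)) ->
  forall f, alg G f -> smooth f.
Proof.
move=> HG.
have key f : alg G f -> continuous f /\ forall i, exists2 g, alg G g & forall x, is_derive x (evec R i) f (g x).
  elim=> [g|c|f1 g1 a1 [c1 d1] a2 [c2 d2]|f1 g1 a1 [c1 d1] a2 [c2 d2]].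
  - exact: HG.
  - split; first exact: cont_cst.
    by move=> i; exists (fun=> 0); [exact: alg_cst|move=> x; exact: is_derive_cst].
  - split; first exact: contD.
    move=> i; have [h1 ah1 D1] := d1 i; have [h2 ah2 D2] := d2 i.
    by exists (fun x => h1 x + h2 x); [exact: alg_add|move=> x; exact: is_deriveDf].
  - split; first exact: contM.
    move=> i; have [h1 ah1 D1] := d1 i; have [h2 ah2 D2] := d2 i.
    exists (fun x => f1 x * h2 x + g1 x * h1 x).
      by apply: alg_add; exact: alg_mul.
    by move=> x; exact: is_deriveMf.
apply: smooth_coind => f /key[cf df]; split=> //; split.
  by move=> i x; have [g _ D] := df i; case: (D x).
by move=> i; have [g ag D] := df i; rewrite (pderivE D).
Qed.

Lemma smooth_alg d (f : 'rV[R]_d -> R) : alg (@smooth R d) f -> smooth f.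
Proof.
apply: alg_smooth => g sg; split; first exact: smooth_cont.
move=> i; exists (pderiv i g); first by apply: alg_base; exact: smooth_pderiv.
by move=> x; exact: smooth_is_derive.
Qed.

Lemma smooth_cst d c : smooth (fun _ : 'rV[R]_d => c).
Proof. by apply: smooth_alg; exact: alg_cst. Qed.

Lemma smoothD d (f g : 'rV[R]_d -> R) : smooth f -> smooth g -> smooth (fun x => f x + g x).
Proof. by move=> sf sg; apply: smooth_alg; apply: alg_add; exact: alg_base. Qed.

Lemma smoothM d (f g : 'rV[R]_d -> R) : smooth f -> smooth g -> smooth (fun x => f x * g x).
Proof. by move=> sf sg; apply: smooth_alg; apply: alg_mul; exact: alg_base. Qed.

Lemma affine_derive m d (A : 'M[R]_(d, m)) (b : 'rV[R]_m) (f : 'rV[R]_m -> R) i x : smooth f ->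
  is_derive x (evec R i) (fun x : 'rV[R]_d => f (x *m A + b))
    (\sum_(j < m) A i j * pderiv j f (x *m A + b)).
Proof.
move=> sf; apply/is_derive_line0.
have -> : (fun s : R => f ((x + s *: evec R i) *m A + b)) =
   (fun s => f (x *m A + b + s *: row i A)).
  apply/funext => s; congr f.
  by rewrite mulmxDl -scalemxAl -rowE addrAC.
apply/is_derive_line0; have := smooth_dir (x *m A + b) (row i A) sf.
by congr is_derive; apply: eq_bigr => j _; rewrite mxE.
Qed.

Lemma smooth_affine m d (A : 'M[R]_(d, m)) (b : 'rV[R]_m) (f : 'rV[R]_m -> R) : smooth f ->
  smooth (fun x : 'rV[R]_d => f (x *m A + b)).
Proof.
move=> sf.
apply: (@alg_smooth _ (fun h => exists2 g, smooth g & h = fun x => g (x *m A + b))); last first.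
  by apply: alg_base; exists f.
move=> h [g sg ->]; split.
  apply: cont_comp; [exact: smooth_cont|exact: continuous_affine].
move=> i; exists (fun x => \sum_(j < m) A i j * pderiv j g (x *m A + b)).
  apply: alg_sum => j; apply: alg_mul; first exact: alg_cst.
  by apply: alg_base; exists (pderiv j g); [exact: smooth_pderiv|].
by move=> x; exact: affine_derive.
Qed.

Lemma smooth_coord d (i : 'I_d) : smooth (fun x : 'rV[R]_d => x 0 i).
Proof.
apply: (@alg_smooth _ (fun h => h = fun x : 'rV[R]_d => x 0 i)); last exact: alg_base.
move=> h ->; split; first exact: coord_continuous.
move=> j; exists (fun=> evec R j 0 i); first exact: alg_cst.
move=> x; apply/is_derive_epsP => e e0; exists 1 => // k k0 _.
have -> : (x + k *: evec R j) 0 i = x 0 i + k * evec R j 0 i by rewrite !mxE.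
by rewrite addrAC subrr add0r mulKf// subrr normr0.
Qed.

Lemma contV (T : topologicalType) (f : T -> R) : continuous f -> (forall x, f x != 0) ->
  continuous (fun x => (f x)^-1).
Proof. by move=> cf f0 x; exact: (cvgV (f0 x) (cf x)). Qed.

(** The derivative of 1/f is a product of two factors 1/f and a smooth one, so smooth functions
    together with 1/f generate an algebra stable under derivatives. *)
Lemma smooth_inv d (f : 'rV[R]_d -> R) : smooth f -> (forall x, f x != 0) ->
  smooth (fun x => (f x)^-1).
Proof.
move=> sf f0.
pose G h := smooth h \/ h = (fun x => (f x)^-1).
apply: (@alg_smooth _ G); last by apply: alg_base; right.
move=> h [sh|->].
  split; first exact: smooth_cont.
  move=> i; exists (pderiv i h); first by apply: alg_base; left; exact: smooth_pderiv.
  by move=> x; exact: smooth_is_derive.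
split.
  by apply: contV => //; exact: smooth_cont.
move=> i; exists (fun x => ((-1 * (f x)^-1) * (f x)^-1) * pderiv i f x).
  apply: alg_mul; last by apply: alg_base; left; exact: smooth_pderiv.
  apply: alg_mul; last by apply: alg_base; right.
  by apply: alg_mul; [exact: alg_cst|apply: alg_base; right].
move=> x; have D := smooth_is_derive i x sf.
have -> : (-1 * (f x)^-1 * (f x)^-1) * pderiv i f x = - (f x) ^- 2 *: pderiv i f x.
  by rewrite mulN1r mulNr -invfM -expr2.
by case: D => D1 <-; apply: DeriveDef; [exact: derivableV|exact: deriveV].
Qed.

End Smooth.

(** * Smooth cutoffs *)

Section Bump.
Variable R : realType.

Lemma is_derive_near (V : normedModType R) (f g : V -> R) x v l :
  (exists2 r : R, 0 < r & forall y, `|x - y| < r -> f y = g y) ->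
  is_derive x v g l -> is_derive x v f l.
Proof.
move=> [r r0 fg] /is_derive_epsP Dg; apply/is_derive_epsP => e /Dg[s s0 hs].
have v0 : 0 < `|v| + 1 by rewrite ltr_wpDl.
exists (Num.min s (r / (`|v| + 1))); first by rewrite lt_min s0 divr_gt0.
move=> h h0; rewrite lt_min ltr_pdivlMr// => /andP[h1 h2].
rewrite !fg; first exact: hs.
  by rewrite subrr normr0.
rewrite opprD addNKr normrN normrZ; apply: le_lt_trans h2.
by rewrite ler_wpM2l// lerDl.
Qed.

(** All powers of 1/x are taken together because the derivative of one member of the family is a
    combination of two others; smoothness then comes from [alg_smooth]. *)
Definition ebump (n : nat) (x : R) : R := if 0 < x then (x^-1) ^+ n * expR (- x^-1) else 0.

(** From e^z >= z^(n+1) / (n+1)! at z = 1/h. Applied with n + 1, it shows that the difference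
    quotient of [ebump n] at 0 tends to 0. *)
Lemma ebump_le n (h : R) : 0 < h -> ebump n h <= (n.+1)`!%:R * h.
Proof.
move=> h0; rewrite /ebump h0 expRN ler_pdivrMr ?expR_gt0//.
have := @expR_ge1Dxn R h^-1 n; rewrite invr_ge0 ltW// => /(_ isT) H.
have f0 : (0 : R) < (n.+1)`!%:R by rewrite ltr0n fact_gt0.
have H2 : h^-1 ^+ n.+1 / (n.+1)`!%:R <= expR h^-1 by apply: le_trans H; rewrite lerDr.
have -> : h^-1 ^+ n = (n.+1)`!%:R * h * (h^-1 ^+ n.+1 / (n.+1)`!%:R).
  by rewrite exprS; field; rewrite !gt_eqF//.
by rewrite ler_wpM2l// mulr_ge0// ltW.
Qed.

Lemma ebump_ge0 n (x : R) : 0 <= ebump n x.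
Proof. by rewrite /ebump; case: ifP => // x0; rewrite mulr_ge0 ?expR_ge0// exprn_ge0// invr_ge0 ltW. Qed.

Lemma ebump_derive_pos n (t : R) : 0 < t ->
  is_derive t (1 : R) (fun x : R => (x^-1) ^+ n * expR (- x^-1))
    (- n%:R * (t^-1 ^+ n.+1 * expR (- t^-1)) + t^-1 ^+ n.+2 * expR (- t^-1)).
Proof.
move=> t0; have tn0 : t != 0 by rewrite gt_eqF.
have D1 : is_derive t (1 : R) (fun x : R => x^-1) (- t ^- 2).
  have Did : derivable (id : R -> R) t 1 by exact: derivable_id.
  apply: DeriveDef; first exact: (@derivableV _ _ id).
  by rewrite (@deriveV _ _ id)// derive_id /GRing.scale /= mulr1.
have D2 : is_derive t (1 : R) (fun x : R => expR (- x^-1)) (expR (- t^-1) * t ^- 2).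
  have D1' := is_deriveN D1; rewrite opprK in D1'.
  by have := @is_derive1_comp _ expR (fun x => - x^-1) t _ _ (is_derive_expR (- t^-1)) D1'.
elim: n => [|n IH].
  have -> : (fun x : R => x^-1 ^+ 0 * expR (- x^-1)) = (fun x => expR (- x^-1)).
    by apply/funext => x; rewrite expr0 mul1r.
  by move: D2; congr is_derive; rewrite oppr0 mul0r add0r -exprVn mulrC.
have -> : (fun x : R => x^-1 ^+ n.+1 * expR (- x^-1)) =
  (fun x => x^-1 * (x^-1 ^+ n * expR (- x^-1))).
  by apply/funext => x; rewrite exprS mulrA.
have := is_deriveM D1 IH; congr is_derive.
by rewrite /GRing.scale /= -exprVn !exprS -natr1; ring.
Qed.

Lemma ebump_derive n (t : R) :
  is_derive t (1 : R) (ebump n) (- n%:R * ebump n.+1 t + ebump n.+2 t).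
Proof.
have [t0|t0|t0] := ltrgtP t 0.
- have -> : - n%:R * ebump n.+1 t + ebump n.+2 t = 0.
    by rewrite /ebump ltNge (ltW t0) /= mulr0 addr0.
  apply: (is_derive_near (g := cst 0)) (is_derive_cst 0 t 1).
  exists (- t); first lra.
  move=> y; rewrite ltr_norml => /andP[h1 h2]; rewrite /ebump ifF//.
  by apply/negbTE; rewrite -leNgt; lra.
- have -> : - n%:R * ebump n.+1 t + ebump n.+2 t =
    - n%:R * (t^-1 ^+ n.+1 * expR (- t^-1)) + t^-1 ^+ n.+2 * expR (- t^-1) by rewrite /ebump t0.
  apply: is_derive_near (ebump_derive_pos n t0).
  exists t => // y; rewrite ltr_norml => /andP[h1 h2]; rewrite /ebump ifT//.
  lra.
- rewrite t0 /ebump ltxx mulr0 addr0; apply/is_derive_epsP => e e0.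
  have f0 : (0 : R) < (n.+2)`!%:R by rewrite ltr0n fact_gt0.
  exists (e / (n.+2)`!%:R); first by rewrite divr_gt0.
  move=> h h0 hr; rewrite ltxx subr0 subr0 add0r /GRing.scale /= mulr1.
  case: ifP => hp; last by rewrite mulr0 normr0.
  have := @ebump_le n.+1 h hp; rewrite /ebump hp => H.
  rewrite mulrA -exprS ger0_norm; last by rewrite mulr_ge0 ?expR_ge0// exprn_ge0// invr_ge0 ltW.
  apply: le_lt_trans H _; rewrite mulrC -ltr_pdivlMr//.
  by move: hr; rewrite gtr0_norm.
Qed.

Lemma ebump_smooth n : smooth (fun x : 'rV[R]_1 => ebump n (x 0 0)).
Proof.
pose G (f : 'rV[R]_1 -> R) := exists n, f = fun x => ebump n (x 0 0).
apply: (@alg_smooth _ _ G); last by apply: alg_base; exists n.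
move=> f [m ->]; split.
  apply: cont_comp; last exact: coord_continuous.
  by apply: deriv_continuous => t; exact: ebump_derive.
move=> i; exists (fun x : 'rV[R]_1 => - m%:R * ebump m.+1 (x 0 0) + ebump m.+2 (x 0 0)).
  apply: alg_add; last by apply: alg_base; exists m.+2.
  by apply: alg_mul; [exact: alg_cst|apply: alg_base; exists m.+1].
move=> x; rewrite [i]ord1; apply/is_derive_epsP => e e0.
have /is_derive_epsP/(_ _ e0)[r r0 hr] := ebump_derive m (x 0 0).
exists r => // h h0 hhr; have := hr h h0 hhr.
by rewrite !mxE /= mulr1 /GRing.scale /= mulr1.
Qed.

(** The classical smooth transition from 0 on t <= 0 to 1 on t >= 1. *)
Definition step (t : R) : R := ebump 0 t / (ebump 0 t + ebump 0 (1 - t)).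

Lemma ebump0_gt0 t : 0 < t -> 0 < ebump 0 t.
Proof. by move=> t0; rewrite /ebump t0 expr0 mul1r expR_gt0. Qed.

Lemma step_den t : 0 < ebump 0 t + ebump 0 (1 - t).
Proof.
have [t0|t0] := ltP 0 t; first by rewrite ltr_wpDr ?ebump_ge0// ebump0_gt0.
by rewrite ltr_wpDl ?ebump_ge0// ebump0_gt0//; lra.
Qed.

Lemma step_ge0 t : 0 <= step t.
Proof. by rewrite divr_ge0 ?ebump_ge0// ltW// step_den. Qed.

Lemma step_le1 t : step t <= 1.
Proof. by rewrite ler_pdivrMr ?step_den// mul1r lerDl ebump_ge0. Qed.

Lemma step0 t : t <= 0 -> step t = 0.
Proof. by move=> t0; rewrite /step {1}/ebump ltNge t0 /= mul0r. Qed.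

Lemma step1 t : 1 <= t -> step t = 1.
Proof.
move=> t1; rewrite /step [ebump 0 (1 - t)]/ebump ifF; last by apply/negbTE; rewrite -leNgt; lra.
by rewrite addr0 divff// gt_eqF// ebump0_gt0//; lra.
Qed.

Lemma step_smooth : smooth (fun x : 'rV[R]_1 => step (x 0 0)).
Proof.
have s2 : smooth (fun x : 'rV[R]_1 => ebump 0 (1 - x 0 0)).
  have := smooth_affine (- (1%:M : 'M[R]_1)) (const_mx 1) (ebump_smooth 0).
  congr smooth; apply/funext => x; congr ebump.
  by rewrite mulmxN mulmx1 !mxE addrC.
apply: (smoothM (ebump_smooth 0) _).
apply: smooth_inv; first exact: (smoothD (ebump_smooth 0) s2).
by move=> x; apply: lt0r_neq0; exact: step_den.
Qed.

Lemma step_aff_smooth d (a : 'cV[R]_d) (b : R) : smooth (fun x : 'rV[R]_d => step ((x *m a) 0 0 + b)).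
Proof.
have := smooth_affine a (const_mx b) step_smooth.
by congr smooth; apply/funext => x; congr step; rewrite !mxE.
Qed.

Lemma step_coord_smooth d (i : 'I_d) (c b : R) : smooth (fun x : 'rV[R]_d => step (c * x 0 i + b)).
Proof.
have := @step_aff_smooth d (c *: (evec R i)^T) b.
congr smooth; apply/funext => x; congr (step (_ + _)).
rewrite mxE (bigD1 i)//= big1 ?addr0; first by rewrite !mxE !eqxx mulr1 mulrC.
by move=> j ji; rewrite !mxE eqxx /= (negbTE ji) mulr0 mulr0.
Qed.

(** In the maximum norm a cutoff between two balls is a product of one-variable transitions, one for
    each face of the cube. *)
Definition boxcut d (B : R) (x : 'rV[R]_d) : R :=
  \prod_(i < d) (step (x 0 i + (B + 1)) * step (- x 0 i + (B + 1))).

Lemma smooth_prod d (I : Type) (r : seq I) (F : I -> 'rV[R]_d -> R) :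
  (forall i, smooth (F i)) -> smooth (fun x => \prod_(i <- r) F i x).
Proof.
move=> sF; elim: r => [|i r IH].
  by under eq_fun do rewrite big_nil; exact: smooth_cst.
by under eq_fun do rewrite big_cons; exact: (smoothM (sF i) IH).
Qed.

Lemma boxcut_smooth d B : smooth (@boxcut d B).
Proof.
apply: smooth_prod => i; apply: smoothM.
  have := @step_coord_smooth d i 1 (B + 1).
  by congr smooth; apply/funext => x; rewrite mul1r.
have := @step_coord_smooth d i (-1) (B + 1).
by congr smooth; apply/funext => x; rewrite mulN1r.
Qed.

Lemma boxcut_ge0 d B (x : 'rV[R]_d) : 0 <= boxcut B x.
Proof. by apply: prodr_ge0 => i _; rewrite mulr_ge0 ?step_ge0. Qed.

Lemma boxcut_le1 d B (x : 'rV[R]_d) : boxcut B x <= 1.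
Proof.
rewrite /boxcut; elim: (index_enum _) => [|i r IH]; first by rewrite big_nil.
rewrite big_cons; apply: mulr_ile1 => //; first by rewrite mulr_ge0 ?step_ge0.
  by apply: prodr_ge0 => j _; rewrite mulr_ge0 ?step_ge0.
by apply: mulr_ile1; rewrite ?step_ge0 ?step_le1.
Qed.

Lemma boxcut1 d B (x : 'rV[R]_d) : `|x| <= B -> boxcut B x = 1.
Proof.
move=> xB; apply: big1 => i _.
have := le_trans (coord_le_norm x i) xB; rewrite ler_norml => /andP[h1 h2].
by rewrite !step1 ?mulr1//; lra.
Qed.

Lemma boxcut_gt0 d B (x : 'rV[R]_d) : 0 <= B -> `|x| < B + 1 -> 0 < boxcut B x.
Proof.
move=> B0 xB; apply: prodr_gt0 => i _.
have := le_lt_trans (coord_le_norm x i) xB; rewrite ltr_norml => /andP[h1 h2].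
by rewrite mulr_gt0// divr_gt0 ?step_den// ebump0_gt0//; lra.
Qed.

Lemma boxcut0 d B (x : 'rV[R]_d) : 0 <= B -> B + 1 <= `|x| -> boxcut B x = 0.
Proof.
move=> B0 xB; have [i xi] : exists i, B + 1 <= `|x 0 i|.
  apply: contrapT => H; have : `|x| < B + 1; last by rewrite ltNge xB.
  apply: normrV_lt; first lra.
  by move=> i; rewrite ltNge; apply/negP => xi; apply: H; exists i.
rewrite /boxcut (bigD1 i)//=.
suff -> : step (x 0 i + (B + 1)) * step (- x 0 i + (B + 1)) = 0 by rewrite mul0r.
move: xi; rewrite ler_normr => /orP[h|h].
  by rewrite [X in _ * X]step0 ?mulr0//; lra.
by rewrite [X in X * _]step0 ?mul0r//; lra.
Qed.

End Bump.

(** * Test functions and their bilinear forms *)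

Section TestFun.
Variable R : realType.

Lemma cont_epsE (V : normedModType R) (f : V -> R) : continuous f ->
  forall x e, 0 < e -> exists2 r : R, 0 < r & forall y, `|x - y| < r -> `|f x - f y| < e.
Proof.
move=> cf x e e0; have /cvgrPdist_lt/(_ _ e0)/nbhs_normP[s /= s0 hs] := cf x.
by exists s.
Qed.

Lemma test_sub d (A B : set 'rV[R]_d) f : A `<=` B -> test_fun A f -> test_fun B f.
Proof. by move=> AB [sf [K [cK [KA f0]]]]; split=> //; exists K; split=> //; split=> // x /KA /AB. Qed.

Lemma test_Cc d (A : set 'rV[R]_d) f : test_fun A f -> Cc f.
Proof.
move=> [sf [K [/compact_bounded [M [_ hM]] [_ f0]]]]; split; first exact: smooth_cont.
exists (`|M| + 1) => x xM; apply: f0 => Kx.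
have M1 : M < `|M| + 1 by apply: le_lt_trans (ler_norm _) _; rewrite ltrDl.
by have := hM _ M1 x Kx; rewrite /= leNgt xM.
Qed.

Lemma test_smooth d (A : set 'rV[R]_d) f : test_fun A f -> smooth f.
Proof. by case. Qed.

Lemma tfunP d (f : 'rV[R]_d -> R) : test_fun setT f <-> smooth f /\ Cc f.
Proof.
split; first by move=> tf; split; [exact: test_smooth tf|exact: test_Cc tf].
move=> [sf [_ [B f0]]]; split=> //; exists [set x | `|x| <= B]; split; first exact: ball_compact.
by split=> // x /= /negP; rewrite -ltNge => /f0.
Qed.

Lemma compact_nbhs_vanish d (K : set 'rV[R]_d) x : compact K -> ~ K x ->
  exists2 r : R, 0 < r & forall y, `|x - y| < r -> ~ K y.
Proof.
move=> cK nKx; have clK : closed K by apply: compact_closed => //; exact: norm_hausdorff.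
have : nbhs x (~` K) by apply: open_nbhs_nbhs; split=> //; exact: closed_openC.
by move/nbhs_normP => [r /= r0 hr]; exists r => // y; exact: hr.
Qed.

Lemma open_ball_sub d (U : set 'rV[R]_d) x : open U -> U x ->
  exists2 r : R, 0 < r & forall y, `|x - y| < r -> U y.
Proof.
move=> oU Ux; have : nbhs x U by apply: open_nbhs_nbhs.
by move/nbhs_normP => [r /= r0 hr]; exists r => // y; exact: hr.
Qed.

Lemma test_pderiv d (A : set 'rV[R]_d) i f : test_fun A f -> test_fun A (pderiv i f).
Proof.
move=> [sf [K [cK [KA f0]]]]; split; first exact: smooth_pderiv.
exists K; split=> //; split=> // x nKx.
have [r r0 hr] := compact_nbhs_vanish cK nKx.
have [_] : is_derive x (evec R i) f 0; last by [].
apply: (is_derive_near (g := cst 0)) (is_derive_cst _ _ _).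
by exists r => // y /hr /f0.
Qed.

Lemma testD d (A : set 'rV[R]_d) f g : test_fun A f -> test_fun A g ->
  test_fun A (fun x => f x + g x).
Proof.
move=> [sf [K [cK [KA f0]]]] [sg [L [cL [LA g0]]]]; split; first exact: (smoothD sf sg).
exists (K `|` L); split; first exact: compactU.
split; first by move=> x [/KA|/LA].
by move=> x nKL; rewrite f0 ?g0 ?addr0// => h; apply: nKL; [right|left].
Qed.

Lemma testM d (A : set 'rV[R]_d) f g : test_fun A f -> smooth g ->
  test_fun A (fun x => f x * g x).
Proof.
move=> [sf [K [cK [KA f0]]]] sg; split; first exact: (smoothM sf sg).
by exists K; split=> //; split=> // x /f0 ->; rewrite mul0r.
Qed.

Lemma testZ d (A : set 'rV[R]_d) c f : test_fun A f -> test_fun A (fun x => c * f x).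
Proof.
move=> tf; have := testM tf (@smooth_cst R d c).
by under eq_fun do rewrite mulrC.
Qed.

Lemma test0 d (A : set 'rV[R]_d) : test_fun A (fun _ => 0).
Proof.
by split; [exact: smooth_cst|exists set0; split; [exact: compact0|split]].
Qed.

Lemma test_sum d (A : set 'rV[R]_d) (I : Type) (r : seq I) (F : I -> 'rV[R]_d -> R) :
  (forall i, test_fun A (F i)) -> test_fun A (fun x => \sum_(i <- r) F i x).
Proof.
move=> tF; elim: r => [|i r IH].
  by under eq_fun do rewrite big_nil; exact: test0.
by under eq_fun do rewrite big_cons; exact: (testD (tF i) IH).
Qed.

Lemma smooth_local d (f : 'rV[R]_d -> R) :
  (forall x, exists2 r : R, 0 < r & exists2 g, smooth g & forall y, `|x - y| < r -> f y = g y) ->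
  smooth f.
Proof.
pose S (f : 'rV[R]_d -> R) := forall x, exists2 r : R, 0 < r &
  exists2 g, smooth g & forall y, `|x - y| < r -> f y = g y.
suff : S f -> smooth f by [].
apply: (@smooth_coind R d S) f => f Sf.
have D i x : exists l, is_derive x (evec R i) f l.
  have [r r0 [g sg fg]] := Sf x; exists (pderiv i g x).
  by apply: (is_derive_near (g := g)); [exists r|exact: smooth_is_derive].
split; last split.
- apply: cont_eps => x e e0; have [r r0 [g sg fg]] := Sf x.
  have [s s0 hs] := cont_epsE (smooth_cont sg) x e0.
  exists (Num.min r s); first by rewrite lt_min r0.
  move=> y; rewrite lt_min => /andP[y1 y2]; rewrite !fg//; first exact: hs.
  by rewrite subrr normr0.
- by move=> i x; have [l [? _]] := D i x.
- move=> i x; have [r r0 [g sg fg]] := Sf x.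
  exists (r / 2); first lra.
  exists (pderiv i g); first exact: smooth_pderiv.
  move=> y xy; have [_] : is_derive y (evec R i) f (pderiv i g y); last by [].
  apply: (is_derive_near (g := g)); last exact: smooth_is_derive.
  exists (r / 2); first lra.
  move=> z yz; apply: fg; rewrite (_ : x - z = (x - y) + (y - z)); last by rewrite addrA subrK.
  by apply: le_lt_trans (ler_normD _ _) _; lra.
Qed.

(** Near a point of U the function coincides with f; a point outside U has positive distance to K,
    so the function vanishes around it. This isolates one component of a function whose own support
    is larger. *)
Lemma test_glue d (f : 'rV[R]_d -> R) (U K : set 'rV[R]_d) : smooth f -> open U ->
  compact K -> K `<=` U -> (forall x, U x -> ~ K x -> f x = 0) ->
  test_fun U (fun x => if `[< U x >] then f x else 0).
Proof.
move=> sf oU cK KU f0; split; last first.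
  exists K; split=> //; split=> // x nKx; case: asboolP => // Ux; exact: f0.
apply: smooth_local => x; have [Ux|nUx] := pselect (U x).
  have [r r0 hr] := open_ball_sub oU Ux.
  by exists r => //; exists f => // y /hr Uy; rewrite asboolT.
have nKx : ~ K x by move/KU.
have [r r0 hr] := compact_nbhs_vanish cK nKx.
exists r => //; exists (fun=> 0); first exact: smooth_cst.
by move=> y /hr nKy; case: asboolP => // Uy; exact: f0.
Qed.

Lemma pderiv_lin d i (f g : 'rV[R]_d -> R) a : smooth f -> smooth g ->
  pderiv i (fun x => f x + a * g x) = fun x => pderiv i f x + a * pderiv i g x.
Proof.
move=> sf sg; apply: pderivE => x; apply: is_deriveDf; first exact: smooth_is_derive.
have := is_deriveMf (is_derive_cst a x (evec R i)) (smooth_is_derive i x sg).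
by rewrite mulr0 addr0.
Qed.

Lemma pderivM d i (f g : 'rV[R]_d -> R) : smooth f -> smooth g ->
  pderiv i (fun x => f x * g x) = fun x => f x * pderiv i g x + g x * pderiv i f x.
Proof.
by move=> sf sg; apply: pderivE => x; apply: is_deriveMf; exact: smooth_is_derive.
Qed.

Local Notation tf f := (test_fun setT f).

Lemma tf_CcM d (f g : 'rV[R]_d -> R) : tf f -> tf g -> Cc (fun x => f x * g x).
Proof. by move=> /test_Cc cf /test_Cc [cg _]; exact: CcM. Qed.

Lemma tf_CcD d (f g : 'rV[R]_d -> R) : tf f -> tf g ->
  Cc (fun x => \sum_(i < d) pderiv i f x * pderiv i g x).
Proof. by move=> ff fg; apply: Cc_sum => i; apply: tf_CcM; exact: test_pderiv. Qed.

Lemma L2ip_sym d (f g : 'rV[R]_d -> R) : L2ip_f f g = L2ip_f g f.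
Proof. by congr intRd; apply/funext => x; rewrite mulrC. Qed.

Lemma Dform_sym d (f g : 'rV[R]_d -> R) : Dform_f f g = Dform_f g f.
Proof. by congr intRd; apply/funext => x; apply: eq_bigr => i _; rewrite mulrC. Qed.

Lemma L2ip_lin d (f g h : 'rV[R]_d -> R) a : tf f -> tf g -> tf h ->
  L2ip_f (fun x => f x + a * g x) h = L2ip_f f h + a * L2ip_f g h.
Proof.
move=> ff fg fh; rewrite /L2ip_f -intRd_lin; [|exact: tf_CcM..].
by congr intRd; apply/funext => x; ring.
Qed.

Lemma Dform_lin d (f g h : 'rV[R]_d -> R) a : tf f -> tf g -> tf h ->
  Dform_f (fun x => f x + a * g x) h = Dform_f f h + a * Dform_f g h.
Proof.
move=> ff fg fh; rewrite /Dform_f -intRd_lin; [|exact: tf_CcD..].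
congr intRd; apply/funext => x; rewrite mulr_sumr -big_split; apply: eq_bigr => i _ /=.
by rewrite pderiv_lin; [ring|exact: test_smooth ff|exact: test_smooth fg].
Qed.

Lemma L2ip_ge0 d (f : 'rV[R]_d -> R) : 0 <= L2ip_f f f.
Proof. by apply: intRd_ge0 => x; rewrite -expr2 sqr_ge0. Qed.

Lemma Dform_ge0 d (f : 'rV[R]_d -> R) : 0 <= Dform_f f f.
Proof. by apply: intRd_ge0 => x; apply: sumr_ge0 => i _; rewrite -expr2 sqr_ge0. Qed.

Lemma L2ip_gt0 d (f : 'rV[R]_d -> R) x : tf f -> f x != 0 -> 0 < L2ip_f f f.
Proof.
move=> ff fx; apply: (intRd_gt0 (x0 := x)); first exact: tf_CcM.
  by move=> y; rewrite -expr2 sqr_ge0.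
by rewrite -expr2 lt_def sqr_ge0 andbT expf_eq0.
Qed.

Lemma int_by_parts d i (f g : 'rV[R]_d -> R) : tf f -> tf g ->
  L2ip_f (pderiv i f) g = - L2ip_f f (pderiv i g).
Proof.
move=> ff fg; have [sf sg] := (test_smooth ff, test_smooth fg).
apply/eqP; rewrite -addr_eq0 /L2ip_f -intRdD; last 2 first.
- exact: (tf_CcM (test_pderiv i ff) fg).
- exact: (tf_CcM ff (test_pderiv i fg)).
have tfg : tf (fun x => f x * g x) by exact: testM.
rewrite (_ : (fun x => _) = pderiv i (fun x => f x * g x)); last first.
  by rewrite pderivM//; apply/funext => x; rewrite addrC [g x * _]mulrC.
apply/eqP; apply: intRd_deriv.
- exact: test_Cc tfg.
- exact: test_Cc (test_pderiv i tfg).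
- by move=> x; apply: smooth_derivable; exact: smoothM.
Qed.

End TestFun.

(** * A Poincare inequality in finite codimension *)

Section Landau.
Variable R : realType.
Local Notation tf f := (test_fun setT f).

Lemma bernoulli_pow (h : R) m : 0 <= h -> 1 + m%:R * h <= (1 + h) ^+ m.
Proof.
move=> h0; elim: m => [|m IH]; first by rewrite mul0r addr0 expr0.
rewrite exprS; apply: (@le_trans _ _ ((1 + h) * (1 + m%:R * h))).
  rewrite -natr1; have : 0 <= m%:R * h * h by rewrite !mulr_ge0.
  lra.
by rewrite ler_wpM2l//; lra.
Qed.

Lemma quad_disc (a b c : R) : 0 <= c -> (forall t : R, 0 <= a + 2 * t * b + t ^+ 2 * c) ->
  b ^+ 2 <= a * c.
Proof.
move=> c0 H; have a0 : 0 <= a by have := H 0; rewrite mulr0 mul0r expr0n mul0r !addr0.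
move: c0; rewrite le_eqVlt => /orP[/eqP c0|c0].
  rewrite -c0 mulr0 leNgt; apply/negP => b0.
  have bn0 : b != 0 by move: b0; apply: contraTneq => ->; rewrite expr0n ltxx.
  (* For c = 0 the form is affine in t, and this t gives it the value -1. *)
  have := H (- (a + 1) / (2 * b)); rewrite -c0 mulr0 addr0.
  have -> : 2 * (- (a + 1) / (2 * b)) * b = - (a + 1) by field.
  lra.
have := H (- b / c).
have -> : a + 2 * (- b / c) * b + (- b / c) ^+ 2 * c = (a * c - b ^+ 2) / c.
  by field; rewrite gt_eqF.
by rewrite pmulr_lge0 ?invr_gt0// subr_ge0.
Qed.

Lemma sum_CS (I : Type) (r : seq I) (a b : I -> R) :
  (\sum_(i <- r) a i * b i) ^+ 2 <= (\sum_(i <- r) a i ^+ 2) * (\sum_(i <- r) b i ^+ 2).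
Proof.
apply: quad_disc; first by apply: sumr_ge0 => i _; exact: sqr_ge0.
move=> t; rewrite !mulr_sumr -!big_split /=; apply: sumr_ge0 => i _.
have -> : a i ^+ 2 + 2 * t * (a i * b i) + t ^+ 2 * b i ^+ 2 = (a i + t * b i) ^+ 2 by ring.
exact: sqr_ge0.
Qed.

Lemma Cc_sq d (f : 'rV[R]_d -> R) : Cc f -> Cc (fun x => f x ^+ 2).
Proof. by move=> cf; under eq_fun do rewrite expr2; apply: CcM => //; case: cf. Qed.

Lemma CcB d (f g : 'rV[R]_d -> R) : Cc f -> Cc g -> Cc (fun x => f x - g x).
Proof.
move=> cf cg; under eq_fun do rewrite -mulN1r; apply: CcD => //; exact: CcZ.
Qed.

Lemma Cc_shift d (f : 'rV[R]_d -> R) (z : 'rV[R]_d) : Cc f -> Cc (fun x => f (x + z)).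
Proof.
move=> cf; have := Cc_affine z (unitmx1 R d) cf.
by under eq_fun do rewrite mulmx1.
Qed.

Definition tdiff d (u : 'rV[R]_d -> R) (z : 'rV[R]_d) := intRd (fun x => (u (x + z) - u x) ^+ 2).

(** The translation is telescoped into n equal ones, and Cauchy-Schwarz is applied to the n
    increments, each of the same norm by translation invariance. *)
Lemma tdiff_scale d (u : 'rV[R]_d -> R) (z : 'rV[R]_d) n : (0 < n)%N -> Cc u ->
  tdiff u z <= n%:R ^+ 2 * tdiff u (n%:R^-1 *: z).
Proof.
move=> n0 cu; have nn0 : (n%:R : R) != 0 by rewrite pnatr_eq0 -lt0n.
set y := n%:R^-1 *: z.
pose b (k : nat) (x : 'rV[R]_d) := u (x + k%:R *: y + y) - u (x + k%:R *: y).
have E x : u (x + z) - u x = \sum_(k < n) b k x.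
  rewrite -(big_mkord xpredT (b ^~ x)) (telescope_sumr_eq (fun k => u (x + k%:R *: y)))//.
    by rewrite scale0r addr0 /y scalerA divff// scale1r.
  by move=> k _; rewrite /b -addrA -[X in _ + (_ + X)]scale1r -scalerDl natr1.
have cb k : Cc (b k).
  apply: CcB; last exact: Cc_shift.
  have := Cc_shift (k%:R *: y + y) cu.
  by under eq_fun do rewrite addrA.
have cE : Cc (fun x => u (x + z) - u x) by apply: CcB => //; exact: Cc_shift.
apply: (@le_trans _ _ (intRd (fun x => n%:R * \sum_(k < n) b k x ^+ 2))).
  apply: intRd_le; first exact: Cc_sq.
    by apply: CcZ; apply: Cc_sum => k; exact: Cc_sq.
  move=> x; rewrite E.
  have := sum_CS (index_enum 'I_n) (fun=> 1) (fun k : 'I_n => b k x).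
  under eq_bigr do rewrite mul1r.
  by under [X in _ <= X * _ -> _]eq_bigr do rewrite expr1n; rewrite sumr_const card_ord.
rewrite intRdZ; last by apply: Cc_sum => k; exact: Cc_sq.
rewrite intRd_sum; last by move=> k; exact: Cc_sq.
have Eb k : intRd (fun x => b k x ^+ 2) = tdiff u y.
  rewrite /tdiff -(@intRd_shift _ _ (fun x => (u (x + y) - u x) ^+ 2) (k%:R *: y))//.
  by apply: Cc_sq; apply: CcB => //; exact: Cc_shift.
by under eq_bigr do rewrite Eb; rewrite sumr_const card_ord -[X in _ * X]mulr_natl expr2 mulrA.
Qed.

(** By [tdiff_scale] the translation may be replaced by a rescaled small one, whose difference
    quotient is uniformly close to the derivative along z; this replaces an integration over the
    segment. *)
Lemma tdiff_le d (u : 'rV[R]_d -> R) (z : 'rV[R]_d) : tf u ->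
  tdiff u z <= sqn z * Dform_f u u.
Proof.
move=> tu; have su := test_smooth tu; have cu := test_Cc tu.
pose v x := \sum_(i < d) z 0 i * pderiv i u x.
have tv : tf v by apply: test_sum => i; apply: testZ; exact: test_pderiv.
have cv := test_Cc tv.
apply: (@le_trans _ _ (L2ip_f v v)); last first.
  rewrite /Dform_f -intRdZ; last exact: tf_CcD.
  apply: intRd_le; first exact: tf_CcM.
    by apply: CcZ; exact: tf_CcD.
  move=> x; rewrite -expr2 /v; apply: le_trans (sum_CS _ _ _) _.
  by rewrite ler_wpM2l ?sqn_ge0//; apply: ler_sum => i _; rewrite expr2.
have Dv x : is_derive x z u (v x) := smooth_dir x z su.
have [C C0 vC] := Cc_bounded cv.
have [_ [B u0]] := cu; have [_ [B' v0]] := cv.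
pose B2 := Num.max (`|B| + `|z|) B'.
have [K K0 hK] := intRd_bound d B2.
apply/ler_addgt0Pr => e e0.
(* The quotient [w] differs from v by at most e' <= 1, and |v| <= C, so |w^2 - v^2| <= e' (2 C + 1);
   K turns this into a bound for the integral. *)
pose e' := Num.min 1 (e / (K * (2 * C + 1))).
have KC : 0 < K * (2 * C + 1) by rewrite mulr_gt0//; lra.
have e'0 : 0 < e' by rewrite lt_min ltr01 divr_gt0.
have [r r0 hr] := Cc_unif cv e'0.
pose n := (Num.truncn (`|z| / r)).+1.
have n0 : (0 : R) < n%:R by rewrite ltr0n.
have zn : n%:R^-1 * `|z| < r.
  have : `|z| / r < n%:R by apply: truncnS_gt.
  by rewrite ltr_pdivrMr// ltr_pdivrMl.
have apx x : `|n%:R * (u (x + n%:R^-1 *: z) - u x) - v x| <= e'.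
  have [xi xin E] := @mvt_line R d u z x n%:R^-1 (fun y => @ex_derive _ _ _ _ _ _ _ (Dv y)).
  have -> : n%:R * (u (x + n%:R^-1 *: z) - u x) = v (x + xi *: z).
    by rewrite E mulVKf ?gt_eqF//; have [_ <-] := Dv (x + xi *: z).
  apply: ltW; rewrite distrC; apply: hr; rewrite opprD addNKr normrN normrZ.
  apply: le_lt_trans zn; rewrite ler_wpM2r//; apply: le_trans xin _.
  by rewrite ger0_norm// invr_ge0 ltW.
apply: le_trans (@tdiff_scale _ u z n isT cu) _.
set y := n%:R^-1 *: z in apx *.
have cw : Cc (fun x => u (x + y) - u x) by apply: CcB => //; exact: Cc_shift.
rewrite /tdiff -intRdZ; last exact: Cc_sq.
rewrite -lerBlDl -intRdB; [|by apply: CcZ; exact: Cc_sq|exact: tf_CcM].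
apply: le_trans (ler_norm _) _.
apply: (@le_trans _ _ (K * (e' * (2 * C + 1)))).
  apply: hK.
  - apply: CcB; [by apply: CcZ; exact: Cc_sq|exact: tf_CcM].
  - move=> x; rewrite gt_max => /andP[h1 h2].
    have nz := normr_ge0 z; have hB := ler_norm B.
    have yz : `|y| <= `|z|.
      by rewrite normrZ ger0_norm ?invr_ge0 ?(ltW n0)// ler_piMl// invf_le1// ler1n.
    rewrite v0// u0; last by have : `|x| <= `|x + y| + `|y|; [rewrite -{1}(addrK y x) ler_normB|lra].
    by rewrite u0; [ring|lra].
  - by rewrite mulr_ge0 ?(ltW e'0)//; lra.
  - move=> x; have := apx x; set w := _ * (u _ - u x) => wx.
    have -> : n%:R ^+ 2 * (u (x + y) - u x) ^+ 2 - v x * v x = (w - v x) * (w - v x + 2 * v x).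
      by rewrite /w; ring.
    rewrite normrM; apply: ler_pM => //; apply: le_trans (ler_normD _ _) _.
    rewrite normrM (ger0_norm (ler0n _ 2)).
    have : e' <= 1 by rewrite ge_min lexx.
    by have := vC x; lra.
rewrite mulrCA -ler_pdivlMr// ge_min lexx orbT//.
Qed.

End Landau.

(** * Kernels of finite rank and the Landau kernel *)

Section FiniteCodim.
Variable R : realType.
Local Notation tf f := (test_fun setT f).

Definition finrank d (K : 'rV[R]_d -> 'rV[R]_d -> R) := exists (I : finType)
  (a b : I -> 'rV[R]_d -> R), [/\ forall i, smooth (a i), forall i, smooth (b i) &
    forall x y, K x y = \sum_i a i x * b i y].

Lemma finrank_l d (f : 'rV[R]_d -> R) : smooth f -> finrank (fun x _ => f x).
Proof.
move=> sf; exists unit, (fun=> f), (fun _ _ => 1); split; [by move=> _|by move=> _; exact: smooth_cst|move=> x y].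
by rewrite (big_pred1 tt) ?mulr1// => -[].
Qed.

Lemma finrank_r d (f : 'rV[R]_d -> R) : smooth f -> finrank (fun _ y => f y).
Proof.
move=> sf; exists unit, (fun _ _ => 1), (fun=> f); split; [by move=> _; exact: smooth_cst|by move=> _|move=> x y].
by rewrite (big_pred1 tt) ?mul1r// => -[].
Qed.

Lemma finrankD d (K L : 'rV[R]_d -> 'rV[R]_d -> R) : finrank K -> finrank L ->
  finrank (fun x y => K x y + L x y).
Proof.
move=> [I [a [b [sa sb E]]]] [J [a' [b' [sa' sb' E']]]].
exists (I + J)%type, (fun k => match k with inl i => a i | inr j => a' j end),
  (fun k => match k with inl i => b i | inr j => b' j end); split.
- by case.
- by case.
- by move=> x y; rewrite E E' big_sumType.
Qed.

Lemma finrankM d (K L : 'rV[R]_d -> 'rV[R]_d -> R) : finrank K -> finrank L ->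
  finrank (fun x y => K x y * L x y).
Proof.
move=> [I [a [b [sa sb E]]]] [J [a' [b' [sa' sb' E']]]].
exists (I * J)%type, (fun k x => a k.1 x * a' k.2 x), (fun k x => b k.1 x * b' k.2 x); split.
- by move=> k; exact: (smoothM (sa k.1) (sa' k.2)).
- by move=> k; exact: (smoothM (sb k.1) (sb' k.2)).
- move=> x y; rewrite E E' mulr_suml.
  rewrite -(pair_bigA _ (fun i j => a i x * a' j x * (b i y * b' j y))) /=.
  by apply: eq_bigr => i _; rewrite mulr_sumr; apply: eq_bigr => j _; rewrite mulrACA.
Qed.

Lemma finrankX d (K : 'rV[R]_d -> 'rV[R]_d -> R) m : finrank K ->
  finrank (fun x y => K x y ^+ m).
Proof.
move=> fK; elim: m => [|m IH]; first exact: (finrank_l (@smooth_cst R d 1)).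
have [I [a [b [sa sb E]]]] := finrankM fK IH.
by exists I, a, b; split=> // x y; rewrite exprS.
Qed.

Lemma finrank_sum d (I : Type) (r : seq I) (K : I -> 'rV[R]_d -> 'rV[R]_d -> R) :
  (forall i, finrank (K i)) -> finrank (fun x y => \sum_(i <- r) K i x y).
Proof.
move=> fK; elim: r => [|i r IH].
  have [J [a [b [sa sb E]]]] := finrank_l (@smooth_cst R d 0).
  by exists J, a, b; split=> // x y; rewrite big_nil.
have [J [a [b [sa sb E]]]] := finrankD (fK i) IH.
by exists J, a, b; split=> // x y; rewrite big_cons.
Qed.

Lemma finrank_dist d (r : R) m : finrank (fun x y : 'rV[R]_d => (1 - sqn (x - y) / r) ^+ m).
Proof.
apply: finrankX.
have fc (c : R) : finrank (fun _ _ : 'rV[R]_d => c) by exact: (finrank_l (@smooth_cst R d c)).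
have fs : finrank (fun x y : 'rV[R]_d => 1 + (- r^-1) * \sum_(i < d) (x 0 i + (-1) * y 0 i) ^+ 2).
  apply: finrankD => //; apply: finrankM => //; apply: finrank_sum => i; apply: finrankX.
  apply: finrankD; first exact: (@finrank_l d (fun x => x 0 i) (@smooth_coord R d i)).
  by apply: finrankM => //; exact: (@finrank_r d (fun x => x 0 i) (@smooth_coord R d i)).
have [I [a [b [sa sb E]]]] := fs; exists I, a, b; split=> // x y; rewrite -E.
rewrite mulNr mulrC; congr (1 - _ * _).
by apply: eq_bigr => i _; rewrite !mxE mulN1r.
Qed.

(** The left side is the second moment of the kernel [radial r ^+ m] divided by r^2. If the bound
    failed for all m, the integrals of the powers would decay like (1 - e)^m, whereas they are at
    least a constant times (1 - e/2)^m. The exponent 0 is excluded because the constant 1 has no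
    compact support when d > 0. *)
Lemma radial_conc d (r e : R) : 0 < r -> 0 < e -> e < 1 -> exists2 m : nat, (0 < m)%N &
  intRd (fun x : 'rV[R]_d => radial r x ^+ m) - intRd (fun x : 'rV[R]_d => radial r x ^+ m.+1)
    <= e * intRd (fun x : 'rV[R]_d => radial r x ^+ m).
Proof.
move=> r0 e0 e1; apply: contrapT => H.
pose Im m := intRd (fun x : 'rV[R]_d => radial r x ^+ m).
have cI m : Cc (fun x : 'rV[R]_d => radial r x ^+ m.+1).
  under eq_fun do rewrite exprS; apply: CcM; first exact: radial_Cc.
  by apply: contX; case: (@radial_Cc R d r r0).
have dec m : (0 < m)%N -> Im m.+1 < (1 - e) * Im m.
  move=> m0; rewrite ltNge; apply/negP => h; apply: H; exists m => //.
  by rewrite -!/(Im _); lra.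
have dec2 m : Im m.+1 <= (1 - e) ^+ m * Im 1.
  elim: m => [|m IH]; first by rewrite expr0 mul1r.
  apply: le_trans (ltW (dec m.+1 isT)) _; rewrite exprS -mulrA ler_wpM2l//; lra.
(* A continuous minorant of the indicator of the set where [radial] exceeds 1 - e/2; its integral is
   positive because this set contains 0. *)
pose psi (x : 'rV[R]_d) := Num.max 0 (radial r x - (1 - e / 2)).
have cpsi : Cc psi.
  have [cr [B rB]] := @radial_Cc R d r r0; split.
    apply: cont_max; first exact: cont_cst.
    by apply: contB => //; exact: cont_cst.
  by exists B => x /rB rx; rewrite /psi rx max_l//; lra.
have psi_ge0 x : 0 <= psi x by rewrite /psi le_max lexx.
pose c := intRd psi.
have c0 : 0 < c.
  apply: (intRd_gt0 (x0 := 0)) => //; rewrite /psi radial0 lt_max; apply/orP; right; lra.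
have low m : (1 - e / 2) ^+ m.+1 * c <= Im m.+1.
  rewrite -intRdZ//; apply: intRd_le; [exact: CcZ|exact: cI|].
  move=> x; rewrite /psi; case: (leP 0 (radial r x - (1 - e / 2))) => h; last first.
    by rewrite mulr0 exprn_ge0// radial_ge0.
  apply: (@le_trans _ _ ((1 - e / 2) ^+ m.+1 * 1)).
    by rewrite ler_wpM2l ?exprn_ge0//; first lra; have := radial_le1 r x; lra.
  by rewrite mulr1 ler_pXn2r// ?nnegrE; lra.
(* The ratio of the two geometric rates is 1 + h, and Bernoulli makes its powers unbounded. *)
pose h := (e / 2) / (1 - e).
have h0 : 0 < h by rewrite divr_gt0; lra.
have E1 : 1 - e / 2 = (1 + h) * (1 - e).
  by rewrite /h mulrDl mul1r divfK; [lra|rewrite gt_eqF//; lra].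
have bnd m : m%:R * h * (c * (1 - e / 2)) <= Im 1.
  have p : 0 < (1 - e) ^+ m by rewrite exprn_gt0//; lra.
  rewrite -(ler_pM2l p); apply: le_trans (dec2 m); apply: le_trans (low m).
  rewrite [(1 - e / 2) ^+ m.+1]exprS (_ : (1 - e / 2) ^+ m = (1 + h) ^+ m * (1 - e) ^+ m); last by rewrite E1 exprMn.
  have b := bernoulli_pow m (ltW h0).
  have -> : (1 - e / 2) * ((1 + h) ^+ m * (1 - e) ^+ m) * c =
    (1 - e) ^+ m * ((1 + h) ^+ m * (c * (1 - e / 2))) by ring.
  rewrite ler_wpM2l ?(ltW p)// ler_wpM2r//; last lra.
  by rewrite mulr_ge0 ?ltW//; lra.
have e3 : 0 < 1 - e / 2 by lra.
have cc : 0 < h * (c * (1 - e / 2)) := mulr_gt0 h0 (mulr_gt0 c0 e3).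
have := bnd (Num.truncn (Im 1 / (h * (c * (1 - e / 2))))).+1.
rewrite -mulrA -ler_pdivlMr//; apply/negP; rewrite -ltNge.
exact: truncnS_gt.
Qed.

Lemma Cc2_intro d e (F : 'rV[R]_d -> 'rV[R]_e -> R) (B : R) :
  continuous (fun z : 'rV[R]_(d + e) => F (lsubmx z) (rsubmx z)) ->
  (forall x y, B < `|x| \/ B < `|y| -> F x y = 0) -> Cc2 F.
Proof.
move=> cF F0; split=> //; exists B => z zB; apply: F0.
apply: contrapT => /not_orP[/negP h1 /negP h2].
move: h1 h2; rewrite -!leNgt => h1 h2.
suff : `|z| <= B by rewrite leNgt zB.
rewrite -(hsubmxK z); apply: normrV_le; first exact: le_trans (normr_ge0 _) h1.
by move=> i; rewrite mxE; case: splitP => j _; apply: le_trans (coord_le_norm _ _) _.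
Qed.

(** Integrating [tdiff_le] in z against the kernel [rho] of mass [Im] bounds |u|^2 - P / Im by (e /
    2) |grad u|^2, where P averages the autocorrelation of u; what remains is to estimate P. *)
Lemma finite_codim_poincare d (B e : R) : 0 <= B -> 0 < e ->
  exists (I : finType) (a : I -> 'rV[R]_d -> R), (forall i, tf (a i)) /\
  forall u : 'rV[R]_d -> R, tf u -> (forall x, B < `|x| -> u x = 0) ->
    L2ip_f u u <= e * Dform_f u u + \sum_i L2ip_f u (a i) ^+ 2.
Proof.
move=> B0 e0.
(* At least the Euclidean distance of any two points of the box, so that [radial] at their
   difference is the polynomial and not its truncation at 0. The summands 1 keep r positive. *)
pose r := 2 * (B + 1) * (d%:R + 1).
have d0 : (0 : R) <= d%:R by [].
have r0 : 0 < r by rewrite /r !mulr_gt0//; lra.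
(* The second moment of the kernel is r^2 times the quantity bounded by [radial_conc], which also
   asks for a parameter below 1. *)
pose e' := Num.min (1 / 2) (e / r ^+ 2).
have r20 : 0 < r ^+ 2 by rewrite exprn_gt0.
have e'0 : 0 < e' by rewrite lt_min divr_gt0//= divr_gt0.
have e'1 : e' < 1 by rewrite gt_min; apply/orP; left; lra.
have [m m0 conc] := @radial_conc d r e' r0 e'0 e'1.
pose rho (x : 'rV[R]_d) := radial r x ^+ m.
have crho : Cc rho.
  rewrite /rho -(prednK m0); under eq_fun do rewrite exprS; apply: CcM; first exact: radial_Cc.
  by apply: contX; case: (@radial_Cc R d r r0).
have crho1 : Cc (fun x : 'rV[R]_d => radial r x ^+ m.+1).
  under eq_fun do rewrite exprS; apply: CcM; first exact: radial_Cc.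
  by case: crho.
have rho_ge0 x : 0 <= rho x by rewrite exprn_ge0// radial_ge0.
pose Im := intRd rho.
have Im0 : 0 < Im.
  by apply: (intRd_gt0 (x0 := 0)) => //; rewrite /rho radial0 expr1n.
have [I [a [b [sa sb E]]]] := @finrank_dist d (r ^+ 2) m.
(* Makes [k ^+ 2] at least 1 / Im, on whichever side of 1 this lies. *)
pose k := Im^-1 + 1.
have k0 : 0 < k by rewrite ltr_wpDl// invr_ge0 ltW.
pose eta := @boxcut R d B.
have teta (g : 'rV[R]_d -> R) : smooth g -> tf (fun x => k * (boxcut B x * g x)).
  move=> sg; apply: testZ; apply: testM => //; apply/tfunP; split; first exact: boxcut_smooth.
  split; first exact: smooth_cont (@boxcut_smooth R d B).
  by exists (B + 1) => x /ltW; exact: boxcut0.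
(* The factor [boxcut] is 1 on the support of u and turns the smooth factors of the kernel into test
   functions. Both families are kept because a product of two coefficients is bounded by the sum of
   their squares. *)
exists (I + I)%type, (fun j x => k * (boxcut B x * (match j with inl i => a i | inr i => b i end) x)).
split; first by case=> i; exact: teta.
move=> u tu u0; have cu := test_Cc tu; have [cuc _] := cu.
have cuu : Cc (fun x => u x * u x) by exact: tf_CcM.
have E1 z : tdiff u z = 2 * L2ip_f u u - 2 * intRd (fun x => u (x + z) * u x).
  have c1 : Cc (fun x => u (x + z) * u x) by apply: CcM => //; exact: Cc_shift.
  have c2 : Cc (fun x => u (x + z) * u (x + z)) by exact: (Cc_shift z cuu).
  rewrite /tdiff (_ : (fun x => _) = (fun x => (u (x + z) * u (x + z) + u x * u x) + (-2) * (u (x + z) * u x))); last first.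
    by apply/funext => x; ring.
  rewrite intRd_lin//; last exact: CcD.
  rewrite intRdD// (@intRd_shift _ _ (fun x => u x * u x))// /L2ip_f.
  by rewrite mulrDl mul1r mulNr.
have sup z : rho z * (2 * L2ip_f u u - 2 * intRd (fun x => u (x + z) * u x)) <=
    r ^+ 2 * (rho z - radial r z ^+ m.+1) * Dform_f u u.
  rewrite -E1; apply: (@le_trans _ _ (rho z * (sqn z * Dform_f u u))).
    by rewrite ler_wpM2l//; exact: tdiff_le.
  rewrite mulrA ler_wpM2r ?Dform_ge0//.
  have [h|h] := leP 0 (1 - sqn z / r ^+ 2).
    have -> : sqn z = r ^+ 2 * (1 - radial r z).
      by rewrite /radial max_r//; field; rewrite gt_eqF.
    by rewrite /rho [radial r z ^+ m.+1]exprS le_eqVlt; apply/orP; left; apply/eqP; ring.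
  by rewrite /rho /radial max_l ?(ltW h)// !expr0n eqn0Ngt m0 /= !(mulr0, mul0r, subrr).
(* On the support, [rho (y - x)] is a polynomial, so the double integral [P] of
   [F] is a finite sum of products of scalar products of u. *)
pose F (z x : 'rV[R]_d) := rho z * (u (x + z) * u x).
have cF : Cc2 F.
  have [crc [C rC]] := crho.
  apply: (@Cc2_intro _ _ _ (Num.max B C)).
    apply: contM; first by apply: cont_comp; [exact: crc|exact: cont_lsub].
    apply: contM; last by apply: cont_comp; [exact: cuc|exact: cont_rsub].
    apply: cont_comp; first exact: cuc.
    exact: (contDV (@cont_rsub R d d) (@cont_lsub R d d)).
  move=> x y; rewrite !gt_max => -[/andP[_ h]|/andP[h _]]; rewrite /F; first by rewrite rC// mul0r.
  by rewrite [u y]u0// !mulr0.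
have cg z : Cc (fun x => u (x + z) * u x) by apply: CcM => //; exact: Cc_shift.
have EF z : intRd (F z) = rho z * intRd (fun x => u (x + z) * u x) by rewrite intRdZ.
have cP : Cc (fun z => rho z * intRd (fun x => u (x + z) * u x)).
  have := Cc2_int cF; congr Cc; apply/funext => z; exact: EF.
set L := L2ip_f u u in sup *; set D := Dform_f u u in sup *.
pose P := intRd (fun z => rho z * intRd (fun x => u (x + z) * u x)).
(* The bound [sup] integrated over z; its right side is the second moment controlled by [conc]. *)
have main : 2 * L * Im - 2 * P <= e * D * Im.
  have h1 : intRd (fun z => rho z * (2 * L - 2 * intRd (fun x => u (x + z) * u x))) = 2 * L * Im - 2 * P.
    rewrite -mulNr -[2 * L * Im]intRdZ// -intRd_lin//; last exact: CcZ.
    by congr intRd; apply/funext => z; ring.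
  have c3 : Cc (fun z => (2 * L) * rho z + (-2) * (rho z * intRd (fun x => u (x + z) * u x))).
    by apply: CcD; exact: CcZ.
  have c4 : Cc (fun z => r ^+ 2 * D * (rho z + (-1) * radial r z ^+ m.+1)).
    by apply: CcZ; apply: CcD => //; exact: CcZ.
  have h2 : intRd (fun z => r ^+ 2 * D * (rho z + (-1) * radial r z ^+ m.+1)) =
      r ^+ 2 * D * (Im - intRd (fun z : 'rV[R]_d => radial r z ^+ m.+1)).
    by rewrite intRdZ; [rewrite intRd_lin// mulN1r|apply: CcD => //; exact: CcZ].
  rewrite -h1; apply: (@le_trans _ _ (r ^+ 2 * D * (Im - intRd (fun z : 'rV[R]_d => radial r z ^+ m.+1)))).
    rewrite -h2; apply: intRd_le => //.
      move: c3; congr Cc; apply/funext => z; ring.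
    move=> z; apply: le_trans (sup z) _.
    by rewrite le_eqVlt; apply/orP; left; apply/eqP; ring.
  apply: (@le_trans _ _ (r ^+ 2 * D * (e' * Im))).
    by rewrite ler_wpM2l// mulr_ge0 ?Dform_ge0// ltW.
  have he' : e' <= e / r ^+ 2 by rewrite ge_min lexx orbT.
  have he2 : r ^+ 2 * e' <= e by rewrite mulrC -ler_pdivlMr.
  have -> : r ^+ 2 * D * (e' * Im) = r ^+ 2 * e' * (D * Im) by ring.
  by rewrite -(mulrA e) ler_wpM2r// mulr_ge0 ?Dform_ge0// ltW.
have cub (i : I) (g : I -> 'rV[R]_d -> R) : (forall i, smooth (g i)) -> Cc (fun x => u x * g i x).
  by move=> sg; apply: CcM => //; exact: smooth_cont (sg i).
have EP : P = \sum_i L2ip_f u (a i) * L2ip_f u (b i).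
  rewrite /P; have -> : (fun z => rho z * intRd (fun x => u (x + z) * u x)) = (fun z => intRd (F z)).
    by apply/funext => z; rewrite EF.
  rewrite intRd_swap//.
  have -> : (fun x => intRd (F^~ x)) = (fun x => \sum_i L2ip_f u (a i) * (u x * b i x)).
    apply/funext => x.
    have cFx : Cc (F^~ x) by exact: Cc2_l.
    rewrite -(intRd_shift (- x) cFx).
    have -> : (fun y => F (y + - x) x) = (fun y => \sum_i (u x * b i x) * (u y * a i y)).
      apply/funext => y; rewrite /F [x + _]addrC subrK.
      have [xB|xB] := leP `|x| B; last first.
        by rewrite !(u0 _ xB) !mulr0 big1// => i _; rewrite !mul0r.
      have [yB|yB] := leP `|y| B; last first.
        by rewrite (u0 _ yB) mul0r mulr0 big1// => i _; rewrite mul0r mulr0.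
      have -> : rho (y - x) = \sum_i a i y * b i x.
        rewrite -E /rho /radial max_r// subr_ge0 ler_pdivrMr// mul1r.
        apply: le_trans (sqn_norm _) _.
        have xy : `|y - x| <= 2 * B by have := ler_normB y x; lra.
        apply: (@le_trans _ _ (d%:R * (2 * B) ^+ 2)).
          by rewrite ler_wpM2l// ler_pXn2r// nnegrE// mulr_ge0.
        rewrite /r !exprMn -mulrA [d%:R * _]mulrCA ler_wpM2l ?exprn_ge0//.
        have h1 : B ^+ 2 <= (B + 1) ^+ 2 by rewrite ler_pXn2r// ?nnegrE; lra.
        have h2 : d%:R <= (d%:R + 1) ^+ 2 :> R by have := sqr_ge0 (d%:R : R); rewrite sqrrD1; lra.
        by rewrite mulrC; apply: ler_pM => //; exact: sqr_ge0.
      rewrite mulr_suml; apply: eq_bigr => i _; ring.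
    rewrite intRd_sum; last by move=> i; apply: CcZ; exact: cub.
    apply: eq_bigr => i _; rewrite intRdZ; last exact: cub.
    by rewrite mulrC.
  rewrite intRd_sum; last by move=> i; apply: CcZ; exact: cub.
  by apply: eq_bigr => i _; rewrite intRdZ//; exact: cub.
have Ek (g : 'rV[R]_d -> R) : smooth g -> L2ip_f u (fun x => k * (boxcut B x * g x)) = k * L2ip_f u g.
  move=> sg; rewrite /L2ip_f -intRdZ; last by apply: CcM => //; exact: smooth_cont sg.
  congr intRd; apply/funext => x.
  have [xB|xB] := leP `|x| B; last by rewrite u0// !mul0r mulr0.
  by rewrite boxcut1// mul1r mulrCA.
rewrite big_sumType /=.
under eq_bigr do rewrite Ek//.
under [X in _ + (_ + X)]eq_bigr do rewrite Ek//.
have h1 : L <= e / 2 * D + P * Im^-1.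
  by rewrite -(ler_pM2r Im0) mulrDl mulfVK ?gt_eqF//; lra.
apply: le_trans h1 _; apply: lerD.
  by rewrite ler_wpM2r ?Dform_ge0//; lra.
rewrite EP mulr_suml -big_split /=; apply: ler_sum => i _.
set x := L2ip_f u (a i); set y := L2ip_f u (b i).
have i0 : 0 <= Im^-1 by rewrite invr_ge0 ltW.
have k2 : Im^-1 <= k ^+ 2.
  by rewrite /k sqrrD1; have := sqr_ge0 Im^-1; lra.
apply: (@le_trans _ _ ((x ^+ 2 + y ^+ 2) * Im^-1)).
  rewrite ler_wpM2r//.
  by have := sqr_ge0 (x - y); have := sqr_ge0 x; have := sqr_ge0 y; rewrite sqrrB; lra.
rewrite !exprMn -mulrDr mulrC ler_wpM2r//.
by rewrite addr_ge0 ?sqr_ge0.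
Qed.

End FiniteCodim.

(** * The space W_0^{1,2} *)

Section Wspace.
Variables (R : realType) (d : nat).
Local Notation F := ('rV[R]_d -> R).
Local Notation tf f := (test_fun (@setT 'rV[R]_d) f).
Implicit Types (u v w : Wseq R d) (f g h : F).

Definition Nf f := L2ip_f f f + Dform_f f f.

(* Treats the L^2 product, the Dirichlet form and their sum at once; [qleN] is
   what makes them pass to the limit along W^{1,2}-Cauchy sequences. *)
Record qform (q : F -> F -> R) : Prop := {
  qlin : forall f g h a, tf f -> tf g -> tf h ->
    q (fun x => f x + a * g x) h = q f h + a * q g h;
  qsym : forall f g, q f g = q g f;
  qge0 : forall f, 0 <= q f f;
  qleN : forall f, q f f <= Nf f }.

Lemma qform_L2 : qform (@L2ip_f R d).
Proof.
split; [exact: L2ip_lin|exact: L2ip_sym|exact: L2ip_ge0|].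
by move=> f; rewrite lerDl Dform_ge0.
Qed.

Lemma qform_D : qform (@Dform_f R d).
Proof.
split; [exact: Dform_lin|exact: Dform_sym|exact: Dform_ge0|].
by move=> f; rewrite lerDr L2ip_ge0.
Qed.

Definition wadd u a v : Wseq R d := fun k x => u k x + a * v k x.
Definition wcst f : Wseq R d := fun _ => f.

Definition ext (q : F -> F -> R) u v : R := limn (fun k => q (u k) (v k)).

Lemma subE f g : f \- g = fun x => f x + (-1) * g x.
Proof. by apply/funext => x /=; rewrite mulN1r. Qed.

Section onform.
Variable q : F -> F -> R.
Hypothesis Q : qform q.

Lemma qlinr f g h a : tf f -> tf g -> tf h -> q h (fun x => f x + a * g x) = q h f + a * q h g.
Proof. by move=> tf_ tg th; rewrite (qsym Q) (qlin Q)// !(qsym Q h). Qed.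

Lemma qsq f g a : tf f -> tf g ->
  q (fun x => f x + a * g x) (fun x => f x + a * g x) = q f f + 2 * a * q f g + a ^+ 2 * q g g.
Proof.
move=> ff fg; have fs : tf (fun x => f x + a * g x) by apply: testD => //; exact: testZ.
by rewrite (qlin Q)// !qlinr// (qsym Q g f); ring.
Qed.

Lemma qCS f g : tf f -> tf g -> q f g ^+ 2 <= q f f * q g g.
Proof.
move=> ff fg; apply: quad_disc; first exact: qge0.
by move=> t; rewrite -qsq//; exact: qge0.
Qed.

Lemma q_add_le f g a : tf f -> tf g ->
  q (fun x => f x + a * g x) (fun x => f x + a * g x) <= 2 * q f f + 2 * a ^+ 2 * q g g.
Proof.
move=> ff fg; have := qge0 Q (fun x => f x + (- a) * g x).
by rewrite !qsq// sqrrN; lra.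
Qed.

End onform.

Lemma qform_N : qform (fun f g => L2ip_f f g + Dform_f f g).
Proof.
split=> [f g h a ff fg fh|f g|f|f].
- by rewrite (qlin qform_L2)// (qlin qform_D)//; ring.
- by rewrite (qsym qform_L2) (qsym qform_D).
- by rewrite addr_ge0 ?L2ip_ge0 ?Dform_ge0.
- by [].
Qed.

Lemma W0_sub A B u : A `<=` B -> W0 A u -> W0 B u.
Proof. by move=> AB [tu cu]; split=> // k; exact: test_sub AB (tu k). Qed.

Lemma W0_T A u : W0 A u -> W0 setT u.
Proof. exact: W0_sub. Qed.

Lemma W0_cst A f : test_fun A f -> W0 A (wcst f).
Proof.
move=> ff; split=> // e e0; exists 0%N => k l _ _.
rewrite (_ : (wcst f k \- wcst f l) = fun _ => 0); last by apply/funext => x; rewrite /= subrr.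
have Z : tf (fun _ : 'rV[R]_d => 0 : R) by exact: test0.
have := qlin qform_N (-1) Z Z Z.
rewrite (_ : (fun x => _) = (fun _ : 'rV[R]_d => 0)); last by apply/funext => x; rewrite mulr0 addr0.
by rewrite mulN1r subrr => ->.
Qed.

Lemma W0_wadd A u a v : W0 A u -> W0 A v -> W0 A (wadd u a v).
Proof.
move=> [tu cu] [tv cv]; split; first by move=> k; apply: testD => //; exact: testZ.
move=> e e0; have a0 : 0 < 4 * (a ^+ 2 + 1) by rewrite mulr_gt0// ltr_wpDl// sqr_ge0.
have [K1 h1] := cu (e / 4) (divr_gt0 e0 (ltr0n _ 4)).
have [K2 h2] := cv _ (divr_gt0 e0 a0).
exists (maxn K1 K2) => k l; rewrite !geq_max => /andP[k1 k2] /andP[l1 l2].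
have T (w : Wseq R d) k' : (forall k, test_fun A (w k)) -> tf (w k') by move=> tw; exact: test_sub (tw k').
have T2 (w : Wseq R d) k' l' : (forall k, test_fun A (w k)) -> tf (w k' \- w l').
  by move=> tw; rewrite subE; apply: testD; [|apply: testZ]; exact: T.
rewrite (_ : wadd u a v k \- wadd u a v l = fun x => (u k \- u l) x + a * (v k \- v l) x); last first.
  by apply/funext => x; rewrite /wadd /=; ring.
apply: le_lt_trans (q_add_le qform_N a (T2 u k l tu) (T2 v k l tv)) _.
have := h1 _ _ k1 l1; have := h2 _ _ k2 l2.
set x := _ + _; set y := _ + _ => hx hy.
have x0 : 0 <= x by rewrite addr_ge0 ?L2ip_ge0 ?Dform_ge0.
have : a ^+ 2 * x <= e / 4; last by rewrite -mulrA; lra.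
apply: (@le_trans _ _ ((a ^+ 2 + 1) * (e / (4 * (a ^+ 2 + 1))))).
  by apply: ler_pM => //; rewrite ?sqr_ge0 ?lerDl//; exact: ltW.
have a1 : a ^+ 2 + 1 != 0 by rewrite gt_eqF// ltr_wpDl ?sqr_ge0.
by rewrite le_eqVlt; apply/orP; left; apply/eqP; field.
Qed.

Lemma tW A u k : W0 A u -> tf (u k).
Proof. by move=> [tu _]; exact: test_sub (tu k). Qed.

Lemma W_bounded u : W0 setT u -> exists2 C : R, 0 < C & forall k, Nf (u k) <= C.
Proof.
move=> Wu; have [tu cu] := Wu; have [K hK] := cu 1 ltr01.
pose C := 2 * Nf (u K) + 2 + \sum_(k < K) Nf (u k).
have N0 f : 0 <= Nf f by rewrite addr_ge0 ?L2ip_ge0 ?Dform_ge0.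
have S0 : 0 <= \sum_(k < K) Nf (u k) by apply: sumr_ge0.
exists C; first by have := N0 (u K); rewrite /C; lra.
move=> k; have [kK|Kk] := ltnP k K.
  rewrite /C (bigD1 (Ordinal kK))//=.
  have : 0 <= \sum_(i < K | i != Ordinal kK) Nf (u i) by apply: sumr_ge0.
  by have := N0 (u K); lra.
have := hK _ _ Kk (leqnn K); rewrite -/(Nf _) => h.
have E : u k = fun x => (u k \- u K) x + 1 * u K x.
  by apply/funext => x /=; rewrite mul1r subrK.
have t1 : tf (u k \- u K) by rewrite subE; apply: testD => //; exact: testZ.
rewrite E; have := q_add_le qform_N 1 t1 (tu K); rewrite -!/(Nf _) expr1n.
by move=> h2; apply: le_trans h2 _; rewrite /C; lra.
Qed.

Lemma cauchy_seq (x : nat -> R) :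
  (forall e, 0 < e -> exists K : nat, forall k l, (K <= k)%N -> (K <= l)%N -> `|x k - x l| < e) ->
  cvgn x.
Proof.
move=> H; apply/cauchy_cvgP/cauchy_exP => e e0; have [K hK] := H e e0.
exists (x K); exists K => // k /= Kk; rewrite -ball_normE /=; exact: hK.
Qed.

Lemma cvg_epsP (x : nat -> R) l : x @ \oo --> l <->
  forall e, 0 < e -> exists K : nat, forall k, (K <= k)%N -> `|l - x k| < e.
Proof.
split.
  by move=> /cvgrPdist_lt H e /H [K _ hK]; exists K => k Kk; exact: hK.
by move=> H; apply/cvgrPdist_lt => e /H[K hK]; exists K.
Qed.

Lemma lim_le (x : nat -> R) l c K : x @ \oo --> l -> (forall k, (K <= k)%N -> x k <= c) -> l <= c.
Proof.
move=> /cvg_epsP xl xc; apply/ler_addgt0Pr => e e0.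
have [K' hK'] := xl e e0; have := hK' (maxn K K') (leq_maxr _ _).
have := xc (maxn K K') (leq_maxl _ _); rewrite ltr_norml => h /andP[_ h2].
lra.
Qed.

Lemma lim_ge (x : nat -> R) l c K : x @ \oo --> l -> (forall k, (K <= k)%N -> c <= x k) -> c <= l.
Proof.
move=> /cvg_epsP xl xc; apply/ler_addgt0Pr => e e0.
have [K' hK'] := xl e e0; have := hK' (maxn K K') (leq_maxr _ _).
have := xc (maxn K K') (leq_maxl _ _); rewrite ltr_norml => h /andP[h2 _].
lra.
Qed.

Section ext.
Variable q : F -> F -> R.
Hypothesis Q : qform q.

Lemma tfB f g : tf f -> tf g -> tf (f \- g).
Proof. by move=> ff fg; rewrite subE; apply: testD => //; exact: testZ. Qed.

(** [limn] has no meaning on a divergent sequence, so this convergence precedes every algebraic rule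
    for [ip] and [Dform]. It follows from bilinearity, Cauchy-Schwarz and boundedness in W^{1,2}. *)
Lemma ext_cvg u v : W0 setT u -> W0 setT v ->
  (fun k => q (u k) (v k)) @ \oo --> ext q u v.
Proof.
move=> Wu Wv; have [C C0 uC] := W_bounded Wu; have [D D0 vD] := W_bounded Wv.
have [[tu cu] [tv cv]] := (Wu, Wv).
apply: cauchy_seq => e e0.
have e20 : 0 < (e / 2) ^+ 2 by rewrite exprn_gt0//; lra.
have [K1 h1] := cu _ (divr_gt0 e20 D0).
have [K2 h2] := cv _ (divr_gt0 e20 C0).
exists (maxn K1 K2) => k l; rewrite !geq_max => /andP[k1 k2] /andP[l1 l2].
have E : q (u k) (v k) - q (u l) (v l) = q (u k \- u l) (v k) + q (u l) (v k \- v l).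
  by rewrite !subE (qlin Q)// (qlinr Q)//; ring.
have tuu := tfB (tu k) (tu l); have tvv := tfB (tv k) (tv l).
have b1 : `|q (u k \- u l) (v k)| < e / 2.
  rewrite -(@ltr_pXn2r _ 2)// ?nnegrE//; last lra.
  rewrite real_normK ?num_real//; apply: le_lt_trans (qCS Q tuu (tv k)) _.
  have := h1 _ _ k1 l1; rewrite ltr_pdivlMr//; apply: le_lt_trans.
  by apply: ler_pM; rewrite ?(qge0 Q)//; [exact: qleN|exact: le_trans (qleN Q _) (vD k)].
have b2 : `|q (u l) (v k \- v l)| < e / 2.
  rewrite -(@ltr_pXn2r _ 2)// ?nnegrE//; last lra.
  rewrite real_normK ?num_real//; apply: le_lt_trans (qCS Q (tu l) tvv) _.
  have := h2 _ _ k2 l2; rewrite ltr_pdivlMr// mulrC; apply: le_lt_trans.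
  by apply: ler_pM; rewrite ?(qge0 Q)//; [exact: le_trans (qleN Q _) (uC l)|exact: qleN].
by rewrite E; apply: le_lt_trans (ler_normD _ _) _; lra.
Qed.

Lemma ext_sym u v : ext q u v = ext q v u.
Proof.
rewrite /ext (_ : (fun k => q (u k) (v k)) = (fun k => q (v k) (u k)))//.
by apply/funext => k; rewrite (qsym Q).
Qed.

Lemma ext_lin u v w a : W0 setT u -> W0 setT v -> W0 setT w ->
  ext q (wadd u a v) w = ext q u w + a * ext q v w.
Proof.
move=> Wu Wv Ww.
apply: (@cvg_unique _ (@Rhausdorff R) _ _ _ _ (ext_cvg (W0_wadd a Wu Wv) Ww)).
rewrite (_ : (fun k => _) = (fun k => q (u k) (w k) + a * q (v k) (w k))).
  apply: cvgD; first exact: ext_cvg.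
  by apply: cvgM; [exact: cvg_cst|exact: ext_cvg].
by apply/funext => k; exact: (qlin Q _ (tW k Wu) (tW k Wv) (tW k Ww)).
Qed.

Lemma ext_linr u v w a : W0 setT u -> W0 setT v -> W0 setT w ->
  ext q w (wadd u a v) = ext q w u + a * ext q w v.
Proof. by move=> Wu Wv Ww; rewrite ext_sym ext_lin// !(ext_sym w). Qed.

Lemma ext_ge0 u : W0 setT u -> 0 <= ext q u u.
Proof. by move=> Wu; apply: (@lim_ge _ _ _ 0 (ext_cvg Wu Wu)) => k _; exact: qge0. Qed.

Lemma ext_cst f g : ext q (wcst f) (wcst g) = q f g.
Proof.
apply: (@cvg_lim _ (@Rhausdorff R)); apply/cvg_epsP => e e0; exists 0%N => k _.
by rewrite /wcst subrr normr0.
Qed.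

Lemma ext_sq u v a : W0 setT u -> W0 setT v ->
  ext q (wadd u a v) (wadd u a v) = ext q u u + 2 * a * ext q u v + a ^+ 2 * ext q v v.
Proof.
move=> Wu Wv; rewrite ext_lin//; last exact: W0_wadd.
by rewrite !ext_linr// (ext_sym v u); ring.
Qed.

Lemma ext_CS u v : W0 setT u -> W0 setT v -> ext q u v ^+ 2 <= ext q u u * ext q v v.
Proof.
move=> Wu Wv; apply: quad_disc; first exact: ext_ge0.
by move=> t; rewrite -ext_sq//; apply: ext_ge0; exact: W0_wadd.
Qed.

Lemma ext_add_le u v a : W0 setT u -> W0 setT v ->
  ext q (wadd u a v) (wadd u a v) <= 2 * ext q u u + 2 * a ^+ 2 * ext q v v.
Proof.
move=> Wu Wv; have := ext_ge0 (W0_wadd (- a) Wu Wv).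
by rewrite !ext_sq// sqrrN; lra.
Qed.

End ext.

(** The square of the W^{1,2} norm; hence the factors 2 in its triangle inequality. *)
Definition wn u := ip u u + energy u.

Lemma wn_ext u : W0 setT u -> wn u = ext (fun f g => L2ip_f f g + Dform_f f g) u u.
Proof.
move=> Wu; apply/esym; apply: (@cvg_unique _ (@Rhausdorff R) _ _ _ _ (ext_cvg qform_N Wu Wu)).
by apply: cvgD; [exact: (ext_cvg qform_L2)|exact: (ext_cvg qform_D)].
Qed.

Lemma wnE u : wn u = ip u u + energy u. Proof. by []. Qed.
Lemma ipE u v : ip u v = ext (@L2ip_f R d) u v. Proof. by []. Qed.
Lemma DformE u v : Dform u v = ext (@Dform_f R d) u v. Proof. by []. Qed.
Lemma energyE u : energy u = Dform u u. Proof. by []. Qed.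
Lemma wadd_at u a v k : wadd u a v k = fun x => u k x + a * v k x. Proof. by []. Qed.
Lemma wadd_cst f a g : wadd (wcst f) a (wcst g) = wcst (fun x => f x + a * g x). Proof. by []. Qed.
Opaque wn ext ip Dform energy wadd.

Lemma ip_ge0 u : W0 setT u -> 0 <= ip u u.
Proof. by move=> Wu; rewrite ipE; exact: (ext_ge0 qform_L2). Qed.

Lemma energy_ge0 u : W0 setT u -> 0 <= energy u.
Proof. by move=> Wu; rewrite energyE DformE; exact: (ext_ge0 qform_D). Qed.

Lemma wn_ge0 u : W0 setT u -> 0 <= wn u.
Proof. by move=> Wu; rewrite wnE addr_ge0 ?ip_ge0 ?energy_ge0. Qed.

Lemma wn_add_le u v a : W0 setT u -> W0 setT v ->
  wn (wadd u a v) <= 2 * wn u + 2 * a ^+ 2 * wn v.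
Proof.
move=> Wu Wv; rewrite (wn_ext Wu) (wn_ext Wv) (wn_ext (W0_wadd a Wu Wv)).
exact: (ext_add_le qform_N a Wu Wv).
Qed.

(** Density of test functions: an element is approximated by the constant sequences made of its own
    terms. *)
Lemma W_dense u : W0 setT u -> forall e, 0 < e -> exists K : nat, forall k, (K <= k)%N ->
  wn (wadd u (-1) (wcst (u k))) < e.
Proof.
move=> Wu e e0; have [tu cu] := Wu.
have [K hK] := cu (e / 2) (divr_gt0 e0 (ltr0n _ 2)); exists K => k Kk.
have Wc : W0 setT (wcst (u k)) by apply: W0_cst.
apply: (@le_lt_trans _ _ (e / 2)); last lra.
rewrite (wn_ext (W0_wadd (-1) Wu Wc)).
apply: (@lim_le _ _ _ K (ext_cvg qform_N (W0_wadd (-1) Wu Wc) (W0_wadd (-1) Wu Wc))) => l Kl.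
by rewrite wadd_at /wcst -!subE ltW// hK.
Qed.

Lemma wadd_sub_add u v w : wadd (wadd u (-1) v) 1 (wadd v (-1) w) = wadd u (-1) w.
Proof. by apply/funext => k; apply/funext => x; rewrite !wadd_at; ring. Qed.

Lemma wn_sub_sym u v : W0 setT u -> W0 setT v -> wn (wadd u (-1) v) = wn (wadd v (-1) u).
Proof.
move=> Wu Wv; rewrite (wn_ext (W0_wadd (-1) Wu Wv)) (wn_ext (W0_wadd (-1) Wv Wu)).
rewrite (ext_sq qform_N _ Wu Wv) (ext_sq qform_N _ Wv Wu) (ext_sym qform_N u v).
by move: (ext _ _ _) (ext _ _ _) (ext _ _ _) => x y z; ring.
Qed.

Lemma wn_tri u v w : W0 setT u -> W0 setT v -> W0 setT w ->
  wn (wadd u (-1) w) <= 2 * wn (wadd u (-1) v) + 2 * wn (wadd v (-1) w).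
Proof.
move=> Wu Wv Ww; rewrite -(wadd_sub_add u v w).
have := wn_add_le 1 (W0_wadd (-1) Wu Wv) (W0_wadd (-1) Wv Ww).
by rewrite expr1n mulr1.
Qed.

Lemma inv_small (e : R) : 0 < e -> exists K : nat, forall n, (K <= n)%N -> n.+1%:R^-1 < e.
Proof.
move=> e0; exists (Num.truncn e^-1) => n Kn.
rewrite invf_plt ?posrE//; apply: lt_le_trans (truncnS_gt _) _.
by rewrite ler_nat.
Qed.

(** A diagonal choice: from each [U n] one term close to it is taken, and these test functions form
    the sequence that represents the limit. *)
Lemma W_complete A (U : nat -> Wseq R d) : (forall n, W0 A (U n)) ->
  (forall e, 0 < e -> exists K : nat, forall m n, (K <= m)%N -> (K <= n)%N ->
     wn (wadd (U m) (-1) (U n)) < e) ->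
  exists2 u, W0 A u & forall e, 0 < e -> exists K : nat, forall n, (K <= n)%N ->
     wn (wadd (U n) (-1) u) < e.
Proof.
move=> WU cU.
have WT n : W0 setT (U n) := W0_T (WU n).
have /choice[kk hk] : forall n, exists k, wn (wadd (U n) (-1) (wcst (U n k))) < n.+1%:R^-1.
  move=> n; have n0 : (0 : R) < n.+1%:R^-1 by rewrite invr_gt0.
  by have [K hK] := W_dense (WT n) n0; exists K; apply: hK.
pose u : Wseq R d := fun n => U n (kk n).
have tu n : test_fun A (u n) by case: (WU n) => + _; exact.
have Wc n : W0 setT (wcst (u n)) by apply: W0_cst; exact: test_sub (tu n).
have dist (e : R) : 0 < e -> exists K : nat, forall m n, (K <= m)%N -> (K <= n)%N ->
    wn (wadd (wcst (u m)) (-1) (wcst (u n))) < e.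
  (* Two triangle inequalities give the weights 2, 4 and 4, hence a total of 10 / 16 of e. *)
  move=> e0; have [K1 h1] := cU (e / 16) (divr_gt0 e0 (ltr0n _ 16)).
  have [K2 h2] := inv_small (divr_gt0 e0 (ltr0n _ 16)).
  exists (maxn K1 K2) => m n; rewrite !geq_max => /andP[m1 m2] /andP[n1 n2].
  have t1 := wn_tri (Wc m) (WT m) (Wc n).
  have t2 := wn_tri (WT m) (WT n) (Wc n).
  rewrite (wn_sub_sym (Wc m) (WT m)) in t1.
  have := hk m; have := hk n; rewrite -!/(u _).
  have := h1 _ _ m1 n1; have := h2 _ m2; have := h2 _ n2; move: t1 t2.
  do ?[move: (wn _) => ?]; move: (n.+1%:R^-1 : R) (m.+1%:R^-1 : R) => ? ?; lra.
have Wu : W0 A u.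
  split=> // e e0; have [K hK] := dist e e0; exists K => k l kK lK.
  have := hK k l kK lK; rewrite (wn_ext (W0_wadd (-1) (Wc k) (Wc l))).
  have -> : ext (fun f g => L2ip_f f g + Dform_f f g) (wadd (wcst (u k)) (-1) (wcst (u l)))
      (wadd (wcst (u k)) (-1) (wcst (u l))) = Nf (u k \- u l).
    by rewrite wadd_cst ext_cst subE.
  by [].
exists u => // e e0.
have [K1 h1] := inv_small (divr_gt0 e0 (ltr0n _ 8)).
have [K2 h2] := W_dense (W0_T Wu) (divr_gt0 e0 (ltr0n _ 8)).
exists (maxn K1 K2) => n; rewrite geq_max => /andP[n1 n2].
have t1 := wn_tri (WT n) (Wc n) (W0_T Wu).
rewrite (wn_sub_sym (Wc n) (W0_T Wu)) in t1.
have := hk n; rewrite -/(u n); have := h1 _ n1; have := h2 _ n2; move: t1.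
do ?[move: (wn _) => ?]; move: (n.+1%:R^-1 : R) => ?; lra.
Qed.

Lemma sq_small_0 (x C : R) : (forall e, 0 < e -> x ^+ 2 <= C * e) -> x = 0.
Proof.
move=> H; apply/eqP; rewrite -sqrf_eq0 eq_le sqr_ge0 andbT.
apply/ler_addgt0Pr => e e0; rewrite add0r.
have C0 : 0 < `|C| + 1 by rewrite ltr_wpDl.
apply: le_trans (H (e / (`|C| + 1)) (divr_gt0 e0 C0)) _.
by rewrite mulrCA ger_pMr// ler_pdivrMr// mul1r (le_trans (ler_norm C))// lerDl.
Qed.

(* Integrating by parts, the gradients of a sequence tending to 0 in L^2 are
   asymptotically orthogonal to any fixed gradient. *)
Lemma closable u : W0 setT u -> ip u u = 0 -> energy u = 0.
Proof.
move=> Wu u0; have [tu cu] := Wu.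
have Wc l : W0 setT (wcst (u l)) by apply: W0_cst.
have E0 l : Dform u (wcst (u l)) = 0.
  have Wp (i : 'I_d) : W0 setT (wcst (pderiv i (pderiv i (u l)))).
    by apply: W0_cst; do 2 apply: test_pderiv.
  rewrite DformE; apply: (@cvg_unique _ (@Rhausdorff R) _ _ _ _ (ext_cvg qform_D Wu (Wc l))).
  rewrite (_ : (fun k => _) = (fun k => \sum_(i < d) - L2ip_f (u k) (pderiv i (pderiv i (u l))))).
    have S0 : \sum_(i < d) - ip u (wcst (pderiv i (pderiv i (u l)))) = 0.
      rewrite big1// => i _; suff -> : ip u (wcst (pderiv i (pderiv i (u l)))) = 0 by rewrite oppr0.
      apply: (@sq_small_0 _ 0) => e e0; rewrite mul0r.
      have := ext_CS qform_L2 Wu (Wp i).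
      by rewrite -!ipE u0 mul0r.
    suff : (fun k => \sum_(i < d) - L2ip_f (u k) (pderiv i (pderiv i (u l)))) @ \oo -->
      \sum_(i < d) - ip u (wcst (pderiv i (pderiv i (u l)))) by rewrite S0.
    elim: (index_enum _) => [|i r IH].
      by rewrite big_nil; under eq_fun do rewrite big_nil; exact: cvg_cst.
    rewrite big_cons; under eq_fun do rewrite big_cons.
    by apply: cvgD => //; rewrite ipE; apply: cvgN; exact: (ext_cvg qform_L2 Wu (Wp i)).
  apply/funext => k; rewrite /wcst /Dform_f intRd_sum.
    by apply: eq_bigr => i _; rewrite -int_by_parts//; exact: test_pderiv.
  by move=> i; apply: tf_CcM; apply: test_pderiv.
apply: (@sq_small_0 _ (energy u)) => e e0.
have [K hK] := W_dense Wu e0.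
have := hK K (leqnn K); set w := wadd u _ _ => wK.
have Ww : W0 setT w by exact: W0_wadd.
have E1 : energy u = Dform u w.
  by rewrite energyE /w !DformE (ext_linr qform_D (-1) Wu (Wc K) Wu) -!DformE E0 mulr0 addr0.
have := ext_CS qform_D Wu Ww; rewrite -!DformE -!energyE -E1 => H.
apply: le_trans H _; rewrite ler_wpM2l//; first exact: energy_ge0.
by apply: le_trans (ltW wK); rewrite wnE lerDr ip_ge0.
Qed.

End Wspace.

(** * Eigenvalues below the threshold *)

Section Spectral.
Variables (R : realType) (d : nat).
Implicit Types (u w : Wseq R d) (A : set 'rV[R]_d).

Lemma ipC u v : ip u v = ip v u.
Proof. by rewrite !ipE (ext_sym (@qform_L2 R d)). Qed.
Lemma DformC u v : Dform u v = Dform v u.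
Proof. by rewrite !DformE (ext_sym (@qform_D R d)). Qed.
Lemma ip_wadd u a v w : W0 setT u -> W0 setT v -> W0 setT w ->
  ip (wadd u a v) w = ip u w + a * ip v w.
Proof. by move=> Wu Wv Ww; rewrite !ipE; exact: (ext_lin (@qform_L2 R d) a Wu Wv Ww). Qed.
Lemma Dform_wadd u a v w : W0 setT u -> W0 setT v -> W0 setT w ->
  Dform (wadd u a v) w = Dform u w + a * Dform v w.
Proof. by move=> Wu Wv Ww; rewrite !DformE; exact: (ext_lin (@qform_D R d) a Wu Wv Ww). Qed.
Lemma ip_sq u a v : W0 setT u -> W0 setT v ->
  ip (wadd u a v) (wadd u a v) = ip u u + 2 * a * ip u v + a ^+ 2 * ip v v.
Proof. by move=> Wu Wv; rewrite !ipE; exact: (ext_sq (@qform_L2 R d) a Wu Wv). Qed.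
Lemma energy_sq u a v : W0 setT u -> W0 setT v ->
  energy (wadd u a v) = energy u + 2 * a * Dform u v + a ^+ 2 * energy v.
Proof. by move=> Wu Wv; rewrite !energyE !DformE; exact: (ext_sq (@qform_D R d) a Wu Wv). Qed.
Lemma ip_CS u v : W0 setT u -> W0 setT v -> ip u v ^+ 2 <= ip u u * ip v v.
Proof. by move=> Wu Wv; rewrite !ipE; exact: (ext_CS (@qform_L2 R d) Wu Wv). Qed.

Definition wsum (I : Type) (r : seq I) (c : I -> R) (v : I -> Wseq R d) : Wseq R d :=
  fun k x => \sum_(m <- r) c m * v m k x.

Lemma wsum_cons (I : Type) m (r : seq I) c v : wsum (m :: r) c v = wadd (wsum r c v) (c m) (v m).
Proof.
by apply/funext => k; apply/funext => x; rewrite wadd_at /wsum big_cons addrC.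
Qed.

Lemma wsum_nil (I : Type) c (v : I -> Wseq R d) : wsum [::] c v = wcst (fun _ => 0).
Proof. by apply/funext => k; apply/funext => x; rewrite /wsum big_nil. Qed.

Lemma W0_wsum A (I : Type) (r : seq I) c v : (forall m, W0 A (v m)) -> W0 A (wsum r c v).
Proof.
move=> Wv; elim: r => [|m r IH]; first by rewrite wsum_nil; apply: W0_cst; exact: test0.
by rewrite wsum_cons; apply: W0_wadd.
Qed.

Lemma ip_wcst0 w : ip (wcst (fun _ => 0)) w = 0.
Proof.
rewrite ipE; apply: (@cvg_lim _ (@Rhausdorff R)); apply/cvg_epsP => e e0; exists 0%N => k _.
rewrite /wcst (_ : L2ip_f _ _ = 0) ?subrr ?normr0// /L2ip_f -[RHS](@intRd_0 R d).
by congr intRd; apply/funext => x; rewrite mul0r.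
Qed.

Lemma ip_wsum (I : Type) (r : seq I) c v w : (forall m, W0 setT (v m)) -> W0 setT w ->
  ip (wsum r c v) w = \sum_(m <- r) c m * ip (v m) w.
Proof.
move=> Wv Ww; elim: r => [|m r IH]; first by rewrite wsum_nil big_nil ip_wcst0.
by rewrite wsum_cons ip_wadd ?IH ?big_cons 1?addrC//; exact: W0_wsum.
Qed.

Lemma Dform_wsum (I : Type) (r : seq I) c v w : (forall m, W0 setT (v m)) -> W0 setT w ->
  Dform (wsum r c v) w = \sum_(m <- r) c m * Dform (v m) w.
Proof.
move=> Wv Ww; elim: r => [|m r IH].
  have W00 : W0 setT (wcst (fun _ : 'rV[R]_d => 0)) by apply: W0_cst; exact: test0.
  have E : wcst (fun _ : 'rV[R]_d => 0) = wadd (wcst (fun _ => 0)) (-1) (wcst (fun _ => 0)) :> Wseq R d.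
    by rewrite wadd_cst; congr wcst; apply/funext => x; rewrite mulr0 addr0.
  by rewrite wsum_nil big_nil E Dform_wadd// mulN1r subrr.
by rewrite wsum_cons Dform_wadd ?IH ?big_cons 1?addrC//; exact: W0_wsum.
Qed.

Lemma lincombE (j : nat) (c : 'I_j -> R) v : lincomb c v = wsum (index_enum 'I_j) c v.
Proof. by []. Qed.

Lemma W0_lincomb A (j : nat) (c : 'I_j -> R) v : (forall m, W0 A (v m)) -> W0 A (lincomb c v).
Proof. by rewrite lincombE; exact: W0_wsum. Qed.

Lemma ip_lincomb (j : nat) (c : 'I_j -> R) v w : (forall m, W0 setT (v m)) -> W0 setT w ->
  ip (lincomb c v) w = \sum_m c m * ip (v m) w.
Proof. by rewrite lincombE; exact: ip_wsum. Qed.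

Lemma Dform_lincomb (j : nat) (c : 'I_j -> R) v w : (forall m, W0 setT (v m)) -> W0 setT w ->
  Dform (lincomb c v) w = \sum_m c m * Dform (v m) w.
Proof. by rewrite lincombE; exact: Dform_wsum. Qed.

Lemma lincomb_scale (j : nat) (a : R) (c : 'I_j -> R) v w : (forall m, W0 setT (v m)) -> W0 setT w ->
  ip (lincomb (fun m => a * c m) v) w = a * ip (lincomb c v) w.
Proof.
by move=> Wv Ww; rewrite !ip_lincomb// mulr_sumr; apply: eq_bigr => m _; rewrite mulrA.
Qed.

(** Dimension count: the j x i matrix of products of the v with the u has a nonzero vector in its
    left kernel, which is then normalized. *)
Lemma ortho_pick A (i j : nat) (v : 'I_j -> Wseq R d) (u : 'I_i -> Wseq R d) : (i < j)%N ->
  (forall m, W0 A (v m)) -> lin_indep v -> (forall m, W0 setT (u m)) ->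
  exists c : 'I_j -> R, ip (lincomb c v) (lincomb c v) = 1 /\
     forall m, ip (lincomb c v) (u m) = 0.
Proof.
move=> ij WAv iv Wu; have Wv m := W0_T (WAv m).
pose G : 'M[R]_(j, i) := \matrix_(m, m') ip (v m) (u m').
have kG : kermx G != 0.
  rewrite kermx_eq0 /row_free; apply/negP => /eqP rG.
  by have := rank_leq_col G; rewrite rG leqNgt ij.
have [c0 c0G cn0] : exists2 c : 'rV[R]_j, c *m G = 0 & c != 0.
  have /rowV0Pn[c /sub_kermxP cG cn] := kG; by exists c.
pose c m := c0 0 m.
have Wc : W0 setT (lincomb c v) by exact: W0_lincomb.
have co m : ip (lincomb c v) (u m) = 0.
  rewrite ip_lincomb//; have /rowP/(_ m) := c0G; rewrite !mxE => c0Gm.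
  by rewrite -[RHS]c0Gm; apply: eq_bigr => k _; rewrite mxE.
(* [lin_indep] is stated in the W^{1,2} norm, so a combination that vanishes only in L^2 must be
   excluded; [closable] does this. *)
have p0 : 0 < ip (lincomb c v) (lincomb c v).
  rewrite lt_def ip_ge0// andbT; apply/negP => /eqP z.
  move/negP: cn0; apply; apply/eqP/rowP => m; rewrite mxE.
  apply: (iv c); by rewrite z (closable Wc z) addr0.
pose s := Num.sqrt (ip (lincomb c v) (lincomb c v)).
have s0 : 0 < s by rewrite sqrtr_gt0.
exists (fun m => s^-1 * c m).
have Wsc : W0 setT (lincomb (fun m => s^-1 * c m) v) by exact: W0_lincomb.
split; last by move=> m; rewrite lincomb_scale// co mulr0.
rewrite lincomb_scale// ipC lincomb_scale// mulrA -invfM -expr2 sqr_sqrtr; last exact: ltW.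
by rewrite mulVf// gt_eqF.
Qed.

Local Open Scope ereal_scope.

Lemma lambda_ge A j (L : R) : (forall v : 'I_j -> Wseq R d, (forall m, W0 A (v m)) -> lin_indep v ->
    exists c, ip (lincomb c v) (lincomb c v) = 1%R /\ (L <= energy (lincomb c v))%R) ->
  L%:E <= lambda A j.
Proof.
move=> H; apply: le_ereal_inf_tmp => x [v [Wv [iv ->]]].
have [c [c1 cL]] := H v Wv iv.
by apply: le_ereal_sup_tmp; exists (energy (lincomb c v))%:E; [exists c|rewrite lee_fin].
Qed.

Lemma lambda_le A j (L : R) (v : 'I_j -> Wseq R d) : (forall m, W0 A (v m)) -> lin_indep v ->
  (forall c, ip (lincomb c v) (lincomb c v) = 1%R -> (energy (lincomb c v) <= L)%R) ->
  lambda A j <= L%:E.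
Proof.
move=> Wv iv H; apply: (@le_trans _ _ (ereal_sup [set y : \bar R | exists c : 'I_j -> R,
          ip (lincomb c v) (lincomb c v) = 1%R /\ y = (energy (lincomb c v))%:E])).
  by apply: ereal_inf_lbound; exists v.
by apply: ge_ereal_sup => y [c [c1 ->]]; rewrite lee_fin; exact: H.
Qed.

Lemma lambda_lt A j (L : \bar R) : lambda A j < L ->
  exists v : 'I_j -> Wseq R d, [/\ forall m, W0 A (v m), lin_indep v &
   exists2 S : \bar R, S < L & forall c, ip (lincomb c v) (lincomb c v) = 1%R ->
     (energy (lincomb c v))%:E <= S].
Proof.
move=> /ereal_inf_lt [x [v [Wv [iv ->]]] xL]; exists v; split=> //.
eexists; first exact: xL.
by move=> c c1; apply: ereal_sup_ubound; exists c.
Qed.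

Lemma lambda_mono A j : lambda A j <= lambda A j.+1.
Proof.
apply: le_ereal_inf_tmp => x [v [Wv [iv ->]]].
pose v' (m : 'I_j) := v (widen_ord (leqnSn j) m).
pose ex (c : 'I_j -> R) (m : 'I_j.+1) : R := if insub (m : nat) is Some k then c k else 0%R.
have exw c k : ex c (widen_ord (leqnSn j) k) = c k by rewrite /ex /= valK.
have E c : lincomb c v' = lincomb (ex c) v.
  apply/funext => k; apply/funext => x0; rewrite /lincomb big_ord_recr /=.
  rewrite [ex c ord_max]/ex insubF ?ltnn// mul0r addr0.
  by apply: eq_bigr => m _; rewrite exw.
apply: (@le_trans _ _ (ereal_sup [set y : \bar R | exists c : 'I_j -> R,
          ip (lincomb c v') (lincomb c v') = 1%R /\ y = (energy (lincomb c v'))%:E])).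
  apply: ereal_inf_lbound; exists v'; split; first by move=> m; exact: Wv.
  split=> // c; rewrite E => /iv H m; rewrite -exw; exact: H.
apply: ge_ereal_sup => y [c [c1 ->]]; apply: ereal_sup_ubound; exists (ex c).
by rewrite -E.
Qed.

Lemma lambda_homo A i j : (i <= j)%N -> lambda A i <= lambda A j.
Proof.
move=> /subnK <-; elim: (j - i)%N => [|n IH]; first by rewrite add0n.
by apply: le_trans IH _; rewrite addSn; exact: lambda_mono.
Qed.

Lemma lambda_sub A B j : A `<=` B -> lambda B j <= lambda A j.
Proof.
move=> AB; apply: ereal_inf_le_tmp => x [v [Wv [iv E]]]; exists v; split=> // m.
exact: W0_sub AB (Wv m).
Qed.

(** A space of positive dimension contains a normalized vector, found by [ortho_pick] with no
    constraint. For j = 0 the supremum is over the empty set and the value is -oo. *)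
Lemma lambda_ge0 A j : (0 < j)%N -> 0 <= lambda A j.
Proof.
move=> j0; apply: lambda_ge => v Wv iv.
have [c [c1 _]] := @ortho_pick A 0 j v (fun _ => wcst (fun _ => 0%R)) j0 Wv iv
  (fun m => W0_cst (@test0 R d setT)).
by exists c; split=> //; apply: energy_ge0; apply: W0_T (W0_lincomb _ Wv).
Qed.

End Spectral.

(** * Extraction of subsequences *)

Section Compactness.
Variables (R : realType).

Definition increasing_nat (s : nat -> nat) := forall q, (s q < s q.+1)%N.

Lemma incr_ge s : increasing_nat s -> forall q, (q <= s q)%N.
Proof. by move=> si; elim=> // q IH; exact: leq_ltn_trans IH (si q). Qed.

Lemma incr_homo s : increasing_nat s -> forall p q, (p <= q)%N -> (s p <= s q)%N.
Proof.
move=> si p q /subnK <-; elim: (q - p)%N => // n IH.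
by rewrite addSn; exact: leq_trans IH (ltnW (si _)).
Qed.

Lemma nbhs_norm_lt (V : normedModType R) (p : V) (r : R) : 0 < r -> nbhs p [set z | `|p - z| < r].
Proof. by move=> r0; apply/nbhs_normP; exists r. Qed.

(** The family is packed into one row vector, so that compactness of a closed ball yields one
    subsequence for all indices. *)
Lemma bolzano_weierstrass_fin (I : finType) (x : nat -> I -> R) (C : R) :
  (forall n i, `|x n i| <= C) ->
  exists s, increasing_nat s /\ forall i, cvgn (fun q => x (s q) i).
Proof.
move=> xC.
pose y n : 'rV[R]_#|I| := \row_k x n (enum_val k).
have C0 : 0 <= `|C| by [].
have yC n : `|y n| <= `|C|.
  apply: normrV_le => // k; rewrite mxE; exact: le_trans (xC _ _) (ler_norm _).
have [p [_ clp]] : [set z : 'rV[R]_#|I| | `|z| <= `|C|] `&` cluster (y @ \oo) !=set0.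
  by apply: (@ball_compact R #|I| `|C|); exists 0%N => // n _; exact: yC.
have next (N k : nat) : exists n, (N < n)%N /\ `|p - y n| < k.+1%:R^-1.
  have Fy : (y @ \oo) (y @` [set n | (N < n)%N]) by exists N.+1 => // n /= Nn; exists n.
  have Bp : nbhs p [set z | `|p - z| < k.+1%:R^-1].
    by apply: nbhs_norm_lt; rewrite invr_gt0.
  by have [_ [[n Nn <-] pn]] := clp _ _ Fy Bp; exists n.
have /choice[nx hnx] : forall Nk : nat * nat, exists n, (Nk.1 < n)%N /\ `|p - y n| < Nk.2.+1%:R^-1.
  by move=> [N k]; exact: next.
pose fix s (q : nat) : nat := if q is q'.+1 then nx (s q', q) else nx (0%N, 0%N).
exists s; split; first by move=> q; have [+ _] := hnx (s q, q.+1).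
have sp q : `|p - y (s q)| < q.+1%:R^-1.
  by case: q => [|q]; [have [] := hnx (0%N, 0%N)|have [] := hnx (s q, q.+1)].
move=> i; apply/cvg_ex; exists (p 0 (enum_rank i)); apply/cvg_epsP => e e0.
have [K hK] := inv_small e0; exists K => q Kq.
apply: le_lt_trans (lt_trans (sp q) (hK q Kq)).
by have := coord_le_norm (p - y (s q)) (enum_rank i); rewrite !mxE enum_rankK.
Qed.

End Compactness.

Section Convergence.
Variables (R : realType) (d : nat).
Implicit Types (u v w : Wseq R d).

Definition wcvg (U : nat -> Wseq R d) u := forall e, 0 < e -> exists K : nat, forall n, (K <= n)%N ->
  wn (wadd (U n) (-1) u) < e.

Lemma ext_conv (q : ('rV[R]_d -> R) -> ('rV[R]_d -> R) -> R) U V u v : qform q ->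
  (forall n, W0 setT (U n)) -> (forall n, W0 setT (V n)) -> W0 setT u -> W0 setT v ->
  wcvg U u -> wcvg V v -> (fun n => ext q (U n) (V n)) @ \oo --> ext q u v.
Proof.
move=> Q WU WV Wu Wv Uu Vv.
have qwn w : W0 setT w -> ext q w w <= wn w.
  move=> Ww; rewrite (wn_ext Ww) -subr_ge0.
  have cw := cvgB (ext_cvg (@qform_N R d) Ww Ww) (ext_cvg Q Ww Ww).
  by apply: (@lim_ge _ _ _ _ 0 (cw _)) => k _; rewrite /= subr_ge0; exact: qleN.
apply/cvg_epsP => e e0.
have v0 := wn_ge0 Wv; have u0 := wn_ge0 Wu.
have e2 : 0 < e / 2 by rewrite divr_gt0.
have ee : 0 < (e / 2) ^+ 2 by rewrite exprn_gt0.
have D1 : 0 < 2 + 2 * wn v by apply: ltr_wpDr; [exact: (mulr_ge0 (ler0n _ 2) v0)|exact: ltr0n].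
have D2 : 0 < wn u + 1 by rewrite ltr_wpDl.
have [K1 h1] := Uu _ (divr_gt0 ee D1).
have [K2 h2] := Vv _ (divr_gt0 ee D2).
have [K3 h3] := Vv _ ltr01.
exists (maxn K1 (maxn K2 K3)) => n; rewrite !geq_max => /and3P[n1 n2 n3].
have WUu := W0_wadd (-1) (WU n) Wu; have WVv := W0_wadd (-1) (WV n) Wv.
have E : ext q u v - ext q (U n) (V n) =
  - (ext q (wadd (U n) (-1) u) (V n) + ext q u (wadd (V n) (-1) v)).
  rewrite (ext_lin Q (-1) (WU n) Wu (WV n)) (ext_linr Q (-1) (WV n) Wv Wu).
  move: (ext q u v) (ext q u (V n)) (ext q (U n) (V n)) => a b c; ring.
have wV : wn (V n) <= 2 + 2 * wn v.
  have Wc : W0 setT (wadd (wadd (V n) (-1) v) 1 v) by apply: W0_wadd.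
  have -> : V n = wadd (wadd (V n) (-1) v) 1 v.
    by apply/funext => k; apply/funext => x; rewrite !wadd_at; ring.
  apply: le_trans (wn_add_le 1 WVv Wv) _; rewrite expr1n mulr1 lerD2r.
  by rewrite -[leRHS]mulr1 ler_pM2l//; exact: ltW (h3 n n3).
have b1 : `|ext q (wadd (U n) (-1) u) (V n)| < e / 2.
  rewrite -(@ltr_pXn2r _ 2)// ?nnegrE ?(ltW e2)//.
  rewrite real_normK ?num_real//; apply: le_lt_trans (ext_CS Q WUu (WV n)) _.
  have := h1 n n1; rewrite ltr_pdivlMr//; apply: le_lt_trans.
  apply: ler_pM; [exact: ext_ge0|exact: ext_ge0|exact: qwn|].
  exact: le_trans (qwn _ (WV n)) wV.
have b2 : `|ext q u (wadd (V n) (-1) v)| < e / 2.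
  rewrite -(@ltr_pXn2r _ 2)// ?nnegrE ?(ltW e2)//.
  rewrite real_normK ?num_real//; apply: le_lt_trans (ext_CS Q Wu WVv) _.
  have := h2 n n2; rewrite ltr_pdivlMr// mulrC; apply: le_lt_trans.
  apply: ler_pM; [exact: ext_ge0|exact: ext_ge0| |exact: qwn].
  by apply: le_trans (qwn _ Wu) _; rewrite lerDl.
rewrite E normrN; apply: le_lt_trans (ler_normD _ _) _.
by rewrite [ltRHS]splitr; exact: ltrD.
Qed.

Lemma ip_conv U V u v : (forall n, W0 setT (U n)) -> (forall n, W0 setT (V n)) -> W0 setT u ->
  W0 setT v -> wcvg U u -> wcvg V v -> (fun n => ip (U n) (V n)) @ \oo --> ip u v.
Proof.
move=> *; rewrite ipE; under eq_fun do rewrite ipE; exact: (ext_conv (@qform_L2 R d)).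
Qed.

Lemma Dform_conv U V u v : (forall n, W0 setT (U n)) -> (forall n, W0 setT (V n)) -> W0 setT u ->
  W0 setT v -> wcvg U u -> wcvg V v -> (fun n => Dform (U n) (V n)) @ \oo --> Dform u v.
Proof.
move=> *; rewrite DformE; under eq_fun do rewrite DformE; exact: (ext_conv (@qform_D R d)).
Qed.

Lemma wcvg_cst u : W0 setT u -> wcvg (fun _ => u) u.
Proof.
move=> Wu e e0; exists 0%N => n _.
rewrite wnE ip_sq// energy_sq// energyE.
suff -> : ip u u + 2 * -1 * ip u u + (-1) ^+ 2 * ip u u +
  (Dform u u + 2 * -1 * Dform u u + (-1) ^+ 2 * Dform u u) = 0 by [].
move: (ip u u) (Dform u u) => a b; ring.
Qed.

Lemma wcvg_dense u : W0 setT u -> wcvg (fun k => wcst (u k)) u.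
Proof.
move=> Wu e e0; have [K hK] := W_dense Wu e0; exists K => n Kn.
by rewrite wn_sub_sym//; [exact: hK|apply: W0_cst; exact: tW Wu].
Qed.

Lemma W_completeP A (U : nat -> Wseq R d) : (forall n, W0 A (U n)) ->
  (forall e, 0 < e -> exists K : nat, forall m n, (K <= m)%N -> (m <= n)%N ->
     wn (wadd (U m) (-1) (U n)) < e) ->
  exists2 u, W0 A u & wcvg U u.
Proof.
move=> WU H; have WT n := W0_T (WU n); apply: W_complete => // e e0.
have [K hK] := H e e0; exists K => m n mK nK; have [mn|nm] := leqP m n; first exact: hK.
by rewrite wn_sub_sym//; apply: hK => //; exact: ltnW.
Qed.

(* Form of the compactness of W_0^{1,2} in L^2 below the level [mu]. *)
Definition coercive A (mu : R) := exists (I : finType) (a : I -> 'rV[R]_d -> R),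
  (forall i, test_fun setT (a i)) /\
  forall u, W0 A u -> mu * ip u u <= energy u + \sum_i ip u (wcst (a i)) ^+ 2.

Lemma test_W0_bound A mu (I : finType) (a : I -> 'rV[R]_d -> R) :
  (forall i, test_fun setT (a i)) ->
  (forall f, test_fun A f -> mu * L2ip_f f f <= Dform_f f f + \sum_i L2ip_f f (a i) ^+ 2) ->
  forall u, W0 A u -> mu * ip u u <= energy u + \sum_i ip u (wcst (a i)) ^+ 2.
Proof.
move=> ta H u Wu; have WT := W0_T Wu.
have Wa i : W0 setT (wcst (a i)) by apply: W0_cst.
have c1 : (fun k => Dform_f (u k) (u k) + \sum_i L2ip_f (u k) (a i) ^+ 2 - mu * L2ip_f (u k) (u k)) @ \oo -->
   energy u + \sum_i ip u (wcst (a i)) ^+ 2 - mu * ip u u.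
  apply: cvgB; last by apply: cvgM; [exact: cvg_cst|rewrite ipE; exact: (ext_cvg (@qform_L2 R d))].
  apply: cvgD; first by rewrite energyE DformE; exact: (ext_cvg (@qform_D R d)).
  elim: (index_enum _) => [|i r IH].
    by rewrite big_nil; under eq_fun do rewrite big_nil; exact: cvg_cst.
  rewrite big_cons; under eq_fun do rewrite big_cons.
  apply: cvgD => //; under eq_fun do rewrite expr2; rewrite expr2 ipE.
  by apply: cvgM; exact: (ext_cvg (@qform_L2 R d) WT (Wa i)).
rewrite -subr_ge0; apply: (@lim_ge _ _ _ _ 0 c1) => k _; rewrite subr_ge0; apply: H.
by case: Wu.
Qed.

Lemma coercive_test A mu (I : finType) (a : I -> 'rV[R]_d -> R) :
  (forall i, test_fun setT (a i)) ->
  (forall f, test_fun A f -> mu * L2ip_f f f <= Dform_f f f + \sum_i L2ip_f f (a i) ^+ 2) ->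
  coercive A mu.
Proof. by move=> ta H; exists I, a; split=> //; exact: test_W0_bound. Qed.

End Convergence.

(** * Existence of eigenfunctions by constrained minimization *)

Section Existence.
Variables (R : realType) (d : nat).
Implicit Types (w phi : Wseq R d) (A : set 'rV[R]_d).

(** Indices start at 0, so [u m] belongs to [lambda A m.+1]. The last clause is the minimality on
    the orthogonal complement of the earlier functions, in homogeneous form to avoid
    normalization. *)
Definition Eig A (j : nat) (u : nat -> Wseq R d) (l : nat -> R) := forall m, (m < j)%N ->
  [/\ W0 A (u m),
      forall m', (m' < j)%N -> ip (u m) (u m') = (m == m')%:R,
      forall phi, W0 A phi -> Dform (u m) phi = l m * ip (u m) phi,
      lambda A m.+1 = (l m)%:E &
      forall w, W0 A w -> (forall m', (m' < m)%N -> ip w (u m') = 0) -> l m * ip w w <= energy w].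

Definition perp A (j : nat) (u : nat -> Wseq R d) w := W0 A w /\ forall m, (m < j)%N -> ip w (u m) = 0.

Lemma perp_wadd A j u w a w' : (forall m, (m < j)%N -> W0 setT (u m)) -> perp A j u w -> perp A j u w' ->
  perp A j u (wadd w a w').
Proof.
move=> Wu [Ww w0] [Ww' w0']; split; first exact: W0_wadd.
move=> m mj; have [WT WT'] := (W0_T Ww, W0_T Ww').
by rewrite (ip_wadd a WT WT' (Wu m mj)) w0// w0'// mulr0 addr0.
Qed.

Lemma lin_indep_orth (j : nat) (v : 'I_j -> Wseq R d) : (forall m, W0 setT (v m)) ->
  orthonormal_fam v -> lin_indep v.
Proof.
move=> Wv ov c; set w := lincomb c v.
have Ww : W0 setT w by exact: W0_lincomb.
have E m : ip w (v m) = c m.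
  rewrite ip_lincomb// (bigD1 m)//= ov eqxx mulr1 big1 ?addr0// => k km.
  by rewrite ov (negbTE km) mulr0.
move=> /eqP; rewrite paddr_eq0 ?ip_ge0 ?energy_ge0// => /andP[/eqP w0 _] m.
have := ip_CS Ww (Wv m); rewrite w0 mul0r E => cm.
by apply/eqP; rewrite -sqrf_eq0 eq_le cm sqr_ge0.
Qed.

Lemma lincomb_orth (j : nat) (v : 'I_j -> Wseq R d) (l c : 'I_j -> R) : (forall m, W0 setT (v m)) ->
  orthonormal_fam v -> (forall m m', Dform (v m) (v m') = l m * (m == m')%:R) ->
  ip (lincomb c v) (lincomb c v) = \sum_m c m ^+ 2 /\ energy (lincomb c v) = \sum_m l m * c m ^+ 2.
Proof.
move=> Wv ov Dv; have Ww : W0 setT (lincomb c v) by exact: W0_lincomb.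
split.
  rewrite ip_lincomb//; apply: eq_bigr => m _; rewrite ipC ip_lincomb// (bigD1 m)//= ov eqxx mulr1.
  by rewrite big1 ?addr0 ?expr2// => k km; rewrite ov (negbTE km) mulr0.
rewrite energyE Dform_lincomb//; apply: eq_bigr => m _; rewrite DformC Dform_lincomb// (bigD1 m)//= Dv eqxx mulr1.
rewrite big1 ?addr0; first by rewrite mulrA expr2 -mulrA [RHS]mulrC -mulrA.
by move=> k km; rewrite Dv (negbTE km) !mulr0.
Qed.

Lemma cauchy_sum_sq (I : finType) (x : nat -> I -> R) : (forall i, cvgn (x ^~ i)) ->
  forall e, 0 < e -> exists K : nat, forall m n, (K <= m)%N -> (K <= n)%N ->
    \sum_i (x m i - x n i) ^+ 2 <= e.
Proof.
move=> cx; elim: (index_enum _) => [|i r IH] e e0.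
  by exists 0%N => m n _ _; rewrite big_nil ltW.
have e2 : 0 < e / 2 by rewrite divr_gt0.
have [K1 h1] := IH _ e2.
pose e3 := Num.min 1 (e / 8).
have e30 : 0 < e3 by rewrite lt_min ltr01 divr_gt0.
have /cvg_epsP/(_ _ e30)[K2 h2] := cx i.
exists (maxn K1 K2) => m n; rewrite !geq_max => /andP[m1 m2] /andP[n1 n2].
rewrite big_cons [leRHS]splitr; apply: lerD; last exact: h1.
have := h2 m m2; have := h2 n n2; move: (limn _) (x m i) (x n i) => l a b hn hm.
have xy : `|a - b| <= 2 * e3.
  have -> : a - b = (l - b) - (l - a) by ring.
  apply: le_trans (ler_normB _ _) _; rewrite mulrDl !mul1r.
  by apply: lerD; exact: ltW.
rewrite -(real_normK (num_real (a - b))).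
apply: (@le_trans _ _ ((2 * e3) ^+ 2)); first by rewrite ler_pXn2r ?nnegrE// mulr_ge0 ?(ltW e30).
have a1 : e3 <= 1 by rewrite ge_min lexx.
have a2 : e3 <= e / 8 by rewrite ge_min lexx orbT.
clear -e30 a1 a2; move: e3 e30 a1 a2 => z; nra.
Qed.

(** Common to the two Cauchy arguments below. [dl] and [D] stand for the squared L^2 norm and the
    energy of a difference; an upper bound for D at level L and the coercive lower bound at level mu
    > L squeeze [dl]. *)
Lemma wn_small (mu L dl D S : R) e : 0 <= L -> L < mu -> 0 <= dl -> D <= S + L * dl ->
  mu * dl <= D + S -> 2 * S <= (mu - L) * e -> dl <= e /\ D <= S + L * e.
Proof.
move=> L0 Lmu dl0 h1 h2 h3.
have m0 : 0 < mu - L by rewrite subr_gt0.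
have dle : dl <= e.
  rewrite -(ler_pM2l m0); apply: le_trans h3; lra.
by split=> //; apply: le_trans h1 _; rewrite lerD2l ler_wpM2l.
Qed.

Lemma minimizer A j u mu : coercive A mu -> (forall m, (m < j)%N -> W0 setT (u m)) ->
  (exists2 w, perp A j u w & ip w w = 1 /\ energy w < mu) ->
  exists2 w, perp A j u w & [/\ ip w w = 1, energy w < mu &
    forall w', perp A j u w' -> energy w * ip w' w' <= energy w'].
Proof.
move=> [I [a [ta Pa]]] Wu [w0 pw0 [nw0 ew0]].
pose E : set R := [set x | exists2 w, perp A j u w & ip w w = 1 /\ x = energy w].
have E0 : E !=set0 by exists (energy w0), w0.
have lbE : lbound E 0 by move=> x [w [Ww _] [_ ->]]; apply: energy_ge0; exact: W0_T Ww.
have hE : has_inf E by split=> //; exists 0.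
pose L := inf E.
have L0 : 0 <= L by apply: lb_le_inf.
have Lle w : perp A j u w -> ip w w = 1 -> L <= energy w.
  by move=> pw nw; apply: ge_inf; [exists 0|exists w].
have Lmu : L < mu by apply: le_lt_trans (Lle _ pw0 nw0) ew0.
(* The homogeneous form of [Lle], needed for sums that are not normalized. Scaling by s is written
   as adding s times w to the zero element. *)
have Lq w : perp A j u w -> L * ip w w <= energy w.
  move=> pw; have WT := W0_T pw.1.
  have [z|nz] := eqVneq (ip w w) 0; first by rewrite z mulr0 energy_ge0.
  have p : 0 < ip w w by rewrite lt_def nz ip_ge0.
  have W00 : perp A j u (wcst (fun _ => 0)).
    by split; [apply: W0_cst; exact: test0|move=> m _; exact: ip_wcst0].
  pose s := (Num.sqrt (ip w w))^-1.
  have ps := perp_wadd s Wu W00 pw.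
  have WT0 := W0_T W00.1.
  have ss : s ^+ 2 * ip w w = 1.
    by rewrite /s exprVn sqr_sqrtr ?ip_ge0// mulVf.
  have z1 w' : ip (wcst (fun _ => 0)) w' = 0 by exact: ip_wcst0.
  have n1 : ip (wadd (wcst (fun _ => 0)) s w) (wadd (wcst (fun _ => 0)) s w) = 1.
    by rewrite (ip_sq s WT0 WT) !z1 mulr0 !add0r.
  have e0 : energy (wcst (fun _ : 'rV[R]_d => 0)) = 0 by apply: closable.
  have D0 : Dform (wcst (fun _ => 0)) w = 0.
    have := ext_CS (@qform_D R d) WT0 WT; rewrite -!DformE -!energyE e0 mul0r => h.
    by apply/eqP; rewrite -sqrf_eq0 eq_le h sqr_ge0.
  have := Lle _ ps n1; rewrite (energy_sq s WT0 WT) e0 D0 mulr0 !add0r => h.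
  by rewrite -(ler_pM2l (_ : 0 < s ^+ 2)) ?exprn_gt0 ?invr_gt0 ?sqrtr_gt0// mulrCA ss mulr1.
have ex n : exists w, [/\ perp A j u w, ip w w = 1 & energy w < L + n.+1%:R^-1].
  have n0 : (0 : R) < n.+1%:R^-1 by rewrite invr_gt0.
  by have [x [w pw [nw ->]] xL] := inf_adherent n0 hE; exists w.
have /choice[W hW] := ex.
have WA n : W0 A (W n) by have [[]] := hW n.
have WT n := W0_T (WA n).
have Wa i : W0 setT (wcst (a i)) by apply: W0_cst.
pose C := \sum_i (ip (wcst (a i)) (wcst (a i)) + 1).
have bnd n i : `|ip (W n) (wcst (a i))| <= C.
  have h1 : ip (W n) (wcst (a i)) ^+ 2 <= ip (wcst (a i)) (wcst (a i)).
    by have := ip_CS (WT n) (Wa i); have [_ -> _] := hW n; rewrite mul1r.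
  have g0 i' : 0 <= ip (wcst (a i')) (wcst (a i')) + 1 by rewrite addr_ge0 ?ip_ge0.
  apply: (@le_trans _ _ (ip (wcst (a i)) (wcst (a i)) + 1)).
    rewrite -(@ler_pXn2r _ 2)// ?nnegrE// real_normK ?num_real//.
    apply: le_trans h1 _; rewrite sqrrD1.
    have := ip_ge0 (Wa i); move: (ip _ _) => x x0; have := sqr_ge0 x; lra.
  by rewrite /C (bigD1 i)//= lerDl; apply: sumr_ge0.
have [s [si scv]] := bolzano_weierstrass_fin bnd.
pose V n := W (s n).
pose S m n := \sum_i (ip (V m) (wcst (a i)) - ip (V n) (wcst (a i))) ^+ 2.
have Ssmall (e : R) : 0 < e -> exists K : nat, forall m n, (K <= m)%N -> (K <= n)%N -> S m n <= e.
  exact: (cauchy_sum_sq scv).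
have small1 (e : R) : 0 < e -> exists K : nat, forall m, (K <= m)%N -> energy (V m) <= L + e.
  move=> e0; have [K hK] := inv_small e0; exists K => m Km.
  have [_ _ h] := hW (s m); apply: le_trans (ltW h) _; rewrite lerD2l ltW//.
  by apply: hK; apply: leq_trans Km (incr_ge si m).
(* Parallelogram law: minimality bounds the energy of [V m] + [V n] from below by L (4 - |V m - V
   n|^2), so the energy of the difference is at most 4 z + L |V m - V n|^2, while coercivity bounds
   it from below. *)
have key m n z : 0 <= z -> energy (V m) <= L + z -> energy (V n) <= L + z -> S m n <= z -> forall e,
    8 * z <= (mu - L) * e ->
    ip (wadd (V m) (-1) (V n)) (wadd (V m) (-1) (V n)) <= e /\
    energy (wadd (V m) (-1) (V n)) <= 4 * z + L * e.
  move=> zz em en smn e ze.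
  have [pm nm _] := hW (s m); have [pn nn _] := hW (s n).
  rewrite -/(V m) -/(V n) in pm nm pn nn.
  have [Wm Wn] : W0 setT (V m) /\ W0 setT (V n) by split; exact: WT.
  have ppl := perp_wadd 1 Wu pm pn.
  have pmi := perp_wadd (-1) Wu pm pn.
  have q1 := Lq _ ppl.
  have q2 := Pa _ pmi.1.
  have ES : \sum_i ip (wadd (V m) (-1) (V n)) (wcst (a i)) ^+ 2 = S m n.
    by apply: eq_bigr => i _; rewrite (ip_wadd (-1) Wm Wn (Wa i)) mulN1r.
  rewrite ES in q2; rewrite (ip_sq 1 Wm Wn) (energy_sq 1 Wm Wn) nm nn in q1.
  have dl0 := ip_ge0 (W0_T pmi.1).
  move: q2 dl0; rewrite (ip_sq (-1) Wm Wn) (energy_sq (-1) Wm Wn) nm nn.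
  clear -zz em en smn q1 ze L0 Lmu; move: em en smn q1; move: (energy (V m)) (energy (V n)) (Dform _ _) (ip _ _) (S m n) => em en D x Sm.
  move=> h1 h2 h3 q1 q2 dl0.
  apply: (@wn_small mu L _ _ (4 * z)) => //; lra.
have [w Ww Vw] : exists2 w, W0 A w & wcvg V w.
  apply: W_completeP => [n|e e0]; first exact: WA.
  have L1 : 0 < 2 * (L + 1) by rewrite mulr_gt0// ltr_wpDl.
  pose e1 := e / (4 * (L + 1)).
  have e10 : 0 < e1 by rewrite divr_gt0// mulr_gt0// ltr_wpDl.
  (* With (1 + L) e1 = e / 4 and 4 z <= e / 4 the squared norm of the difference stays below e; the
     second entry is the hypothesis of [key]. *)
  pose z := Num.min (e / 16) ((mu - L) * e1 / 8).
  have z0 : 0 < z by rewrite lt_min !divr_gt0// mulr_gt0// subr_gt0.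
  have [K1 h1] := Ssmall z z0; have [K2 h2] := small1 z z0.
  exists (maxn K1 K2) => m n; rewrite geq_max => /andP[m1 m2] mn.
  have [n1 n2] := (leq_trans m1 mn, leq_trans m2 mn).
  have z1 : 8 * z <= (mu - L) * e1.
    by rewrite mulrC -ler_pdivlMr// ge_min lexx orbT.
  have [k1 k2] := key m n z (ltW z0) (h2 _ m2) (h2 _ n2) (h1 _ _ m1 n1) e1 z1.
  rewrite wnE; apply: (@le_lt_trans _ _ (e1 + (4 * z + L * e1))); first exact: lerD.
  have z2 : z <= e / 16 by rewrite ge_min lexx.
  have -> : e1 + (4 * z + L * e1) = 4 * z + e / 4.
    rewrite /e1; field; rewrite gt_eqF// ltr_wpDl//.
  clear -z2 e0; lra.
have WwT := W0_T Ww.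
have VT n : W0 setT (V n) := WT (s n).
have nw : ip w w = 1.
  have c := ip_conv VT VT WwT WwT Vw Vw.
  apply: (cvg_unique (@Rhausdorff R) c).
  apply/cvg_epsP => e e0; exists 0%N => k _.
  by have [_ nk _] := hW (s k); rewrite nk subrr normr0.
have pw : perp A j u w.
  split=> // m mj; have c := ip_conv VT (fun _ => Wu m mj) WwT (Wu m mj) Vw (wcvg_cst (Wu m mj)).
  apply: (cvg_unique (@Rhausdorff R) c).
  apply/cvg_epsP => e e0; exists 0%N => k _.
  by have [[_ pk] _ _] := hW (s k); rewrite pk// subrr normr0.
have ew : energy w <= L.
  apply/ler_addgt0Pr => e e0; have [K hK] := small1 e e0.
  have c := Dform_conv VT VT WwT WwT Vw Vw.
  have hK' n : (K <= n)%N -> Dform (V n) (V n) <= L + e by rewrite -energyE; exact: hK.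
  by rewrite energyE; exact: (lim_le c hK').
have ewL : energy w = L by apply/eqP; rewrite eq_le ew Lle.
by exists w => //; rewrite ewL; split.
Qed.

Lemma ortho_pick_perp A j u (v : 'I_j.+1 -> Wseq R d) : (forall m, (m < j)%N -> W0 setT (u m)) ->
  (forall m, W0 A (v m)) -> lin_indep v ->
  exists c, ip (lincomb c v) (lincomb c v) = 1 /\ perp A j u (lincomb c v).
Proof.
move=> Wu Wv iv.
have [c [c1 c0]] := @ortho_pick R d A j j.+1 v (fun m : 'I_j => u m) (ltnSn j) Wv iv
  (fun m => Wu m (ltn_ord m)).
exists c; split=> //; split; first exact: W0_lincomb.
by move=> m mj; exact: (c0 (Ordinal mj)).
Qed.

Lemma Eig_exists A j mu : coercive A mu -> (lambda A j < mu%:E)%E ->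
  exists u l, Eig A j u l.
Proof.
move=> cA; elim: j => [|j IH] lj.
  by exists (fun _ => wcst (fun _ => 0)), (fun _ => 0).
have [u [l Hul]] := IH (le_lt_trans (lambda_mono A j) lj).
have Wu m : (m < j)%N -> W0 setT (u m) by move=> mj; have [Wm _ _ _ _] := Hul m mj; exact: W0_T Wm.
have [v [Wv iv [S Smu Sv]]] := lambda_lt lj.
(* A trial space of dimension j + 1 with energies below mu meets the orthogonal complement of the j
   functions found so far, so the constrained infimum is below mu. *)
have [c0 [c01 pc0]] := ortho_pick_perp Wu Wv iv.
have ec0 : energy (lincomb c0 v) < mu by rewrite -lte_fin; exact: le_lt_trans (Sv c0 c01) Smu.
have [w [Ww pw] [nw ew minw]] : exists2 w, perp A j u w & [/\ ip w w = 1, energy w < mu &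
    forall w', perp A j u w' -> energy w * ip w' w' <= energy w'].
  by apply: minimizer => //; exists (lincomb c0 v).
have WwT := W0_T Ww.
set L := energy w in ew minw *.
(* First variation through the discriminant: the quadratic polynomial in t given by [w] + t [phi] is
   nonnegative and has constant term 0, so its linear coefficient vanishes. *)
have ELp phi : perp A j u phi -> Dform w phi = L * ip w phi.
  move=> pphi; have Wp := W0_T pphi.1.
  apply/eqP; rewrite -subr_eq0 -sqrf_eq0 eq_le sqr_ge0 andbT.
  have := @quad_disc R 0 (Dform w phi - L * ip w phi) (energy phi - L * ip phi phi).
  rewrite mul0r; apply; first by rewrite subr_ge0; exact: minw.
  move=> t; have := minw _ (perp_wadd t Wu (conj Ww pw) pphi).
  rewrite (ip_sq t WwT Wp) (energy_sq t WwT Wp) nw -/L -subr_ge0.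
  move: (Dform w phi) (ip w phi) (energy phi) (ip phi phi) => a b a' b' h.
  by apply: le_trans h _; rewrite le_eqVlt; apply/orP; left; apply/eqP; ring.
(* The projection [s] of [phi] on the earlier eigenfunctions is subtracted; it contributes to
   neither form, since those functions satisfy their own equations and are orthogonal to w. *)
have EL phi : W0 A phi -> Dform w phi = L * ip w phi.
  move=> Wp; have WpT := W0_T Wp.
  pose s := lincomb (fun m : 'I_j => ip phi (u m)) (fun m : 'I_j => u m).
  have Wuo (m : 'I_j) : W0 setT (u m) by exact: Wu.
  have WsA : W0 A s by apply: W0_lincomb => m; have [] := Hul m (ltn_ord m).
  have Ws := W0_T WsA.
  have pp : perp A j u (wadd phi (-1) s).
    split; first exact: W0_wadd.
    move=> m mj; rewrite (ip_wadd (-1) WpT Ws (Wu m mj)) /s ip_lincomb//; last exact: Wu.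
    rewrite (bigD1 (Ordinal mj))//= big1 => [|k km].
      by have [_ /(_ m mj) -> _ _ _] := Hul m mj; rewrite eqxx mulr1 addr0 mulN1r subrr.
    have [_ /(_ m mj) -> _ _ _] := Hul k (ltn_ord k).
    by rewrite (_ : (k == m :> nat) = false) ?mulr0//; apply/negbTE.
  have ips : ip w s = 0.
    by rewrite ipC /s ip_lincomb// big1// => m _; rewrite (ipC (u m)) pw ?mulr0.
  have Ds : Dform w s = 0.
    rewrite DformC /s Dform_lincomb// big1// => m _.
    by have [_ _ -> // _ _] := Hul m (ltn_ord m); rewrite (ipC (u m)) pw// !mulr0.
  have := ELp _ pp; rewrite (DformC w) (ipC w) (Dform_wadd (-1) WpT Ws WwT) (ip_wadd (-1) WpT Ws WwT).
  by rewrite (DformC s) (ipC s) Ds ips !mulr0 !addr0 (DformC phi) (ipC phi).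
have lL m : (m < j)%N -> l m <= L.
  move=> mj; have [_ _ _ _ h] := Hul m mj.
  have := h w Ww (fun m' h' => pw m' (ltn_trans h' mj)).
  by rewrite nw mulr1.
pose u' m := if (m < j)%N then u m else w.
pose l' m := if (m < j)%N then l m else L.
have u'j : u' j = w by rewrite /u' ltnn.
have orth m m' : (m < j.+1)%N -> (m' < j.+1)%N -> ip (u' m) (u' m') = (m == m')%:R.
  rewrite !ltnS => mj m'j; rewrite /u'.
  case: (ltnP m j) => h; case: (ltnP m' j) => h'.
  - by have [_ -> // _ _ _] := Hul m h.
  - by rewrite ipC pw// ltn_eqF// (leq_trans h h').
  - by rewrite pw// gtn_eqF// (leq_trans h' h).
  - have -> : m = m' by apply/eqP; rewrite eqn_leq (leq_trans mj h') (leq_trans m'j h).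
    by rewrite eqxx nw.
have Wu' m : (m < j.+1)%N -> W0 A (u' m).
  by rewrite /u' => _; case: ifP => // mj; have [] := Hul m mj.
have Du' m phi : (m < j.+1)%N -> W0 A phi -> Dform (u' m) phi = l' m * ip (u' m) phi.
  rewrite /u' /l' => _ Wp; case: ifP => mj; last exact: EL.
  by have [_ _ H _ _] := Hul m mj; exact: H.
exists u', l' => m; rewrite ltnS leq_eqVlt => /orP[/eqP ->|mj]; last first.
  have mj1 : (m < j.+1)%N by rewrite ltnS ltnW.
  split; [exact: Wu'|by move=> m' m'j; exact: orth|by move=> phi; exact: Du'| |].
    by rewrite /l' mj; have [] := Hul m mj.
  move=> w' Ww' pw'; rewrite /l' mj; have [_ _ _ _] := Hul m mj; apply=> // m' m'm.
  by have := pw' m' m'm; rewrite /u' (ltn_trans m'm mj).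
split; [exact: Wu'|by move=> m' m'j; exact: orth|by move=> phi; exact: Du'| |].
  (* Upper bound: on the span of the functions found, the energy is diagonal with entries at most L.
     Lower bound: every trial space of dimension j + 1 contains a competitor of the minimization. *)
  rewrite /l' ltnn; apply/eqP; rewrite eq_le; apply/andP; split.
    apply: (@lambda_le _ _ _ _ _ (fun m : 'I_j.+1 => u' m)).
    - by move=> k; exact: Wu'.
    - apply: lin_indep_orth; first by move=> k; apply: W0_T (Wu' k (ltn_ord k)).
      by move=> k k'; rewrite orth.
    - move=> c; have [|||-> ->] := @lincomb_orth j.+1 (fun m : 'I_j.+1 => u' m) (fun m => l' m) c.
      + by move=> k; apply: W0_T (Wu' k (ltn_ord k)).
      + by move=> k k'; rewrite orth.
      + by move=> k k'; rewrite Du'// ?orth//; exact: Wu'.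
      + move=> c1; rewrite -[L]mulr1 -c1 mulr_sumr; apply: ler_sum => k _.
        rewrite ler_wpM2r ?sqr_ge0// /l'; case: ifP => // kj; exact: lL.
  apply: lambda_ge => v' Wv' iv'.
  have [c [c1 pc]] := ortho_pick_perp Wu Wv' iv'.
  by exists c; split=> //; have := minw _ pc; rewrite c1 mulr1.
move=> w' Ww' pw'; rewrite /l' ltnn; apply: minw; split=> // m0 mj.
by have := pw' m0 mj; rewrite /u' mj.
Qed.

End Existence.

(** * Tubes *)

Section Cylinder.
Variable R : realType.

Lemma image_compact (T U : topologicalType) (f : T -> U) (A : set T) : continuous f -> compact A ->
  compact (f @` A).
Proof. by move=> cf; apply: continuous_compact; exact: continuous_subspaceT. Qed.

Lemma poincare_test d (A : set 'rV[R]_d) (mu : R) f : (mu%:E <= lambda A 1)%E -> test_fun A f ->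
  mu * L2ip_f f f <= Dform_f f f.
Proof.
move=> mul tf; have [f0|f0] := eqVneq (L2ip_f f f) 0; first by rewrite f0 mulr0 Dform_ge0.
have fp : 0 < L2ip_f f f by rewrite lt_neqAle eq_sym f0 L2ip_ge0.
have tT : test_fun setT f by apply: test_sub tf.
have Wf : W0 setT (wcst f) by exact: W0_cst.
have WT : forall m : 'I_1, W0 setT (wcst f) by [].
have ipf : ip (wcst f) (wcst f) = L2ip_f f f by rewrite ipE ext_cst.
have Df : Dform (wcst f) (wcst f) = Dform_f f f by rewrite DformE ext_cst.
have ipl (c : 'I_1 -> R) : ip (lincomb c (fun _ => wcst f)) (lincomb c (fun _ => wcst f)) =
    c ord0 ^+ 2 * L2ip_f f f.
  rewrite ip_lincomb//; last exact: W0_lincomb.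
  by rewrite big_ord1 ipC ip_lincomb// big_ord1 ipf expr2 mulrA.
have Dl (c : 'I_1 -> R) : energy (lincomb c (fun _ => wcst f)) = c ord0 ^+ 2 * Dform_f f f.
  rewrite energyE Dform_lincomb//; last exact: W0_lincomb.
  by rewrite big_ord1 DformC Dform_lincomb// big_ord1 Df expr2 mulrA.
have : (lambda A 1 <= (Dform_f f f / L2ip_f f f)%:E)%E.
  apply: (@lambda_le _ _ _ _ _ (fun _ => wcst f)) => [m||c].
  - exact: W0_cst.
  - move=> c; rewrite ipl Dl -mulrDr => /eqP; rewrite mulf_eq0 => /orP[|h m].
      by rewrite sqrf_eq0 => /eqP c0 m; rewrite ord1.
    by move: h; rewrite gt_eqF// ltr_pwDl// Dform_ge0.
  - rewrite ipl Dl => c1; rewrite ler_pdivlMr// mulrAC c1 mul1r; exact: lexx.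
by move=> /(le_trans mul); rewrite lee_fin ler_pdivlMr.
Qed.

Section Geometry.
Variable n : nat.
Implicit Types (E : set 'rV[R]_n) (M : 'M[R]_n.+1) (t : 'rV[R]_n.+1).

(** Exhibits [rsnoc] as an affine map of the cross-section, so that slices inherit smoothness and
    the chain rule from the affine case. *)
Definition snocmx : 'M[R]_(n, n.+1) := \matrix_(i, j) (lift ord_max i == j)%:R.

Lemma rsnoc_affine (y : 'rV[R]_n) s : rsnoc y s = y *m snocmx + s *: evec R ord_max.
Proof.
apply/rowP => j; rewrite !mxE eqxx /=; have [jm|->] := unliftP ord_max j; last first.
  rewrite rsnoc_max eqxx mulr1 big1 ?add0r// => i _; rewrite mxE (_ : _ == _ = false) ?mulr0//.
  by rewrite eq_sym; apply/negbTE; exact: neq_lift.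
move=> ->; rewrite rsnoc_lift (bigD1 jm)//= big1 => [|i ij]; last first.
  by rewrite mxE (inj_eq lift_inj) (negbTE ij) mulr0.
by rewrite mxE eqxx mulr1 addr0 (_ : lift _ _ == ord_max = false) ?mulr0 ?addr0// eq_sym; apply/negbTE/neq_lift.
Qed.

Lemma rsnocK (y : 'rV[R]_n) s : rsnoc y s *m snocmx^T = y.
Proof.
apply/rowP => i; rewrite !mxE (bigD1 (lift ord_max i))//= big1 => [|j ji]; last first.
  by rewrite !mxE eq_sym (negbTE ji) mulr0.
by rewrite !mxE eqxx mulr1 addr0 rsnoc_lift.
Qed.

Lemma rsnoc_eta (x : 'rV[R]_n.+1) : rsnoc (x *m snocmx^T) (x 0 ord_max) = x.
Proof.
apply/rowP => j; have [i|->] := unliftP ord_max j; last by rewrite rsnoc_max.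
move=> ->; rewrite rsnoc_lift mxE (bigD1 (lift ord_max i))//= big1 => [|k ki].
  by rewrite !mxE eqxx mulr1 addr0.
by rewrite !mxE eq_sym (negbTE ki) mulr0.
Qed.

Lemma smooth_slice (f : 'rV[R]_n.+1 -> R) s : smooth f -> smooth (fun y => f (rsnoc y s)).
Proof.
move=> sf; have := smooth_affine snocmx (s *: evec R ord_max) sf.
by congr smooth; apply/funext => y; rewrite rsnoc_affine.
Qed.

Lemma pderiv_slice (f : 'rV[R]_n.+1 -> R) s i : smooth f ->
  pderiv i (fun y => f (rsnoc y s)) = fun y => pderiv (lift ord_max i) f (rsnoc y s).
Proof.
move=> sf; apply: pderivE => y.
have := affine_derive snocmx (s *: evec R ord_max) i y sf.
have -> : (fun y => f (y *m snocmx + s *: evec R ord_max)) = fun y => f (rsnoc y s).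
  by apply/funext => z; rewrite rsnoc_affine.
rewrite (bigD1 (lift ord_max i))//= big1 => [|j ji].
  by rewrite mxE eqxx mul1r addr0 -rsnoc_affine.
by rewrite mxE eq_sym (negbTE ji) mul0r.
Qed.

(* Coordinates of x in the frame of the tube: the last one runs along the axis,
   and multiplication by [snocmx^T] keeps the others. *)
Definition loc M t (x : 'rV[R]_n.+1) := (x - t) *m M.

Lemma locK M t z : orthogonal_mx M -> loc M t (z *m M^T + t) = z.
Proof. by move=> /orth_tr MM; rewrite /loc addrK -mulmxA MM mulmx1. Qed.

Lemma loc_inv M t x : orthogonal_mx M -> loc M t x *m M^T + t = x.
Proof. by move=> MM; rewrite /loc -mulmxA MM mulmx1 subrK. Qed.

Lemma cylinderP E M t x : orthogonal_mx M ->
  cylinder E M t x <-> E (loc M t x *m snocmx^T) /\ 0 < loc M t x 0 ord_max.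
Proof.
move=> MM; split=> [[y [s [Ey [s0 ->]]]]|[Ey s0]].
  by rewrite locK// -/(rsnoc y s) rsnocK rsnoc_max.
exists (loc M t x *m snocmx^T), (loc M t x 0 ord_max); split=> //; split=> //.
by rewrite -/(rsnoc _ _) rsnoc_eta loc_inv.
Qed.

Lemma cubeP M t r x : orthogonal_mx M -> cube M t r x <-> forall i, `|loc M t x 0 i| < r.
Proof.
move=> MM; split=> [[z [zr ->]]|h]; first by rewrite locK.
by exists (loc M t x); rewrite loc_inv.
Qed.

Lemma loc_cont M t : continuous (loc M t).
Proof.
have -> : loc M t = fun x => x *m M + - t *m M by apply/funext => x; rewrite /loc mulmxBl mulNmx.
exact: continuous_affine.
Qed.

Lemma cross_cont M t : continuous (fun x => loc M t x *m snocmx^T).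
Proof.
have -> : (fun x => loc M t x *m snocmx^T) = fun x => x *m (M *m snocmx^T) + - t *m M *m snocmx^T.
  by apply/funext => x; rewrite /loc mulmxBl mulmxBl !mulNmx mulmxA.
exact: continuous_affine.
Qed.

Lemma slice_Cc (F : 'rV[R]_n.+1 -> R) s : Cc F -> Cc (fun y => F (rsnoc y s)).
Proof.
move=> [cF [B hB]]; split.
  have cr : continuous (fun y : 'rV[R]_n => rsnoc y s).
    rewrite (_ : (fun y : 'rV[R]_n => rsnoc y s) = fun y => y *m snocmx + s *: evec R ord_max).
      exact: continuous_affine.
    by apply/funext => y; rewrite rsnoc_affine.
  exact: (cont_comp cF cr).
exists B => y By; apply: hB; apply: lt_le_trans By _.
apply: normrV_le => // i; rewrite -(rsnoc_lift y s); exact: coord_le_norm.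
Qed.

Lemma slice_le (F G : 'rV[R]_n.+1 -> R) : Cc F -> Cc G ->
  (forall s, intRd (fun y => F (rsnoc y s)) <= intRd (fun y => G (rsnoc y s))) ->
  intRd F <= intRd G.
Proof.
move=> cF cG H; rewrite -subr_ge0 -intRdB// intRd_rsnoc; apply: int1_ge0 => s.
by rewrite intRdB ?subr_ge0//; exact: slice_Cc.
Qed.

Lemma test_slice E M t s f : orthogonal_mx M -> test_fun (cylinder E M t) f ->
  test_fun E (fun y => f (rsnoc y s *m M^T + t)).
Proof.
move=> MM [sf [K [cK [KC f0]]]]; split.
  exact: (smooth_slice s (smooth_affine M^T t sf)).
exists ((fun x => loc M t x *m snocmx^T) @` K); split; [|split].
- exact: image_compact (@cross_cont M t) cK.
- by move=> _ [x Kx <-]; have [+ _] := (cylinderP E t x MM).1 (KC _ Kx).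
- move=> y nK; apply: f0 => Kx; apply: nK; exists (rsnoc y s *m M^T + t); first exact: Kx.
  by rewrite (locK t _ MM) rsnocK.
Qed.

Lemma pderiv_slice_le (f : 'rV[R]_n.+1 -> R) s y : smooth f ->
  \sum_(i < n) pderiv i (fun y => f (rsnoc y s)) y * pderiv i (fun y => f (rsnoc y s)) y <=
  \sum_(i < n.+1) pderiv i f (rsnoc y s) * pderiv i f (rsnoc y s).
Proof.
move=> sf; rewrite (bigD1_ord ord_max)//= -[leLHS]add0r lerD//; first by rewrite -expr2 sqr_ge0.
by apply: ler_sum => i _; rewrite (pderiv_slice s i sf).
Qed.

(** In the frame of the tube both integrals keep their values, the gradient being multiplied by an
    orthogonal matrix. On each slice the axial derivative is dropped and the inequality of the
    cross-section applies. *)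
Lemma cylinder_poincare E M t (mu : R) f : orthogonal_mx M -> (mu%:E <= lambda E 1)%E ->
  test_fun (cylinder E M t) f -> mu * L2ip_f f f <= Dform_f f f.
Proof.
move=> MM mul tf; have sf := test_smooth tf; have cf := test_Cc tf.
have tT : test_fun setT f by exact: test_sub tf.
have MM' : M^T *m M^T^T = 1%:M by rewrite trmxK; exact: orth_tr.
pose A z := f (z *m M^T + t).
have sA : smooth A by exact: smooth_affine.
have tA : test_fun setT A.
  by apply/tfunP; split=> //; apply: Cc_affine => //; rewrite unitmx_tr; exact: orth_unit.
have eL : L2ip_f f f = intRd (fun z => A z * A z).
  by rewrite /A (@intRd_isometry R _ M^T MM' (fun x => f x * f x) t (tf_CcM tT tT)).
have eD : Dform_f f f = intRd (fun z => \sum_(i < n.+1) pderiv i A z * pderiv i A z).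
  rewrite /Dform_f -(@intRd_isometry R _ M^T MM' _ t (tf_CcD tT tT)).
  congr intRd; apply/funext => z.
  pose g : 'rV[R]_n.+1 := \row_j pderiv j f (z *m M^T + t).
  transitivity (sqn g); first by apply: eq_bigr => i _; rewrite mxE expr2.
  rewrite -(sqn_orth g MM); apply: eq_bigr => i _.
  rewrite -expr2; congr (_ ^+ 2).
  rewrite mxE /pderiv; have [_ ->] : is_derive z (evec R i) A (\sum_(j < n.+1) M^T i j * pderiv j f (z *m M^T + t)).
    exact: affine_derive.
  by apply: eq_bigr => j _; rewrite !mxE mulrC.
have cAA := tf_CcM tA tA; have cDA := tf_CcD tA tA.
rewrite eL eD -(intRdZ mu cAA); apply: (slice_le (CcZ mu cAA) cDA) => s.
pose g y := A (rsnoc y s).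
have tg : test_fun E g := test_slice s MM tf.
have tgT : test_fun setT g := test_sub (@subsetT _ _) tg.
have cDg := tf_CcD tgT tgT; have cgg := tf_CcM tgT tgT.
have := poincare_test mul tg; rewrite /L2ip_f /Dform_f -(intRdZ mu cgg).
move=> /le_trans; apply; apply: (intRd_le cDg (slice_Cc s cDA)) => y.
exact: pderiv_slice_le.
Qed.

End Geometry.
End Cylinder.

(** * Localization to the far ends of the tubes *)

Section Localization.
Variables (R : realType) (d : nat).
Implicit Types (A U : set 'rV[R]_d) (f u : 'rV[R]_d -> R).
Local Notation tf f := (test_fun (@setT 'rV[R]_d) f).

Lemma test_out A f x : test_fun A f -> ~ A x -> f x = 0.
Proof. by move=> [_ [K [_ [KA f0]]]] nA; apply: f0 => /KA. Qed.

Lemma test_T A f : test_fun A f -> tf f.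
Proof. exact: test_sub. Qed.

Definition glue U f := fun x => if `[< U x >] then f x else 0.

Lemma pderiv_glue U f i x : open U -> U x -> smooth f -> pderiv i (glue U f) x = pderiv i f x.
Proof.
move=> oU Ux sf; have [r r0 hr] := open_ball_sub oU Ux.
have [_] : is_derive x (evec R i) (glue U f) (pderiv i f x); last by [].
apply: is_derive_near (smooth_is_derive i x sf).
by exists r => // y /hr Uy; rewrite /glue asboolT.
Qed.

Lemma sq_add_le (p q e : R) : 0 < e -> (p + q) ^+ 2 <= (1 + e) * p ^+ 2 + (1 + e^-1) * q ^+ 2.
Proof.
move=> e0; rewrite -subr_ge0.
have -> : (1 + e) * p ^+ 2 + (1 + e^-1) * q ^+ 2 - (p + q) ^+ 2 = (e * p - q) ^+ 2 / e.
  by field; rewrite gt_eqF.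
by rewrite divr_ge0 ?sqr_ge0 ?ltW.
Qed.

Lemma grad_mul_le (c u : 'rV[R]_d -> R) (e : R) x : smooth c -> smooth u -> 0 <= c x <= 1 -> 0 < e ->
  \sum_j pderiv j (fun x => u x * c x) x ^+ 2 <=
  (1 + e) * \sum_j pderiv j u x ^+ 2 + (1 + e^-1) * (u x ^+ 2 * \sum_j pderiv j c x ^+ 2).
Proof.
move=> sc su /andP[c0 c1] e0; rewrite !mulr_sumr -big_split /=; apply: ler_sum => j _.
rewrite (pderivM j su sc) [X in X ^+ 2]addrC; apply: (le_trans (sq_add_le _ _ e0)).
rewrite !exprMn lerD// ler_wpM2l//; first by rewrite addr_ge0// ltW.
rewrite -[leRHS]mul1r ler_wpM2r ?sqr_ge0//.
by rewrite -[leRHS](expr1n _ 2) lerXn2r// nnegrE.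
Qed.

(** Here a and D are the squared norm and energy of u, h and Dh those of its cut-off bounded part, S
    the sum of squared coefficients. First e is taken with 2 mu e <= mu0 - mu, to pay for the
    product rule; then dl with 4 K dl (c + mu + 1) = mu0 - mu, to absorb the bounded part. Neither
    depends on u. *)
Lemma localize_constants (mu mu0 Cg c : R) : 0 <= mu -> mu < mu0 -> 0 <= Cg -> 0 <= c ->
  exists e dl K : R, [/\ 0 < e, 0 < dl, 0 <= K & forall a D h S Dh : R, 0 <= a -> 0 <= D -> 0 <= S ->
    mu0 * a <= (1 + e) * D + ((1 + e^-1) * Cg + mu0) * h ->
    h <= dl * Dh + S -> Dh <= 2 * D + c * a -> mu * a <= D + K * S].
Proof.
move=> mu_ge0 lt_mu Cg0 c0.
pose e := (mu0 - mu) / (2 * (mu + 1)).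
have e0 : 0 < e by rewrite divr_gt0 ?subr_gt0// mulr_gt0//; lra.
pose K := (1 + e^-1) * Cg + mu0.
have K0 : 0 < K by apply: ltr_wpDl; [rewrite mulr_ge0// addr_ge0// invr_ge0 ltW|lra].
pose dl := (mu0 - mu) / (4 * K * (c + mu + 1)).
have den : 0 < 4 * K * (c + mu + 1) by rewrite !mulr_gt0//; lra.
have dl0 : 0 < dl by rewrite divr_gt0 ?subr_gt0.
exists e, dl, K; split=> //; first exact: ltW.
move=> a D h S Dh a0 D0 S0 h1 h2 h3.
have em : 2 * (mu * e) <= mu0 - mu.
  rewrite /e [leLHS](_ : _ = (mu0 - mu) * (mu / (mu + 1))); last by field; lra.
  rewrite -[leRHS]mulr1 ler_wpM2l ?subr_ge0 ?ltW// ltr_pdivrMr ?mul1r; lra.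
have dm : 4 * (K * dl) * (c + mu + 1) = mu0 - mu.
  rewrite [LHS](_ : _ = dl * (4 * K * (c + mu + 1))); last by ring.
  by rewrite /dl divfK// gt_eqF.
have Kdl : 0 < K * dl by rewrite mulr_gt0.
have h4 : K * h <= (K * dl) * (2 * D + c * a) + K * S.
  rewrite -(mulrA K) -mulrDr; apply: ler_wpM2l; first exact: ltW.
  by apply: le_trans h2 _; rewrite lerD2r; apply: ler_wpM2l => //; exact: ltW.
rewrite -/K in h1; move: h1 h4 Kdl dm em; move: (K * h) (K * dl) => Kh q h1 h4 q0 dm em.
have KS : 0 <= K * S by rewrite mulr_ge0// ltW.
move: (K * S) KS h4 => P P0 h4.
have qm : 0 <= q * mu * a by rewrite !mulr_ge0// ltW.
have qa : 0 <= q * a by rewrite !mulr_ge0// ltW.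
have s0 : 0 < 1 + e + 2 * q by lra.
rewrite -(ler_pM2l s0).
have b1 : mu0 * a <= (1 + e + 2 * q) * D + q * (c * a) + P by lra.
have b2 : 0 <= ((mu0 - mu) - 2 * (mu * e)) * a by rewrite mulr_ge0// subr_ge0.
have b3 : (mu0 - mu) * a = 4 * q * (c + mu + 1) * a by rewrite dm.
have qca : 0 <= q * (c * a) by rewrite !mulr_ge0// ltW.
have eP : 0 <= (e + 2 * q) * P by rewrite mulr_ge0//; lra.
move: b1 b2 b3 qm qa qca eP; rewrite !mulrDr !mulrDl !mul1r; clear -a0 D0 P0.
nra.
Qed.

Variables (k : nat) (Omega : set 'rV[R]_d) (C U : 'I_k -> set 'rV[R]_d)
  (chi : 'I_k -> 'rV[R]_d -> R) (B mu0 : R).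
Hypotheses (chi_smooth : forall i, smooth (chi i)) (chi01 : forall i x, 0 <= chi i x <= 1)
  (openU : forall i, open (U i)) (UC : forall i, U i `<=` C i)
  (Udisj : forall i j x, U i x -> U j x -> i = j)
  (glueU : forall i u, test_fun Omega u -> test_fun (U i) (glue (U i) (fun x => u x * chi i x)))
  (B0 : 0 <= B)
  (far1 : forall x, Omega x -> B < `|x| -> exists2 i, U i x & chi i x = 1)
  (far0 : forall i x j, U i x -> B < `|x| -> pderiv j (chi i) x = 0)
  (poincareC : forall i f, test_fun (C i) f -> mu0 * L2ip_f f f <= Dform_f f f).

Local Notation eta := (@boxcut R d B).
(** The part of u far out in the i-th tube. A product alone would not do, since [chi i] need not
    vanish on the other components. *)
Let v i u := glue (U i) (fun x => u x * chi i x).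

(** The cutoffs overlap and do not sum to 1; the inequality holds because at each point of Omega one
    of them equals 1. *)
Lemma localize_L2 u x : test_fun Omega u -> u x ^+ 2 <= \sum_i v i u x ^+ 2 + (u x * eta x) ^+ 2.
Proof.
move=> tu; have s0 : 0 <= \sum_i v i u x ^+ 2 by apply: sumr_ge0 => i _; exact: sqr_ge0.
have [xB|Bx] := leP `|x| B; first by rewrite boxcut1// mulr1 lerDr.
have [Ox|nOx] := pselect (Omega x); last by rewrite (test_out tu nOx) expr0n addr_ge0 ?sqr_ge0.
have [i Ui c1] := far1 Ox Bx.
rewrite (bigD1 i)//= {1}/v /glue asboolT// c1 mulr1 -addrA lerDl addr_ge0 ?sqr_ge0//.
by apply: sumr_ge0 => j _; exact: sqr_ge0.
Qed.

(** At most one [U i] contains x, so the outer sum has at most one nonzero term. The product rule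
    error u^2 |grad chi|^2 occurs only for |x| <= B, where [eta] is 1 and dominates it. *)
Lemma localize_grad : exists2 Cg : R, 0 <= Cg & forall e u x, 0 < e -> test_fun Omega u ->
  \sum_i \sum_j pderiv j (v i u) x ^+ 2 <=
  (1 + e) * \sum_j pderiv j u x ^+ 2 + (1 + e^-1) * (Cg * (u x * eta x) ^+ 2).
Proof.
have bnd i : exists2 c : R, 0 <= c & forall x, `|x| <= B -> \sum_j pderiv j (chi i) x ^+ 2 <= c.
  have cG : Cc (fun x => eta x * \sum_j pderiv j (chi i) x ^+ 2).
    apply: CcM; first split; first exact: (smooth_cont (boxcut_smooth B)).
      by exists (B + 1) => x xB; apply: boxcut0 => //; exact: ltW.
    apply: continuous_bigsum => j; apply: contX; apply: smooth_cont.
    exact: smooth_pderiv (chi_smooth i).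
  have [c c0 hc] := Cc_bounded cG; exists c; first exact: ltW.
  by move=> x xB; apply: le_trans (hc x); rewrite boxcut1// mul1r ler_norm.
have {bnd} [c hc] := choice (fun i => let: ex_intro2 c c0 h := bnd i in ex_intro _ c (conj c0 h)).
have c0 i : 0 <= c i by have [] := hc i.
exists (\sum_i c i); first exact: sumr_ge0.
move=> e u x e0 tu; have su := test_smooth tu.
have rhs0 : 0 <= (1 + e) * (\sum_j pderiv j u x ^+ 2) + (1 + e^-1) * ((\sum_i c i) * (u x * eta x) ^+ 2).
  rewrite addr_ge0// mulr_ge0 ?addr_ge0 ?invr_ge0 ?(ltW e0)//.
    by apply: sumr_ge0 => j _; exact: sqr_ge0.
  by rewrite mulr_ge0 ?sqr_ge0//; exact: sumr_ge0.
have v0 i : ~ U i x -> \sum_j pderiv j (v i u) x ^+ 2 = 0.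
  move=> nU; apply: big1 => j _.
  by rewrite (test_out (test_pderiv j (glueU i tu)) nU) expr0n.
have [[i Ui]|nU] := pselect (exists i, U i x); last first.
  by rewrite big1// => i _; apply: v0 => Ui; apply: nU; exists i.
rewrite (bigD1 i)//= [X in _ + X]big1 => [|i' i'i]; last first.
  by apply: v0 => Ui'; move: i'i; rewrite (Udisj Ui' Ui) eqxx.
rewrite addr0 (eq_bigr (fun j => pderiv j (fun x => u x * chi i x) x ^+ 2)); last first.
  by move=> j _; rewrite (pderiv_glue j (@openU i) Ui (smoothM su (chi_smooth i))).
apply: le_trans (grad_mul_le (chi_smooth i) su (chi01 i x) e0) _.
rewrite lerD2l ler_wpM2l ?addr_ge0 ?invr_ge0 ?(ltW e0)//.
have [xB|Bx] := leP `|x| B; last first.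
  rewrite big1 ?mulr0; last by move=> j _; rewrite (far0 j Ui Bx) expr0n.
  by rewrite mulr_ge0 ?sqr_ge0//; exact: sumr_ge0.
rewrite boxcut1// mulr1 mulrC ler_wpM2r ?sqr_ge0//; apply: (le_trans (proj2 (hc i) x xB)).
by rewrite (bigD1 i)//= lerDl; exact: sumr_ge0.
Qed.

Lemma cut_energy : exists2 c : R, 0 <= c & forall u, tf u ->
  Dform_f (fun x => u x * eta x) (fun x => u x * eta x) <= 2 * Dform_f u u + c * L2ip_f u u.
Proof.
have se := @boxcut_smooth R d B.
have te : tf eta.
  apply/tfunP; split=> //; split; first exact: smooth_cont se.
  by exists (B + 1) => x xB; apply: boxcut0 => //; exact: ltW.
have [c c0 hc] := Cc_bounded (tf_CcD te te); exists (2 * c); first by rewrite mulr_ge0 ?ltW.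
move=> u tu; have su := test_smooth tu; have tue := testM tu se.
have cD := tf_CcD tu tu; have cL := tf_CcM tu tu.
rewrite /Dform_f /L2ip_f -(intRdZ 2 cD) -(intRdZ (2 * c) cL) -intRdD; [|exact: CcZ|exact: CcZ].
apply: intRd_le; [exact: tf_CcD|by apply: CcD; exact: CcZ|move=> x].
have -> : \sum_i pderiv i (fun x => u x * eta x) x * pderiv i (fun x => u x * eta x) x =
    \sum_i pderiv i (fun x => u x * eta x) x ^+ 2 by apply: eq_bigr => i _; rewrite expr2.
have c01 : 0 <= eta x <= 1 by rewrite boxcut_ge0 boxcut_le1.
apply: le_trans (grad_mul_le se su c01 ltr01) _.
rewrite invr1; apply: lerD; first by rewrite le_eqVlt; apply/orP; left; apply/eqP; congr (_ * _); apply: eq_bigr.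
rewrite -mulrA ler_wpM2l// mulrC -expr2 ler_wpM2r ?sqr_ge0//; apply: le_trans _ (hc x).
by apply: le_trans (ler_norm _); apply: ler_sum => j _; rewrite expr2.
Qed.

Lemma localize_coercive mu : 0 <= mu -> mu < mu0 -> coercive Omega mu.
Proof.
move=> mu_ge0 lt_mu; have [Cg Cg0 hg] := localize_grad; have [c c0 hc] := cut_energy.
have [e [dl [K [e0 dl0 K0 H]]]] := localize_constants mu_ge0 lt_mu Cg0 c0.
have B1 : 0 <= B + 1 by rewrite addr_ge0.
have [I [a [ta ha]]] := finite_codim_poincare d B1 dl0.
have se := @boxcut_smooth R d B.
(* The coefficients of u times [eta] against [a i] are those of u against [a i] times [eta]; the
   square root absorbs the factor K in front of the squares. *)
apply: (@coercive_test _ _ _ _ I (fun i x => Num.sqrt K * (a i x * eta x))).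
  by move=> i; apply: testZ; exact: testM.
move=> u tu; have tT := test_T tu; have tue := testM tT se.
have ipE i : L2ip_f u (fun x => Num.sqrt K * (a i x * eta x)) = Num.sqrt K * L2ip_f (fun x => u x * eta x) (a i).
  rewrite /L2ip_f -intRdZ; last exact: tf_CcM.
  by congr intRd; apply/funext => x; ring.
under eq_bigr do rewrite ipE exprMn sqr_sqrtr//.
rewrite -mulr_sumr; set h := L2ip_f (fun x => u x * eta x) (fun x => u x * eta x).
apply: (H _ _ h _ _ (L2ip_ge0 u) (Dform_ge0 u) _ _ _ (hc u tT)).
- by apply: sumr_ge0 => i _; exact: sqr_ge0.
- have tv i : test_fun (C i) (v i u) by apply: test_sub (glueU i tu); exact: UC.
  have tvT i : tf (v i u) := test_T (tv i).
  have cv i : Cc (fun x => v i u x * v i u x) by exact: tf_CcM.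
  have cDv i : Cc (fun x => \sum_j pderiv j (v i u) x * pderiv j (v i u) x) by exact: tf_CcD.
  have cu := tf_CcM tT tT; have cDu := tf_CcD tT tT; have ch := tf_CcM tue tue.
  have i1 : L2ip_f u u <= \sum_i L2ip_f (v i u) (v i u) + h.
    rewrite /h /L2ip_f -(intRd_sum _ cv) -(intRdD (Cc_sum _ cv) ch).
    apply: (intRd_le cu (CcD (Cc_sum _ cv) ch)) => x.
    have := localize_L2 x tu; rewrite !expr2 => /le_trans; apply.
    by rewrite lerD2r; apply: ler_sum => i _; rewrite expr2.
  have i2 : \sum_i Dform_f (v i u) (v i u) <= (1 + e) * Dform_f u u + (1 + e^-1) * Cg * h.
    rewrite /h /L2ip_f /Dform_f -(intRd_sum _ cDv) -(intRdZ (1 + e) cDu) -(intRdZ _ ch).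
    rewrite -(intRdD (CcZ _ cDu) (CcZ _ ch)).
    apply: (intRd_le (Cc_sum _ cDv) (CcD (CcZ _ cDu) (CcZ _ ch))) => x.
    have sq f : \sum_(j < d) pderiv j f x ^+ 2 = \sum_(j < d) pderiv j f x * pderiv j f x.
      by apply: eq_bigr => j _; rewrite expr2.
    have := hg e u x e0 tu; rewrite [(u x * eta x) ^+ 2]expr2 sq !mulrA.
    by under eq_bigr do rewrite sq.
  have i3 : mu0 * (\sum_i L2ip_f (v i u) (v i u)) <= \sum_i Dform_f (v i u) (v i u).
    by rewrite mulr_sumr; apply: ler_sum => i _; exact: poincareC.
  have m0 : 0 < mu0 by exact: le_lt_trans lt_mu.
  have := ler_wpM2l (ltW m0) i1; rewrite mulrDr.
  move/le_trans; apply; rewrite (mulrDl ((1 + e^-1) * Cg)) addrA lerD2r.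
  exact: le_trans i3 i2.
- apply: ha => // x xB; rewrite boxcut0 ?mulr0//; exact: ltW.
Qed.
End Localization.

(** * Bounded sets and trial functions *)

Section OpenSets.
Variable R : realType.

Lemma bounded_le (V : normedModType R) (A : set V) : bounded_set A ->
  exists2 B : R, 0 <= B & forall x, A x -> `|x| <= B.
Proof.
move=> [M [_ hM]]; exists (`|M| + 1); first by rewrite addr_ge0.
have M1 : M < `|M| + 1 by apply: le_lt_trans (ler_norm _) _; rewrite ltrDl.
exact: hM M1.
Qed.

Lemma preimage_open (T U : topologicalType) (f : T -> U) A : continuous f -> open A -> open (f @^-1` A).
Proof. by move=> cf oA; apply: open_comp => // x _; exact: cf. Qed.

Lemma open_gtf (T : topologicalType) (f : T -> R) a : continuous f -> open [set x | a < f x].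
Proof. by move=> cf; exact: (preimage_open cf (@open_gt R a)). Qed.

Lemma closed_gef (T : topologicalType) (f : T -> R) a : continuous f -> closed [set x | a <= f x].
Proof.
move=> cf; rewrite (_ : [set x | a <= f x] = ~` [set x | f x < a]).
  by apply: open_closedC; exact: (preimage_open cf (@open_lt R a)).
by apply/seteqP; split=> x /=; [move=> h; apply/negP; rewrite -leNgt|move/negP; rewrite -leNgt].
Qed.

(** The finite-codimension inequality with e = 1 / (mu + 1), multiplied by mu + 1. On a bounded set
    there is thus no threshold for the existence of eigenfunctions. *)
Lemma bounded_coercive d (A : set 'rV[R]_d) B mu : (forall x, A x -> `|x| <= B) -> 0 <= B -> 0 <= mu ->
  coercive A mu.
Proof.
move=> AB B0 mu0; have m0 : 0 < mu + 1 by lra.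
have [I [a [ta ha]]] := finite_codim_poincare d B0 (divr_gt0 ltr01 m0).
apply: (@coercive_test _ _ _ _ I (fun i x => Num.sqrt (mu + 1) * a i x)).
  by move=> i; exact: testZ.
move=> f tf; have tT := test_T tf.
have -> : \sum_i L2ip_f f (fun x => Num.sqrt (mu + 1) * a i x) ^+ 2 = (mu + 1) * \sum_i L2ip_f f (a i) ^+ 2.
  rewrite mulr_sumr; apply: eq_bigr => i _; rewrite -[X in X * _](@sqr_sqrtr _ (mu + 1)) ?(ltW m0)// -exprMn.
  congr (_ ^+ 2); rewrite /L2ip_f -intRdZ; last exact: tf_CcM.
  by congr intRd; apply/funext => x; ring.
have fB x : B < `|x| -> f x = 0 by move=> Bx; apply: (test_out tf) => /AB; rewrite leNgt Bx.
have := ha f tT fB; rewrite -(ler_pM2l m0) mulrDr mulrA div1r mulfV ?gt_eqF// mul1r; apply: le_trans.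
by rewrite ler_wpM2r ?L2ip_ge0//; lra.
Qed.

Lemma lambda1_ge d (A : set 'rV[R]_d) mu :
  (forall f, test_fun A f -> mu * L2ip_f f f <= Dform_f f f) -> (mu%:E <= lambda A 1)%E.
Proof.
move=> H; apply: lambda_ge => v Wv iv.
have [c [c1 _]] := @ortho_pick R d A 0 1 v (fun _ => wcst (fun _ => 0)) isT Wv iv
  (fun _ => W0_cst (test0 setT)).
exists c; split=> //; rewrite -[mu]mulr1 -c1.
have WA := W0_lincomb c Wv.
have h0 (I : finType) (F : I -> R) : (I -> False) -> \sum_i F i = 0.
  by move=> nI; apply: big1 => i; case: (nI i).
have no : 'I_0 -> False by case.
(* An empty family of coefficients turns the coercive bound into a plain Poincare inequality. *)
have := @test_W0_bound R d A mu 'I_0 (fun _ => fun _ => 0) _ _ _ WA; rewrite h0// addr0; apply.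
- by move=> i; case: (no i).
- by move=> f tf; rewrite h0// addr0; exact: H.
Qed.

Lemma disjoint_forms d (A B : set 'rV[R]_d) f g : (forall x, A x -> ~ B x) -> test_fun A f -> test_fun B g ->
  L2ip_f f g = 0 /\ Dform_f f g = 0.
Proof.
move=> AB tf tg; rewrite /L2ip_f /Dform_f.
have m0 f' g' : test_fun A f' -> test_fun B g' -> forall x, f' x * g' x = 0.
  move=> tf' tg' x; have [Ax|nA] := pselect (A x); last by rewrite (test_out tf' nA) mul0r.
  by rewrite (test_out tg' (AB x Ax)) mulr0.
split; rewrite -[RHS](@intRd_0 R d); congr intRd; apply/funext => x; first exact: m0.
by apply: big1 => i _; apply: m0; exact: test_pderiv.
Qed.

(** The trial space is spanned by j bumps with disjoint supports inside a ball of A; both forms are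
    diagonal on it. Finiteness provides the level at which [Eig_exists] is applied to a truncated
    set. *)
Lemma lambda_fin d (A : set 'rV[R]_d.+1) x0 j : open A -> A x0 -> exists L : R, (lambda A j <= L%:E)%E.
Proof.
move=> oA Ax0; have [r r0 hr] := open_ball_sub oA Ax0.
(* The centers are 3 h apart and the supports lie within 5 h / 4 of them, so they are disjoint and
   all j of them stay within distance r of x0. *)
pose h := r / (3 * (j%:R + 1)).
have j0 : 0 <= j%:R :> R by rewrite ler0n.
have h0 : 0 < h by rewrite divr_gt0// mulr_gt0//; lra.
pose p (m : nat) := x0 + (3 * h * m%:R) *: evec R ord0.
pose Bm (m : nat) := [set x | `|x - p m| < h + h / 4].
pose f (m : nat) x := boxcut 0 (h^-1 *: (x - p m)) : R.
have ev1 : `|evec R (ord0 : 'I_d.+1)| <= 1.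
  by apply: normrV_le => // i; rewrite mxE eqxx /=; case: (_ == _); rewrite ?normr1 ?normr0.
have tf m : test_fun (Bm m) (f m).
  split.
    have := smooth_affine (h^-1)%:M (- (h^-1 *: p m)) (boxcut_smooth 0); congr smooth.
    by apply/funext => x; rewrite /f mul_mx_scalar scalerBr.
  exists ((fun y => y + p m) @` [set y | `|y| <= h]); split; [|split].
  - apply: (image_compact _ (@ball_compact _ _ h)).
    by apply: contDV; [exact: cont_id|exact: cont_cst].
  - by move=> _ [y /= yh <-]; rewrite /Bm /= addrK; apply: le_lt_trans yh _; rewrite ltrDl divr_gt0.
  - move=> x nx; apply: boxcut0 => //; rewrite add0r normrZ gtr0_norm ?invr_gt0// mulrC ler_pdivlMr// mul1r.
    rewrite leNgt; apply/negP => xh; apply: nx; exists (x - p m); first exact: ltW.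
    by rewrite subrK.
have Bdisj m m' x : m != m' -> Bm m x -> ~ Bm m' x.
  move=> mm'; rewrite /Bm /= => h1 h2.
  have : 3 * h * `|m%:R - m'%:R| <= `|p m - p m'|.
    have := coord_le_norm (p m - p m') ord0; apply: le_trans.
    rewrite !mxE !eqxx !mulr1 opprD addrACA subrr add0r -mulrBr normrM ler_wpM2r// ger0_norm//.
    by rewrite mulr_ge0// ltW.
  have d1 : 1 <= `|m%:R - m'%:R| :> R.
    rewrite -[m%:R]/(m%:~R) -[m'%:R]/(m'%:~R) -intrB -intr_norm -[1]/(1%:~R) ler_int.
    by rewrite -gtz0_ge1 normr_gt0 subr_eq0.
  have : `|p m - p m'| < (h + h / 4) + (h + h / 4).
    rewrite (_ : p m - p m' = (x - p m') - (x - p m)); last by rewrite opprB [RHS]addrC subrKA.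
    by apply: le_lt_trans (ler_normB _ _) _; exact: ltrD.
  have : 3 * h <= 3 * h * `|m%:R - m'%:R| by rewrite ler_pMr// mulr_gt0.
  lra.
have BA m : (m < j)%N -> Bm m `<=` A.
  move=> mj x /= xB; apply: hr; rewrite distrC.
  rewrite (_ : x - x0 = (x - p m) + (3 * h * m%:R) *: evec R ord0); last first.
    by rewrite /p opprD addrA subrK.
  apply: le_lt_trans (ler_normD _ _) _.
  have e1 : `|(3 * h * m%:R) *: evec R (ord0 : 'I_d.+1)| <= 3 * h * (j%:R - 1).
    rewrite normrZ ger0_norm; last by rewrite !mulr_ge0// ltW.
    apply: le_trans (_ : 3 * h * m%:R * 1 <= _).
      by rewrite ler_wpM2l// !mulr_ge0// ltW.
    rewrite mulr1 ler_wpM2l//; first by rewrite mulr_ge0// ltW.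
    by rewrite lerBrDr natr1 ler_nat.
  have er : r = 3 * h * (j%:R + 1) by rewrite /h; field; lra.
  have hm : 0 <= h * j%:R by rewrite mulr_ge0// ltW.
  apply: lt_le_trans (ltr_leD xB e1) _; rewrite er; lra.
have f0 m : f m (p m) != 0.
  by rewrite gt_eqF// /f subrr scaler0 boxcut_gt0// normr0 add0r.
have tT m : test_fun setT (f m) := test_T (tf m).
have L0 m : 0 < L2ip_f (f m) (f m) := L2ip_gt0 (tT m) (f0 m).
pose g (m : 'I_j) x := (Num.sqrt (L2ip_f (f m) (f m)))^-1 * f m x.
have tg (m : 'I_j) : test_fun (Bm m) (g m) by exact: testZ.
have tgT (m : 'I_j) : test_fun setT (g m) := test_T (tg m).
have Wg (m : 'I_j) : W0 setT (wcst (g m)) by exact: W0_cst.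
have off (m m' : 'I_j) : m != m' -> L2ip_f (g m) (g m') = 0 /\ Dform_f (g m) (g m') = 0.
  by move=> mm'; exact: (disjoint_forms (fun x => Bdisj m m' x mm') (tg m) (tg m')).
have og : orthonormal_fam (fun m => wcst (g m)).
  move=> m m'; rewrite ipE ext_cst; have [->|mm'] := eqVneq m m'; last exact: (off _ _ mm').1.
  have cL := tf_CcM (tT m') (tT m').
  rewrite /L2ip_f (_ : (fun x => _) = fun x => (L2ip_f (f m') (f m'))^-1 * (f m' x * f m' x)).
    by rewrite intRdZ// mulVf// gt_eqF// L0.
  apply/funext => x; rewrite /g mulrACA -expr2 exprVn sqr_sqrtr//; exact: ltW.
pose l m := Dform_f (g m) (g m).
have Dg m m' : Dform (wcst (g m)) (wcst (g m')) = l m * (m == m')%:R.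
  rewrite DformE ext_cst; have [->|mm'] := eqVneq m m'; first by rewrite mulr1.
  by rewrite mulr0 (off _ _ mm').2.
exists (\sum_m l m); apply: (@lambda_le _ _ _ _ _ (fun m => wcst (g m))).
- by move=> m; apply: W0_cst; exact: test_sub (BA m (ltn_ord m)) (tg m).
- exact: lin_indep_orth.
- move=> c; have [-> ->] := lincomb_orth c Wg og Dg => c1.
  apply: ler_sum => m _; rewrite -[leRHS]mulr1 ler_wpM2l ?Dform_ge0// -c1.
  by rewrite (bigD1 m)//= lerDl; apply: sumr_ge0 => i _; exact: sqr_ge0.
Qed.

End OpenSets.

Section Tubes.
Variables (R : realType) (n : nat) (Omega0 : set 'rV[R]_n.+1) (k : nat)
  (E : 'I_k -> set 'rV[R]_n) (M : 'I_k -> 'M[R]_n.+1) (t : 'I_k -> 'rV[R]_n.+1) (r0 : R).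
Let C i := cylinder (E i) (M i) (t i).
Let Omega := Omega0 `|` \bigcup_(i in [set: 'I_k]) C i.
Let Omega_r r := Omega0 `|` \bigcup_(i in [set: 'I_k]) (cube (M i) (t i) r `&` C i).
Hypotheses (oO : open Omega0) (bO : bounded_set Omega0)
  (oE : forall i, open (E i)) (bE : forall i, bounded_set (E i)) (MM : forall i, orthogonal_mx (M i))
  (r0_gt0 : 0 < r0)
  (hr0 : forall r, r0 <= r -> Omega `\` Omega_r r = \bigcup_(i in [set: 'I_k]) (C i `\` cube (M i) (t i) r) /\
     (forall i j : 'I_k, i != j -> (C i `\` cube (M i) (t i) r) `&` (C j `\` cube (M j) (t j) r) = set0)).

(** The equality of sets in [hr0] excludes Omega_0 and the truncated parts of the other tubes; the
    disjointness in [hr0] excludes their outer parts. *)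
Lemma outer_disjoint r i x : r0 <= r -> C i x -> ~ cube (M i) (t i) r x ->
  ~ Omega0 x /\ forall j, C j x -> j = i.
Proof.
move=> rr0 Cx nQ; have [h1 h2] := hr0 rr0.
have [_ nO] : (Omega `\` Omega_r r) x by rewrite h1; exists i.
split; first by move=> Ox; apply: nO; left.
move=> j Cj; apply/eqP/negPn/negP => ji.
have nQj : ~ cube (M j) (t j) r x by move=> Qj; apply: nO; right; exists j.
have : ((C j `\` cube (M j) (t j) r) `&` (C i `\` cube (M i) (t i) r)) x by [].
by rewrite h2.
Qed.

Lemma cylinder_open i : open (C i).
Proof.
rewrite (_ : C i = (fun x => loc (M i) (t i) x *m (snocmx R n)^T) @^-1` E i `&`
    [set x | 0 < loc (M i) (t i) x 0 ord_max]).
  apply: openI; first by apply: preimage_open => //; exact: cross_cont.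
  by apply: open_gtf; exact: (cont_comp (@coord_continuous _ _ _ 0 ord_max) (@loc_cont _ _ (M i) (t i))).
by apply/seteqP; split=> x /(cylinderP _ _ _ (MM i)).
Qed.

Lemma height_cont i : continuous (fun x => loc (M i) (t i) x 0 ord_max).
Proof. exact: (cont_comp (@coord_continuous _ _ _ 0 ord_max) (@loc_cont _ _ (M i) (t i))). Qed.

Lemma cube_norm i r x : 0 < r -> cube (M i) (t i) r x <-> `|loc (M i) (t i) x| < r.
Proof.
move=> rp; rewrite (cubeP _ _ _ (MM i)); split; first exact: normrV_lt.
by move=> h j; apply: le_lt_trans h; exact: coord_le_norm.
Qed.

Lemma cube_open i r : 0 < r -> open (cube (M i) (t i) r).
Proof.
move=> rp; rewrite (_ : cube _ _ _ = [set x | - r < - `|loc (M i) (t i) x|]).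
  apply: open_gtf; have cN : continuous (fun x : R => - x) by move=> x; apply: cvgN; exact: cvg_id.
  exact: (cont_comp cN (cont_comp (@norm_continuousV R n.+1) (@loc_cont _ _ (M i) (t i)))).
by apply/seteqP; split=> x; rewrite /= ltrN2 => /(cube_norm _ _ rp).
Qed.

Lemma Omega_r_open r : 0 < r -> open (Omega_r r).
Proof.
move=> rp; apply: openU => //; apply: bigcup_open => i _; apply: openI; first exact: cube_open.
exact: cylinder_open.
Qed.

Lemma Omega_r_sub r : Omega_r r `<=` Omega.
Proof. by move=> x [Ox|[i _ [_ Cx]]]; [left|right; exists i]. Qed.

Lemma Omega_r_mono r r' : r <= r' -> Omega_r r `<=` Omega_r r'.
Proof.
move=> rr x [Ox|[i _ [[z [zr ->]] Cx]]]; [by left|right; exists i => //; split=> //].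
by exists z; split=> // j; exact: lt_le_trans (zr j) rr.
Qed.

Lemma cube_bounded (r : R) : exists2 B : R, 0 <= B & (forall x, Omega0 x -> `|x| <= B) /\
  forall i x, `|loc (M i) (t i) x| <= r -> `|x| <= B.
Proof.
have [B0 B00 hB0] := bounded_le bO.
have bnd i : exists c : R, 0 <= c /\ forall x, `|loc (M i) (t i) x| <= r -> `|x| <= c.
  have cK : compact ((fun z => z *m (M i)^T + t i) @` [set z | `|z| <= r]).
    by apply: (image_compact _ (@ball_compact _ _ r)); exact: continuous_affine.
  have [c c0 hc] := bounded_le (compact_bounded cK); exists c; split=> // x xr; apply: hc.
  by exists (loc (M i) (t i) x) => //; exact: loc_inv.
have [c hc] := choice bnd; have c0 i : 0 <= c i by have [] := hc i.
exists (B0 + \sum_i c i); first by rewrite addr_ge0// sumr_ge0.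
split=> [x /hB0 h|i x xr]; first by apply: le_trans h _; rewrite lerDl sumr_ge0.
apply: le_trans (proj2 (hc i) x xr) _; rewrite (bigD1 i)//= addrCA lerDl addr_ge0//.
by rewrite sumr_ge0.
Qed.

Lemma Omega_r_coercive r mu : 0 < r -> 0 <= mu -> coercive (Omega_r r) mu.
Proof.
move=> rp mu0; have [B B0 [hO hB]] := cube_bounded r.
apply: (@bounded_coercive _ _ _ B) => // x [/hO//|[i _ [Qx _]]].
by apply: (hB i); apply: ltW; exact/cube_norm.
Qed.

(** A compact set has bounded coordinates in the frame of every tube. *)
Lemma test_exhaust f : test_fun Omega f -> exists2 r : R, 0 < r & test_fun (Omega_r r) f.
Proof.
move=> [sf [K [cK [KO f0]]]].
have bnd i : exists c : R, 0 <= c /\ forall x, K x -> `|loc (M i) (t i) x| <= c.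
  have cL : compact (loc (M i) (t i) @` K) by apply: image_compact cK; exact: loc_cont.
  have [c c0 hc] := bounded_le (compact_bounded cL); exists c; split=> // x Kx.
  by apply: hc; exists x.
have [c hc] := choice bnd; have c0 i : 0 <= c i by have [] := hc i.
have s0 : 0 <= \sum_i c i by rewrite sumr_ge0.
exists (\sum_i c i + 1); first lra.
split=> //; exists K; split=> //; split=> // x Kx; have [Ox|[i _ Cx]] := KO x Kx; first by left.
right; exists i => //; split=> //; apply/cube_norm; first lra.
apply: le_lt_trans (proj2 (hc i) x Kx) _.
have : c i <= \sum_i c i by rewrite (bigD1 i)//= lerDl sumr_ge0.
lra.
Qed.

Lemma Omega_coercive mu mu0 : 0 <= mu -> mu < mu0 -> (forall i, (mu0%:E <= lambda (E i) 1)%E) ->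
  coercive Omega mu.
Proof.
move=> mu_ge0 lt_mu hmu0.
have bnd i : exists c : R, 0 <= c /\ forall y, E i y -> `|y| <= c.
  by have [c c0 hc] := bounded_le (bE i); exists c.
have [c hc] := choice bnd; have c0 i : 0 <= c i by have [] := hc i.
(* Beyond [r0] the tubes are disjoint; beyond the radii of the cross-sections, a distant point of a
   tube must have a large height. *)
pose r := r0 + \sum_i c i.
have rr0 : r0 <= r by rewrite lerDl sumr_ge0.
have rp : 0 < r := lt_le_trans r0_gt0 rr0.
have cr i : c i <= r by rewrite /r (bigD1 i)//= addrCA lerDl addr_ge0 ?sumr_ge0// ltW.
have [B B0 [hO hB]] := cube_bounded (r + 2).
pose s i x := loc (M i) (t i) x 0 ord_max.
pose U i := C i `&` [set x | r < s i x].
(* Rises from 0 at height r + 1 to 1 at height r + 2, while [U i] starts at height r: the lower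
   margin gives a compact support inside [U i], the upper one makes [chi i] equal to 1 in the tube
   beyond B. *)
pose chi i x := step (s i x + (- r - 1)).
have nQ i x : r < s i x -> ~ cube (M i) (t i) r x.
  move=> rs /(cubeP _ _ _ (MM i)) /(_ ord_max); rewrite -/(s i x) ltNge => /negP; apply.
  by rewrite ltW// (lt_le_trans rs)// ler_norm.
have chiE i : chi i = fun x => step ((x *m col ord_max (M i)) 0 0 + (- ((t i) *m M i) 0 ord_max - r - 1)).
  apply/funext => x; rewrite /chi /s /loc mulmxBl !mxE; congr step.
  under [in RHS]eq_bigr do rewrite mxE.
  by rewrite !addrA.
have chi_smooth i : smooth (chi i) by rewrite chiE; exact: step_aff_smooth.
have oU i : open (U i) by apply: openI; [exact: cylinder_open|apply: open_gtf; exact: height_cont].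
have far i x : C i x -> B < `|x| -> r + 2 < s i x.
  move=> Cx Bx; rewrite ltNge; apply/negP => sx; move: Bx; rewrite ltNge => /negP; apply.
  have [Ey s0] := (cylinderP _ _ _ (MM i)).1 Cx.
  apply: (hB i); apply: normrV_le => [|j]; first lra.
  have -> : loc (M i) (t i) x 0 j = rsnoc (loc (M i) (t i) x *m (snocmx R n)^T) (s i x) 0 j by rewrite rsnoc_eta.
  have [j'|] := unliftP ord_max j => ->.
    rewrite rsnoc_lift; apply: le_trans (coord_le_norm _ _) _.
    by apply: le_trans (proj2 (hc i) _ Ey) _; apply: le_trans (cr i) _; rewrite lerDl.
  by rewrite rsnoc_max gtr0_norm.
apply: (@localize_coercive R _ k Omega C U chi B mu0) => //.
- by move=> i x; rewrite step_ge0 step_le1.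
- by move=> i x [].
- by move=> i j x [Ci ri] [Cj rj]; have [_ /(_ i Ci)] := outer_disjoint rr0 Cj (nQ _ _ rj).
- move=> i u tu; have [su [K [cK [KO u0]]]] := tu.
  (* Since V is open, K minus V is compact; it lies in the i-th tube because K lies in Omega, and
     [U i] avoids V, so nothing of u on [U i] is lost. *)
  pose V := Omega0 `|` \bigcup_(j in [set j | j != i]) C j.
  have oV : open V by apply: openU => //; apply: bigcup_open => j _; exact: cylinder_open.
  have UV x : U i x -> ~ V x.
    move=> [Ci ri] [Ox|[j ji Cj]]; first by have [] := outer_disjoint rr0 Ci (nQ _ _ ri).
    by have [_ /(_ j Cj) ij] := outer_disjoint rr0 Ci (nQ _ _ ri); move: ji; rewrite /= ij eqxx.
  apply: (@test_glue _ _ _ _ ((K `&` [set x | r + 1 <= s i x]) `&` ~` V)) => //.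
  + exact: smoothM su (chi_smooth i).
  + apply: compact_closedI; last exact: open_closedC.
    by apply: compact_closedI => //; apply: closed_gef; exact: height_cont.
  + move=> x [[Kx /= sx] nV]; split=> /=; last lra.
    have [Ox|[j _ Cj]] := KO x Kx; first by exfalso; apply: nV; left.
    have [<-//|ji] := eqVneq j i.
    by exfalso; apply: nV; right; exists j.
  + move=> x Ux nK; have [Kx|nKx] := pselect (K x); last by rewrite u0 ?mul0r.
    rewrite /chi step0 ?mulr0// addrA; have [sx|] := leP (r + 1) (s i x); last lra.
    by exfalso; apply: nK; split=> //; exact: UV.
- move=> x Ox Bx; have [/hO|[i _ Cx]] := Ox; first by rewrite leNgt Bx.
  have sx := far i x Cx Bx; exists i; first by split=> //=; lra.
  by rewrite /chi step1//; lra.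
- move=> i x j [Cx _] Bx; have sx := far i x Cx Bx.
  have [e e0 he] := open_ball_sub (open_gtf (r + 2) (@height_cont i)) sx.
  have [_] : is_derive x (evec R j) (chi i) 0; last by [].
  have dc : is_derive x (evec R j) (cst (1 : R)) 0 by exact: is_derive_cst.
  apply: (@is_derive_near R _ (chi i) (cst 1) x (evec R j) 0) dc.
  by exists e => // y /he /= sy; rewrite /chi step1// /s; lra.
- by move=> i f; exact: cylinder_poincare.
Qed.

(* Otherwise Omega is a disjoint union of tubes and lambda_1(Omega) >= mu0.  Note
   that a cube may well miss its tube, as E_i need not be contained in (-r, r)^n. *)
Lemma Omega_r_nonempty r mu0 : r0 <= r -> (lambda Omega 1 < mu0%:E)%E ->
  (forall i, (mu0%:E <= lambda (E i) 1)%E) -> exists x, Omega_r r x.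
Proof.
move=> rr0 lt hmu0; apply: contrapT => ne; move: lt; apply/negP; rewrite -leNgt.
have nO x : ~ Omega_r r x by move=> Ox; apply: ne; exists x.
have Cd i j x : C i x -> C j x -> i = j.
  move=> Ci Cj; have nQ : ~ cube (M j) (t j) r x by move=> Qx; apply: (nO x); right; exists j.
  by have [_ /(_ i Ci)] := outer_disjoint rr0 Cj nQ.
apply: lambda1_ge => u tu; have [su [K [cK [KO u0]]]] := tu.
have KC x : K x -> exists i, C i x.
  by move=> /KO[Ox|[i _ Ci]]; [exfalso; apply: (nO x); left|exists i].
have tg i : test_fun (C i) (glue (C i) u).
  pose V := \bigcup_(j in [set j | j != i]) C j.
  have oV : open V by apply: bigcup_open => j _; exact: cylinder_open.
  apply: (@test_glue _ _ _ _ (K `&` ~` V)) => //.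
  - exact: cylinder_open.
  - by apply: compact_closedI => //; exact: open_closedC.
  - move=> x [Kx nV]; have [j Cj] := KC x Kx; have [<-//|ji] := eqVneq j i.
    by exfalso; apply: nV; exists j.
  - move=> x Cx nK; apply: u0 => Kx; apply: nK; split=> // -[j /= ji Cj].
    by move: ji; rewrite (Cd _ _ _ Cj Cx) eqxx.
have tT := test_T tu; have tgT i := test_T (tg i).
have cg i := tf_CcM (tgT i) (tgT i); have cDg i := tf_CcD (tgT i) (tgT i).
(* G stands for the L^2 integrand or the Dirichlet integrand; both are local and split in the same
   way over the disjoint tubes. *)
have split1 (G : ('rV[R]_n.+1 -> R) -> 'rV[R]_n.+1 -> R) x : (forall i f, test_fun (C i) f -> ~ C i x -> G f x = 0) ->
    (forall i, C i x -> G (glue (C i) u) x = G u x) -> (~ K x -> G u x = 0) ->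
    G u x = \sum_i G (glue (C i) u) x.
  move=> G0 G1 GK; have [[i Ci]|nC] := pselect (exists i, C i x).
    rewrite (bigD1 i)//= big1 ?addr0 ?G1// => j ji; apply: (G0 j) => // Cj.
    by move: ji; rewrite (Cd _ _ _ Cj Ci) eqxx.
  rewrite big1 ?GK//; first by move=> /KC.
  by move=> i _; apply: (G0 i) => // Ci; apply: nC; exists i.
have uK x : ~ K x -> forall j, pderiv j u x = 0.
  move=> nK j; have : test_fun K u by split; [exact: su|exists K; split=> //; split].
  by move=> /(test_pderiv j) /test_out; apply.
have eL : L2ip_f u u = \sum_i L2ip_f (glue (C i) u) (glue (C i) u).
  rewrite /L2ip_f -(intRd_sum _ cg); congr intRd; apply/funext => x.
  apply: (split1 (fun f x => f x * f x)) => [i f tf nC|i Ci|nK].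
  - by rewrite (test_out tf nC) mul0r.
  - by rewrite /glue asboolT.
  - by rewrite u0 ?mul0r.
have eD : Dform_f u u = \sum_i Dform_f (glue (C i) u) (glue (C i) u).
  rewrite /Dform_f -(intRd_sum _ cDg); congr intRd; apply/funext => x.
  apply: (split1 (fun f x => \sum_j pderiv j f x * pderiv j f x)) => [i f tf nC|i Ci|nK].
  - by apply: big1 => j _; rewrite (test_out (test_pderiv j tf) nC) mul0r.
  - by apply: eq_bigr => j _; rewrite (pderiv_glue j (@cylinder_open i) Ci su).
  - by apply: big1 => j _; rewrite uK ?mul0r.
rewrite eL eD mulr_sumr; apply: ler_sum => i _; exact: cylinder_poincare (MM i) (hmu0 i) (tg i).
Qed.

End Tubes.

(** * Limits of the truncated eigenfunctions *)

Section Limit.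
Variables (R : realType) (d : nat).
Implicit Types (w phi : Wseq R d).

Lemma Eig_weak (A : set 'rV[R]_d) j u l m phi : Eig A j u l -> (m < j)%N -> W0 A phi ->
  Dform (u m) phi = l m * ip (u m) phi.
Proof. by move=> H mj Wp; have [_ _ + _ _] := H m mj; exact. Qed.

Lemma Eig_orth (A : set 'rV[R]_d) j u l m m' : Eig A j u l -> (m < j)%N -> (m' < j)%N ->
  ip (u m) (u m') = (m == m')%:R.
Proof. by move=> H mj m'j; have [_ + _ _ _] := H m mj; exact. Qed.

(** Minimality applied to w minus its projection on the earlier eigenfunctions; the energy of the
    projection is nonnegative and is dropped. Free of constraints on w, this form survives a change
    of the eigenfunctions. *)
Lemma Eig_residual (A : set 'rV[R]_d) j u l m w : Eig A j u l -> (m < j)%N -> W0 A w ->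
  l m * (ip w w - \sum_(m' < m) ip w (u m') ^+ 2) <= energy w.
Proof.
move=> H mj Ww; have WT := W0_T Ww.
have m'j (m' : 'I_m) : (m' < j)%N := ltn_trans (ltn_ord m') mj.
have Wu (m' : 'I_m) : W0 A (u m') by have [] := H m' (m'j m').
have WuT (m' : 'I_m) : W0 setT (u m') := W0_T (Wu m').
have l0 m' : (m' < j)%N -> 0 <= l m'.
  by move=> h; have [_ _ _ e _] := H m' h; rewrite -lee_fin -e; exact: lambda_ge0.
pose c (m' : 'I_m) := ip w (u m').
pose s := lincomb c (fun m' : 'I_m => u m').
have Ws : W0 A s by exact: W0_lincomb.
have WsT := W0_T Ws.
have og (m' m'' : 'I_m) : ip (u m') (u m'') = (m' == m'')%:R.
  exact: (Eig_orth H (m'j m') (m'j m'')).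
have Du (m' m'' : 'I_m) : Dform (u m') (u m'') = l m' * (m' == m'')%:R.
  by rewrite (Eig_weak H (m'j m') (Wu m'')) og.
have [ss es] := @lincomb_orth R d m (fun m' : 'I_m => u m') (fun m' : 'I_m => l m') c WuT og Du.
have iws : ip w s = \sum_(m' < m) c m' ^+ 2.
  by rewrite ipC /s ip_lincomb//; apply: eq_bigr => m' _; rewrite ipC expr2.
have Dws : Dform w s = \sum_(m' < m) l m' * c m' ^+ 2.
  rewrite DformC /s Dform_lincomb//; apply: eq_bigr => m' _.
  by rewrite (Eig_weak H (m'j m') Ww) ipC /c expr2 mulrCA.
have := H m mj => -[_ _ _ _ /(_ (wadd w (-1) s) (W0_wadd _ Ww Ws))].
rewrite (ip_sq _ WT WsT) (energy_sq _ WT WsT) ss es iws Dws.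
have pp m' : (m' < m)%N -> ip (wadd w (-1) s) (u m') = 0.
  move=> h; pose o := Ordinal h.
  rewrite (ip_wadd _ WT WsT (WuT o)) /s ip_lincomb//.
  rewrite (bigD1 o isT) big1 => [|k ko]; last by rewrite og (negbTE (andP ko).2) mulr0.
  by rewrite og eqxx mulr1 /= addr0 mulN1r subrr.
move/(_ pp); set S := \sum_(m' < m) c m' ^+ 2; set T := \sum_(m' < m) l m' * c m' ^+ 2.
rewrite (_ : ip w w + 2 * -1 * S + (-1) ^+ 2 * S = ip w w - S); last by ring.
rewrite (_ : energy w + 2 * -1 * T + (-1) ^+ 2 * T = energy w - T); last by ring.
move/le_trans; apply; rewrite gerBl; apply: sumr_ge0 => m' _.
by rewrite mulr_ge0 ?sqr_ge0// l0.
Qed.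

Variables (Omega : set 'rV[R]_d) (A : nat -> set 'rV[R]_d) (v : nat -> nat -> Wseq R d)
  (lam : nat -> nat -> R) (j : nat) (mu : R) (I : finType) (a : I -> 'rV[R]_d -> R).
Hypotheses (Amono : forall q q', (q <= q')%N -> A q `<=` A q') (AO : forall q, A q `<=` Omega)
  (exh : forall f, test_fun Omega f -> exists K : nat, forall q, (K <= q)%N -> test_fun (A q) f)
  (Hv : forall q, Eig (A q) j (v q) (lam q))
  (ta : forall i, test_fun setT (a i))
  (Ha : forall w, W0 Omega w -> mu * ip w w <= energy w + \sum_i ip w (wcst (a i)) ^+ 2)
  (conv : forall m i, (m < j)%N -> cvgn (fun q => ip (v q m) (wcst (a i))))
  (ltmu : (lambda Omega j < mu%:E)%E).

Let L m := limn (fun q => lam q m).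

Lemma lam_ge0 q m : (m < j)%N -> 0 <= lam q m.
Proof. by move=> h; have [_ _ _ e _] := Hv q h; rewrite -lee_fin -e; exact: lambda_ge0. Qed.

Lemma lam_mono q q' m : (m < j)%N -> (q <= q')%N -> lam q' m <= lam q m.
Proof.
move=> h qq; have [_ _ _ e _] := Hv q h; have [_ _ _ e' _] := Hv q' h.
by rewrite -lee_fin -e -e'; apply: lambda_sub; exact: Amono.
Qed.

Lemma lam_cvg m : (m < j)%N -> (fun q => lam q m) @ \oo --> L m.
Proof.
move=> h; apply: nonincreasing_is_cvgn; first by move=> q q' qq; exact: lam_mono.
by exists 0 => _ [q _ <-]; exact: lam_ge0.
Qed.

Lemma lam_lim_le q m : (m < j)%N -> L m <= lam q m.
Proof.
move=> h; apply: nonincreasing_cvgn_ge; first by move=> p q' qq; exact: lam_mono.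
by apply/cvg_ex; exists (L m); exact: lam_cvg.
Qed.

Lemma vW q m : (m < j)%N -> W0 (A q) (v q m).
Proof. by move=> h; have [] := Hv q h. Qed.

Lemma vWO q m : (m < j)%N -> W0 Omega (v q m).
Proof. by move=> h; apply: W0_sub (vW q h). Qed.

Lemma vWT q m : (m < j)%N -> W0 setT (v q m).
Proof. by move=> h; apply: W0_T (vW q h). Qed.

Lemma cvg_sum (J : Type) (r : seq J) (F : J -> nat -> R) (l : J -> R) : (forall i, F i @ \oo --> l i) ->
  (fun q => \sum_(i <- r) F i q) @ \oo --> \sum_(i <- r) l i.
Proof.
move=> H; elim: r => [|i r IH]; first by rewrite big_nil; under eq_fun do rewrite big_nil; exact: cvg_cst.
by rewrite big_cons; under eq_fun do rewrite big_cons; exact: cvgD.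
Qed.

Definition limits m (u : nat -> Wseq R d) :=
  forall m', (m' < m)%N -> W0 Omega (u m') /\ wcvg (fun q => v q m') (u m').

(** The inequality passes to the limit for a fixed test function, which belongs to all truncated
    sets from some index on; density then extends it to w. *)
Lemma limit_residual m u w : (m < j)%N -> limits m u -> W0 Omega w ->
  L m * (ip w w - \sum_(m' < m) ip w (u m') ^+ 2) <= energy w.
Proof.
move=> mj Hu Ww; have WT := W0_T Ww.
have m'j (m' : 'I_m) : (m' < j)%N := ltn_trans (ltn_ord m') mj.
have WuT (m' : 'I_m) : W0 setT (u m') by have [Wu _] := Hu m' (ltn_ord m'); exact: W0_T Wu.
have step f : test_fun Omega f -> L m * (ip (wcst f) (wcst f) - \sum_(m' < m) ip (wcst f) (u m') ^+ 2) <=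
    energy (wcst f).
  move=> tf; have [K hK] := exh tf; have WfT : W0 setT (wcst f) by apply: W0_cst; exact: test_T tf.
  have c1 : (fun q => lam q m * (ip (wcst f) (wcst f) - \sum_(m' < m) ip (wcst f) (v q m') ^+ 2)) @ \oo -->
      L m * (ip (wcst f) (wcst f) - \sum_(m' < m) ip (wcst f) (u m') ^+ 2).
    apply: cvgM; first exact: lam_cvg.
    apply: cvgB; first exact: cvg_cst.
    apply: cvg_sum => m'; under eq_fun do rewrite expr2; rewrite expr2.
    have cm := ip_conv (fun _ => WfT) (fun q => vWT q (m'j m')) WfT (WuT m') (wcvg_cst WfT) (Hu m' (ltn_ord m')).2.
    exact: cvgM.
  apply: (lim_le c1 (K := K)) => q Kq; apply: (Eig_residual (Hv q) mj).
  by apply: W0_cst; exact: hK.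
have c1 : (fun k => L m * (ip (wcst (w k)) (wcst (w k)) - \sum_(m' < m) ip (wcst (w k)) (u m') ^+ 2) -
     energy (wcst (w k))) @ \oo --> L m * (ip w w - \sum_(m' < m) ip w (u m') ^+ 2) - energy w.
  have Wk k : W0 setT (wcst (w k)) by apply: W0_cst; exact: (tW k Ww).
  have dw := wcvg_dense WT.
  apply: cvgB; last by under eq_fun do rewrite energyE; rewrite energyE; exact: (Dform_conv Wk Wk WT WT dw dw).
  apply: cvgM; first exact: cvg_cst.
  apply: cvgB; first exact: (ip_conv Wk Wk WT WT dw dw).
  apply: cvg_sum => m'; under eq_fun do rewrite expr2; rewrite expr2.
  have cm := ip_conv Wk (fun _ => WuT m') WT (WuT m') dw (wcvg_cst (WuT m')).
  exact: cvgM.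
rewrite -subr_le0; apply: (lim_le c1 (K := 0%N)) => k _; rewrite subr_le0; apply: step.
by have [/(_ k)] := Ww.
Qed.

(** Every trial space of dimension m + 1 contains a normalized vector orthogonal to the earlier
    limits, whose energy is at least [L m]. The earlier limits must exist already, so the
    convergence is proved by induction on m. *)
Lemma limit_lt m u : (m < j)%N -> limits m u -> L m < mu.
Proof.
move=> mj Hu; rewrite -lte_fin; apply: le_lt_trans ltmu; apply: le_trans (lambda_homo _ mj).
apply: lambda_ge => v' Wv' iv'.
have WuT m' : (m' < m)%N -> W0 setT (u m') by move=> h; have [Wu _] := Hu m' h; exact: W0_T Wu.
have [c [c1 [Wc pc]]] := ortho_pick_perp WuT Wv' iv'.
exists c; split=> //; have := limit_residual mj Hu Wc; rewrite c1 big1 ?subr0 ?mulr1// => m' _.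
by rewrite pc// expr0n.
Qed.

Lemma limit_step m u : (m < j)%N -> limits m u ->
  exists2 w, W0 Omega w & wcvg (fun q => v q m) w.
Proof.
move=> mj Hu; have Lmu := limit_lt mj Hu.
apply: W_completeP => [q|eps eps0]; first exact: vWO.
have L0 : 0 <= L m by apply: (lim_ge (lam_cvg mj) (K := 0%N)) => q _; exact: lam_ge0.
(* The eigenvalues decrease to [L m] and may exceed it; L' bounds them from some index on and still
   lies below mu. *)
pose L' := (L m + mu) / 2.
have [L'0 L'mu] : 0 <= L' /\ L' < mu by rewrite /L'; split; lra.
have LL' : L m < L' by rewrite /L'; lra.
have mu0 : 0 < 1 + mu by lra.
pose e := eps / (2 * (1 + mu)).
have e0 : 0 < e by rewrite divr_gt0// mulr_gt0.
(* Bounds both the variation of the eigenvalue and that of the coefficients; with S = 2 h the last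
   hypothesis of [wn_small] is an equality. The choice of e makes the final bound (1 + mu) e equal
   to eps / 2. *)
pose h := (mu - L') * e / 4.
have h0 : 0 < h by rewrite divr_gt0// mulr_gt0// subr_gt0.
have [K1 hK1] := (cvg_epsP _ _).1 (lam_cvg mj) _ h0.
have LL'0 : 0 < L' - L m by rewrite subr_gt0.
have [K2 hK2] := (cvg_epsP _ _).1 (lam_cvg mj) _ LL'0.
have [K3 hK3] := @cauchy_sum_sq R I (fun q i => ip (v q m) (wcst (a i))) (fun i => @conv m i mj) h h0.
exists (maxn K1 (maxn K2 K3)) => q q'; rewrite !geq_max => /andP[q1 /andP[q2 q3]] qq'.
have Wq := vWT q mj; have Wq' := vWT q' mj.
have Wd := W0_wadd (-1) (vWO q mj) (vWO q' mj).
set dl := wadd (v q m) (-1) (v q' m) in Wd *.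
have nq p : ip (v p m) (v p m) = 1 by rewrite (Eig_orth (Hv p) mj mj) eqxx.
have eq p : energy (v p m) = lam p m.
  by rewrite energyE (Eig_weak (Hv p) mj (vW p mj)) nq mulr1.
have Dq : Dform (v q m) (v q' m) = lam q' m * ip (v q m) (v q' m).
  rewrite DformC ipC; apply: (Eig_weak (Hv q') mj).
  by apply: W0_sub (vW q mj); exact: Amono.
have idl : ip dl dl = 2 - 2 * ip (v q m) (v q' m) by rewrite /dl (ip_sq _ Wq Wq') !nq; ring.
have edl : energy dl = lam q m - lam q' m + lam q' m * ip dl dl.
  by rewrite idl /dl (energy_sq _ Wq Wq') Dq !eq; ring.
have dl0 : 0 <= ip dl dl by apply: ip_ge0; exact: W0_T Wd.
have co := Ha Wd.
have aS : \sum_i ip dl (wcst (a i)) ^+ 2 <= h.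
  rewrite (eq_bigr (fun i => (ip (v q m) (wcst (a i)) - ip (v q' m) (wcst (a i))) ^+ 2)).
    by apply: hK3 => //; exact: leq_trans q3 qq'.
  by move=> i _; rewrite /dl (ip_wadd _ Wq Wq' (W0_cst (ta i))) mulN1r.
have l1 : lam q m - lam q' m <= h.
  have := hK1 q q1; have := lam_lim_le q' mj.
  by rewrite ltr_distlC => ? /andP[? ?]; lra.
have l2 : lam q' m <= L'.
  by have := hK2 q' (leq_trans q2 qq'); rewrite ltr_distlC => /andP[? ?]; lra.
have hq : lam q' m * ip dl dl <= L' * ip dl dl by rewrite ler_wpM2r.
have [s1 s2] : ip dl dl <= e /\ energy dl <= 2 * h + L' * e.
  apply: (wn_small (S := 2 * h) L'0 L'mu dl0); last by rewrite /h; lra.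
    by rewrite edl; lra.
  by apply: le_trans co _; lra.
rewrite wnE; apply: (@le_lt_trans _ _ ((1 + mu) * e)).
  have me : 0 < (mu - L') * e by rewrite mulr_gt0// subr_gt0.
  have hh : h * 4 = (mu - L') * e by rewrite /h divfK.
  lra.
have -> : (1 + mu) * e = eps / 2 by rewrite /e; field; lra.
lra.
Qed.

Lemma limit_family : exists u, limits j u.
Proof.
have : forall m, (m <= j)%N -> exists u, limits m u; last exact.
elim=> [|m IH] mj; first by exists (fun _ => wcst (fun _ => 0)).
have [u Hu] := IH (ltnW mj); have [w Ww vw] := limit_step mj Hu.
exists (fun m' => if (m' < m)%N then u m' else w) => m'; rewrite ltnS leq_eqVlt => /orP[/eqP ->|h].
  by rewrite ltnn.
by rewrite h; exact: Hu.
Qed.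

Lemma limit_Eig : exists2 u, Eig Omega j u L & forall m, (m < j)%N -> wcvg (fun q => v q m) (u m).
Proof.
have [u Hu] := limit_family; exists u => [m mj|m mj]; last by have [] := Hu m mj.
have Wu m' : (m' < j)%N -> W0 Omega (u m') by move=> h; have [] := Hu m' h.
have WuT m' : (m' < j)%N -> W0 setT (u m') by move=> h; apply: W0_T (Wu m' h).
have cu m' : (m' < j)%N -> wcvg (fun q => v q m') (u m') by move=> h; have [] := Hu m' h.
have Hm : limits m u by move=> m' h; apply: Hu; exact: ltn_trans mj.
split; first exact: Wu.
- move=> m' m'j.
  have c1 := ip_conv (fun q => vWT q mj) (fun q => vWT q m'j) (WuT m mj) (WuT m' m'j) (cu m mj) (cu m' m'j).
  apply: (cvg_unique (@Rhausdorff R) c1).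
  apply/cvg_epsP => e e0; exists 0%N => q _.
  by rewrite (Eig_orth (Hv q) mj m'j) subrr normr0.
- have step f : test_fun Omega f -> Dform (u m) (wcst f) = L m * ip (u m) (wcst f).
    move=> tf; have [K hK] := exh tf; have WfT : W0 setT (wcst f) by apply: W0_cst; exact: test_T tf.
    have c1 := Dform_conv (fun q => vWT q mj) (fun _ => WfT) (WuT m mj) WfT (cu m mj) (wcvg_cst WfT).
    have c2 := ip_conv (fun q => vWT q mj) (fun _ => WfT) (WuT m mj) WfT (cu m mj) (wcvg_cst WfT).
    apply: (cvg_unique (@Rhausdorff R) c1).
    have c3 : (fun q => lam q m * ip (v q m) (wcst f)) @ \oo --> L m * ip (u m) (wcst f).
      exact: cvgM (lam_cvg mj) c2.
    apply/cvg_epsP => e e0; have [K' hK'] := (cvg_epsP _ _).1 c3 e e0.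
    exists (maxn K K') => q; rewrite geq_max => /andP[Kq K'q].
    rewrite (Eig_weak (Hv q) mj (W0_cst (hK q Kq))); exact: hK'.
  move=> phi Wphi; have WT := W0_T Wphi; have dw := wcvg_dense WT.
  have Wk k : W0 setT (wcst (phi k)) by apply: W0_cst; exact: (tW k Wphi).
  have c1 := Dform_conv (fun _ => WuT m mj) Wk (WuT m mj) WT (wcvg_cst (WuT m mj)) dw.
  have c2 := ip_conv (fun _ => WuT m mj) Wk (WuT m mj) WT (wcvg_cst (WuT m mj)) dw.
  apply: (cvg_unique (@Rhausdorff R) c1).
  rewrite (_ : (fun k => Dform _ _) = fun k => L m * ip (u m) (wcst (phi k))).
    by apply: cvgM => //; exact: cvg_cst.
  by apply/funext => k; apply: step; have [/(_ k)] := Wphi.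
(* Domain monotonicity gives [lambda Omega m.+1] <= [lam q m] for every q, hence the upper bound;
   the lower one is the dimension count with [limit_residual]. *)
- apply/eqP; rewrite eq_le; apply/andP; split.
    have le0 q : (lambda Omega m.+1 <= (lam q m)%:E)%E.
      by have [_ _ _ <- _] := Hv q mj; exact: lambda_sub.
    have ge0 : (0 <= lambda Omega m.+1)%E by exact: lambda_ge0.
    case: (lambda Omega m.+1) le0 ge0 => [x|//|//] le0 _; last by have := le0 0%N.
    rewrite lee_fin; apply: (lim_ge (lam_cvg mj) (K := 0%N)) => q _.
    by rewrite -lee_fin; exact: le0.
  apply: lambda_ge => v' Wv' iv'.
  have WuT' m' : (m' < m)%N -> W0 setT (u m') by move=> h; apply: WuT; exact: ltn_trans mj.
  have [c [c1 [Wc pc]]] := ortho_pick_perp WuT' Wv' iv'.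
  exists c; split=> //; have := limit_residual mj Hm Wc; rewrite c1 big1 ?subr0 ?mulr1// => m' _.
  by rewrite pc// expr0n.
- move=> w Ww pw; have := limit_residual mj Hm Ww; rewrite big1 ?subr0// => m' _.
  by rewrite pw// expr0n.
Qed.
End Limit.

(** * Assembly on the truncated domains *)

Section Truncation.
Variable R : realType.

Lemma ereal_between (a b : \bar R) : (0 <= a)%E -> (a < b)%E ->
  exists mu mu0 : R, [/\ 0 <= mu, mu < mu0, (a < mu%:E)%E & (mu0%:E <= b)%E].
Proof.
case: a => [x||]; [|by move=> _; rewrite ltNge leey|by []].
rewrite lee_fin; case: b => [y| |] // x0.
  rewrite lte_fin => xy; exists ((2 * x + y) / 3), ((x + 2 * y) / 3).
  by split; rewrite ?lte_fin ?lee_fin; lra.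
by move=> _; exists (x + 1), (x + 2); split; rewrite ?lte_fin ?leey//; lra.
Qed.

Lemma norm_le_sq (z b : R) : z ^+ 2 <= b -> `|z| <= 1 + b.
Proof.
rewrite -real_normK ?num_real//; move: `|z| => y yb.
have : 0 <= (2 * y - 1) ^+ 2 by exact: sqr_ge0.
nra.
Qed.

Lemma L2dist_wcvg d (U : nat -> Wseq R d) u : (forall q, W0 setT (U q)) -> W0 setT u -> wcvg U u ->
  (fun q => L2dist (U q) u) @ \oo --> (0 : R).
Proof.
move=> WU Wu cU; apply/cvg_epsP => e e0; have e20 : 0 < e ^+ 2 by rewrite exprn_gt0.
have [K hK] := cU _ e20; exists K => q Kq.
have -> : L2dist (U q) u = Num.sqrt (ip (wadd (U q) (-1) u) (wadd (U q) (-1) u)).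
  have eqw : (fun k => U q k \- u k) = wadd (U q) (-1) u.
    by apply/funext => k; rewrite subE wadd_at.
  by rewrite /L2dist eqw.
have Wd := W0_wadd (-1) (WU q) Wu.
rewrite sub0r normrN ger0_norm ?sqrtr_ge0// -(gtr0_norm e0) -sqrtr_sqr ltr_sqrt//.
apply: le_lt_trans (hK q Kq); rewrite wnE lerDl; exact: energy_ge0.
Qed.

Lemma Eig_eigfun d (A : set 'rV[R]_d) j u l m : Eig A j u l -> (m < j)%N ->
  eigfun A (lambda A m.+1) (u m).
Proof.
move=> H mj; have [Wu o w e _] := H m mj; split; first by split=> //; rewrite o// eqxx.
by exists (l m).
Qed.

Lemma Eig_energy d (A : set 'rV[R]_d) j u l m : Eig A j u l -> (m < j)%N -> energy (u m) = l m.
Proof.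
move=> H mj; have [Wu o w e _] := H m mj.
by rewrite energyE (w _ Wu) (o m mj) eqxx mulr1.
Qed.

End Truncation.
(* N = n.+1 with n >= 1 (i.e. N >= 2); E_i live in R^(N-1) = R^n. *)
Theorem mainTheorem5 (R : realType) (n : nat) (Omega0 : set 'rV[R]_n.+1)
  (k : nat) (E : 'I_k -> set 'rV[R]_n) (M : 'I_k -> 'M[R]_n.+1)
  (t : 'I_k -> 'rV[R]_n.+1) (r0 : R) (ell : nat) :
  (1 <= n)%N ->
  (0 < k)%N ->
  (* (A1) *)
  open Omega0 -> bounded_set Omega0 ->
  (* (A2) *)
  (forall i, open (E i) /\ bounded_set (E i) /\ connected (E i)) ->
  (forall i, orthogonal_mx (M i)) ->
  (* (A3) *)
  (exists rho0 : R, 0 < rho0 /\ forall i j : 'I_k, i != j ->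
     (cylinder (E i) (M i) (t i) `&` cylinder (E j) (M j) (t j))
       `\` [set x | enorm x < rho0] = set0) ->
  (* choice of r0 *)
  0 < r0 ->
  (forall r : R, r0 <= r ->
     let C := fun i => cylinder (E i) (M i) (t i) in
     let Omega := Omega0 `|` \bigcup_(i in [set: 'I_k]) C i in
     let Omega_r := Omega0 `|` \bigcup_(i in [set: 'I_k]) (cube (M i) (t i) r `&` C i) in
     Omega `\` Omega_r = \bigcup_(i in [set: 'I_k]) (C i `\` cube (M i) (t i) r) /\
     (forall i j : 'I_k, i != j ->
        (C i `\` cube (M i) (t i) r) `&` (C j `\` cube (M j) (t j) r) = set0)) ->
  let C := fun i => cylinder (E i) (M i) (t i) in
  let Omega := Omega0 `|` \bigcup_(i in [set: 'I_k]) C i in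
  let Omega_r := fun r : R =>
    Omega0 `|` \bigcup_(i in [set: 'I_k]) (cube (M i) (t i) r `&` C i) in
  let EE := \big[Order.min/+oo%E]_(i < k) lambda (E i) 1 in
  (2 <= ell)%N ->
  (lambda Omega ell < EE)%E ->
  forall j : nat, (1 <= j <= ell)%N ->
  exists u : 'I_j -> Wseq R n.+1,
    (* (1) *)
    orthonormal_fam u /\
    (forall m : 'I_j, eigfun Omega (lambda Omega m.+1) (u m)) /\
    (forall m : 'I_j, m.+1 = j ->
       lambda Omega j = (energy (u m))%:E /\
       forall w : Wseq R n.+1, S2 Omega w ->
         (forall m' : 'I_j, (m' < m)%N -> ip w (u m') = 0) ->
         energy (u m) <= energy w) /\
    (* (2) *)
    exists un : nat -> 'I_j -> Wseq R n.+1,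
      (forall p : nat, r0 <= p%:R ->
         orthonormal_fam (un p) /\
         forall m : 'I_j,
           eigfun (Omega_r p%:R) (lambda (Omega_r p%:R) m.+1) (un p m)) /\
      exists sigma : nat -> nat,
        (forall q, (sigma q < sigma q.+1)%N) /\
        (forall q, r0 <= (sigma q)%:R) /\
        forall m : 'I_j,
          (fun q => L2dist (un (sigma q) m) (u m)) @ \oo --> (0 : R).
Proof.
move=> n1 k0 oO bO hE MM _ r0_gt0 hr0 C Omega Omega_r EE ell2 ltE j /andP[j1 jell].
have oE i : open (E i) by have [] := hE i.
have bE i : bounded_set (E i) by have [_ []] := hE i.
have ell0 : (0 < ell)%N by exact: ltn_trans ell2.
(* [mu] is the level of coercivity on Omega and [mu0] the Poincare level of the cross-sections; the
   cutting off uses up the gap between them. *)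
have [mu [mu0 [mu_ge0 lt_mu a_lt ge_b]]] := ereal_between (lambda_ge0 Omega ell0) ltE.
have hmu0 i : (mu0%:E <= lambda (E i) 1)%E.
  by apply: le_trans ge_b _; exact: bigmin_le_cond.
have ltj : (lambda Omega j < mu%:E)%E by exact: le_lt_trans (lambda_homo _ jell) a_lt.
have lt1 : (lambda Omega 1 < mu0%:E)%E.
  apply: le_lt_trans (lambda_homo Omega j1) _; apply: lt_trans ltj _; by rewrite lte_fin.
have EigP (p : nat) : exists vl : (nat -> Wseq R n.+1) * (nat -> R),
    r0 <= p%:R -> Eig (Omega_r p%:R) j vl.1 vl.2.
  (* Below [r0] nothing is claimed; the dummy value makes the choice total. *)
  have [r0p|] := leP r0 p%:R; last by move=> _; exists (fun _ => wcst (fun _ => 0), fun _ => 0).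
  have pp : 0 < p%:R :> R := lt_le_trans r0_gt0 r0p.
  have [x Ox] := Omega_r_nonempty oE MM hr0 r0p lt1 hmu0.
  have [B hB] := lambda_fin j (Omega_r_open oO oE MM pp) Ox.
  have B1 : 0 <= `|B| + 1 by rewrite addr_ge0.
  (* Coercivity on the bounded set holds at any level, here one above its finite j-th value. *)
  have cB := Omega_r_coercive E t bO MM pp B1.
  have lB : (lambda (Omega_r p%:R) j < (`|B| + 1)%:E)%E.
    by apply: le_lt_trans hB _; rewrite lte_fin ltr_pwDr// ler_norm.
  have [v [l H]] := Eig_exists cB lB.
  by exists (v, l).
have [vl Hvl] := choice EigP.
have [I [a [ta Ha]]] := Omega_coercive oO bO oE bE MM r0_gt0 hr0 mu_ge0 lt_mu hmu0.
(* From this index on every truncation is admissible. *)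
pose p0 := Num.bound r0.
have p0r (q : nat) : r0 <= (p0 + q)%:R.
  apply: ltW; apply: lt_le_trans (archi_boundP (ltW r0_gt0)) _.
  by rewrite ler_nat leq_addr.
have Heig q := Hvl _ (p0r q).
(* Eigenfunctions and test functions are indexed jointly, so that one subsequence serves every m. *)
pose x (q : nat) (i : 'I_j * I) := ip ((vl (p0 + q)%N).1 i.1) (wcst (a i.2)).
have aT i : W0 setT (wcst (a i)) by exact: W0_cst.
have xb q i : `|x q i| <= 1 + \sum_i ip (wcst (a i)) (wcst (a i)).
  apply: norm_le_sq; have [Wv _ _ _ _] := Heig q i.1 (ltn_ord i.1).
  apply: (le_trans (ip_CS (W0_T Wv) (aT i.2))); rewrite (Eig_orth (Heig q) (ltn_ord i.1) (ltn_ord i.1)) eqxx mul1r.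
  by rewrite (bigD1 i.2 isT) lerDl; apply: sumr_ge0 => i' _; exact: ip_ge0 (aT i').
have [s [incs cvs]] := bolzano_weierstrass_fin xb.
pose sigma q := (p0 + s q)%N.
have sig_ge q : (q <= sigma q)%N by apply: leq_trans (incr_ge incs q) (leq_addl _ _).
have sig_mono q q' : (q <= q')%N -> (sigma q <= sigma q')%N.
  by move=> qq; rewrite leq_add2l; exact: incr_homo.
have [||||||||u Hu cu] := @limit_Eig R n.+1 Omega (fun q => Omega_r (sigma q)%:R)
  (fun q => (vl (sigma q)).1) (fun q => (vl (sigma q)).2) j mu I a.
- by move=> q q' qq; apply: Omega_r_mono; rewrite ler_nat; exact: sig_mono.
- by move=> q; exact: Omega_r_sub.
- move=> f tf; have [r rp tr] := test_exhaust MM tf; exists (Num.bound r) => q rq.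
  apply: test_sub tr; apply: Omega_r_mono; apply: ltW; apply: lt_le_trans (archi_boundP (ltW rp)) _.
  by rewrite ler_nat; exact: leq_trans rq (sig_ge q).
- by move=> q; exact: Heig.
- exact: ta.
- exact: Ha.
- by move=> m i mj; exact: (cvs (Ordinal mj, i)).
- exact: ltj.
have WuT m : (m < j)%N -> W0 setT (u m) by move=> mj; have [W _ _ _ _] := Hu m mj; exact: W0_T W.
exists (fun m : 'I_j => u m); split; [|split; [|split]].
- by move=> m m'; rewrite (Eig_orth Hu).
- by move=> m; exact: Eig_eigfun Hu (ltn_ord m).
- move=> m mj; have [_ _ _ e h] := Hu m (ltn_ord m).
  have em := Eig_energy Hu (ltn_ord m); split; first by rewrite em -e mj.
  by move=> w [Ww w1] wo; rewrite em -[leLHS]mulr1 -w1; apply: h => // m' m'm; exact: (wo (Ordinal (ltn_trans m'm (ltn_ord m))) m'm).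
exists (fun p (m : 'I_j) => (vl p).1 m); split.
  move=> p r0p; have H := Hvl p r0p; split; first by move=> m m'; rewrite (Eig_orth H).
  by move=> m; exact: Eig_eigfun H (ltn_ord m).
exists sigma; split; [|split].
- by move=> q; rewrite ltn_add2l; exact: incs.
- by move=> q; exact: p0r.
- move=> m; have WvT q : W0 setT ((vl (sigma q)).1 m).
    by have [W _ _ _ _] := Heig (s q) m (ltn_ord m); exact: W0_T W.
  exact: (@L2dist_wcvg R _ (fun q => (vl (sigma q)).1 m) (u m) WvT (WuT m (ltn_ord m)) (cu m (ltn_ord m))).
Qed.
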